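(* Let $k$ be a field, $G=\mathrm{GL}_4\times\mathrm{GL}_3$, $W=\mathbb{A}^4$, $V=\wedge^2W\otimes\mathbb{A}^3\oplus W$ with the natural action, and $U=\{x\in V\mid P_1(x)\neq0,\ P_2(x)\neq0\}$ with $P_1,P_2$ as defined in the context. Then $G_k\backslash U_k$ is in bijective correspondence with $\mathrm{Prg}_2(k)$. If $x\in U_k$, the corresponding $k$-form of $\mathrm{PGL}_2$ is the stabilizer $G_x$.
   Context: $\mathrm{Prg}_2(k)$ is the set of $k$-isomorphism classes of $k$-forms of $\mathrm{PGL}_2$. Elements of $V$ are written $x=(x_1,x_2,x_3,x_0)$ with $x_1,x_2,x_3\in\wedge^2W$, $x_0\in W$; $(g_1,g_2)\in G$ acts by the natural action of $\mathrm{GL}_4\times\mathrm{GL}_3$ on $\wedge^2W\otimes\mathbb{A}^3$ and by $g_1$ on $W$. Identify $\wedge^4W\cong\mathbb{A}^1$ via the standard basis. $P_1$: let $\Phi_1(x)=\sum_{\sigma\in\mathfrak{S}_3}\mathrm{sgn}(\sigma)\,x_{\sigma(1)}\otimes x_{\sigma(2)}\otimes x_{\sigma(3)}$ and, for $x_0\in W$, let $\Phi_{2,x_0}:\wedge^2W\otimes\wedge^2W\otimes\wedge^2W\to\wedge^4W\otimes\wedge^4W\cong\mathbb{A}^1$ be the linear map with $$\Phi_{2,x_0}(a_1\otimes a_2\otimes(b_1\wedge b_2))=(a_1\wedge b_1\wedge x_0)(a_2\wedge b_2\wedge x_0)-(a_1\wedge b_2\wedge x_0)(a_2\wedge b_1\wedge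 x_0).$$ Then $P_1(x)=-\frac16\Phi_{2,x_0}(\Phi_1(x))$; this has coefficients in $\mathbb{Z}$ and is therefore defined over any $k$. $P_2$: let $\Phi_3(x)$ be the Pfaffian of the $4\times4$ alternating matrix $u_1x_1+u_2x_2+u_3x_3$, a ternary quadratic form in $u=(u_1,u_2,u_3)$, and let $\Phi_4$ be the degree $3$ homogeneous polynomial on ternary quadratic forms such that $\Phi_4(u_1u_3+u_2^2)=1$ and $\Phi_4(hQ)=(\det h)^2\Phi_4(Q)$ for $h\in\mathrm{GL}_3$; explicitly $\Phi_4(au_1^2+bu_1u_2+cu_1u_3+du_2^2+eu_2u_3+fu_3^2)=ae^2+dc^2+fb^2-4adf-bce$. Then $P_2(x)=\Phi_4(\Phi_3(x))$. *)

(* Defs.v *)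
From HB Require Import structures.
From mathcomp Require Import all_boot all_order all_fingroup all_algebra.
From mathcomp Require Import separable.
From mathcomp Require Import ring.
From mathcomp Require Import boolp classical_sets functions.

Set Implicit Arguments.
Unset Strict Implicit.
Unset Printing Implicit Defensive.

Import GRing.Theory.

Local Open Scope classical_set_scope.
Local Open Scope ring_scope.

(* Affine algebraic groups over a field, as functors of points.  Algebras are
   non-zero (comAlgType); a representable functor is determined by its
   restriction to these. *)

Record kgroup (k : fieldType) := KGroup {
  points :> comAlgType k -> groupType;
  pmap : forall R S : comAlgType k,
    {lrmorphism R -> S} -> points R -> points S;
  pmapM : forall (R S : comAlgType k) (f : {lrmorphism R -> S}),
    {morph pmap f : x y / (x * y)%g};
  pmap_id : forall (R : comAlgType k) (x : points R),
    pmap (idfun : {lrmorphism R -> R}) x = x;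
  pmap_comp : forall (R S T : comAlgType k) (g : {lrmorphism S -> T})
    (f : {lrmorphism R -> S}) (x : points R),
    pmap (g \o f : {lrmorphism R -> T}) x = pmap g (pmap f x)
}.

Definition kiso (k : fieldType) (G H : kgroup k) : Prop :=
  exists phi : forall R : comAlgType k, G R -> H R,
    [/\ forall R, bijective (phi R),
        forall R, {morph phi R : x y / (x * y)%g}
      & forall (R S : comAlgType k) (f : {lrmorphism R -> S}) (x : G R),
          phi S (pmap f x) = pmap f (phi R x)].

Definition finitely_generated (k : fieldType) (A : comAlgType k) : Prop :=
  exists s : seq A, forall B : {pred A},
    GRing.subalg_closed B -> {subset s <= B} -> forall a, a \in B.

Definition affine_algebraic (k : fieldType) (G : kgroup k) : Prop :=
  exists2 A : comAlgType k, finitely_generated A &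
    exists phi : forall R : comAlgType k, {lrmorphism A -> R} -> G R,
      (forall R, bijective (phi R)) /\
      (forall (R S : comAlgType k) (f : {lrmorphism R -> S})
              (a : {lrmorphism A -> R}),
          phi S (f \o a : {lrmorphism A -> S}) = pmap f (phi R a)).

(* Restriction of scalars of algebras along iota : k -> K. *)

Definition resalg (k K : fieldType) (iota : {rmorphism k -> K})
  (R : comAlgType K) : Type := R.

Section ResAlg.
Variables (k K : fieldType) (iota : {rmorphism k -> K}).

Section Instances.
Variable R : comAlgType K.

HB.instance Definition _ := GRing.ComNzRing.on (resalg iota R).

Definition resalg_scale (a : k) (x : resalg iota R) : resalg iota R :=
  iota a *: (x : R).

Fact resalg_scaleA a b x :
  resalg_scale a (resalg_scale b x) = resalg_scale (a * b) x.
Proof. by rewrite /resalg_scale rmorphM scalerA. Qed.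
Fact resalg_scale1 : left_id 1 resalg_scale.
Proof. by move=> x; rewrite /resalg_scale rmorph1 scale1r. Qed.
Fact resalg_scaleDr : right_distributive resalg_scale +%R.
Proof. by move=> a x y; rewrite /resalg_scale scalerDr. Qed.
Fact resalg_scaleDl x : {morph resalg_scale^~ x : a b / a + b}.
Proof. by move=> a b; rewrite /resalg_scale rmorphD scalerDl. Qed.

HB.instance Definition _ := GRing.Zmodule_isLmodule.Build k (resalg iota R)
  resalg_scaleA resalg_scale1 resalg_scaleDr resalg_scaleDl.

Fact resalg_scaleAl (a : k) (x y : resalg iota R) : a *: (x * y) = a *: x * y.
Proof. exact: (@scalerAl K R (iota a) x y). Qed.
HB.instance Definition _ :=
  GRing.Lmodule_isLalgebra.Build k (resalg iota R) resalg_scaleAl.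

Fact resalg_scaleAr (a : k) (x y : resalg iota R) : a *: (x * y) = x * (a *: y).
Proof. exact: (@scalerAr K R (iota a) x y). Qed.
HB.instance Definition _ :=
  GRing.Lalgebra_isAlgebra.Build k (resalg iota R) resalg_scaleAr.

End Instances.

Section Morphisms.
Variables (R S : comAlgType K) (f : {lrmorphism R -> S}).

Definition resalg_mor (x : resalg iota R) : resalg iota S := f x.

Fact resalg_mor_is_zmod_morphism : zmod_morphism resalg_mor.
Proof. exact: (raddfB f). Qed.
Fact resalg_mor_is_monoid_morphism : monoid_morphism resalg_mor.
Proof. by split; [exact: (rmorph1 f) | exact: (rmorphM f)]. Qed.
Fact resalg_mor_is_scalable : scalable resalg_mor.
Proof. by move=> a x; exact: (linearZ_LR f). Qed.
HB.instance Definition _ := GRing.isZmodMorphism.Build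
  (resalg iota R) (resalg iota S) resalg_mor resalg_mor_is_zmod_morphism.
HB.instance Definition _ := GRing.isMonoidMorphism.Build
  (resalg iota R) (resalg iota S) resalg_mor resalg_mor_is_monoid_morphism.
HB.instance Definition _ := GRing.isScalable.Build
  k (resalg iota R) (resalg iota S) *:%R resalg_mor resalg_mor_is_scalable.

End Morphisms.
End ResAlg.

Arguments resalg_mor {k K} iota {R S} f x.

Lemma lrmorphism_ext (k : fieldType) (R S : comAlgType k)
  (f g : {lrmorphism R -> S}) : f =1 g -> f = g.
Proof.
case: f g => [f Cf] [g Cg] /= /funext fg; rewrite /= in fg *.
subst g; congr (GRing.LRMorphism.Pack _).
case: Cf => [[a] [b] [c]]; case: Cg => [[a'] [b'] [c']].
by rewrite (Prop_irrelevance a a') (Prop_irrelevance b b') (Prop_irrelevance c c').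
Qed.


Fact base_change_pmap_id (k K : fieldType) (iota : {rmorphism k -> K})
  (G : kgroup k) (R : comAlgType K) (x : G (resalg iota R)) :
  pmap (resalg_mor iota (idfun : {lrmorphism R -> R}) : {lrmorphism _ -> _}) x
    = x.
Proof.
by rewrite -[RHS]pmap_id; congr (pmap _ x); apply: lrmorphism_ext.
Qed.

Fact base_change_pmap_comp (k K : fieldType) (iota : {rmorphism k -> K})
  (G : kgroup k) (R S T : comAlgType K) (g : {lrmorphism S -> T})
  (f : {lrmorphism R -> S}) (x : G (resalg iota R)) :
  pmap (resalg_mor iota (g \o f : {lrmorphism R -> T}) : {lrmorphism _ -> _}) x
    = pmap (resalg_mor iota g : {lrmorphism _ -> _})
        (pmap (resalg_mor iota f : {lrmorphism _ -> _}) x).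
Proof.
by rewrite -pmap_comp; congr (pmap _ x); apply: lrmorphism_ext.
Qed.

Definition base_change (k K : fieldType) (iota : {rmorphism k -> K})
    (G : kgroup k) : kgroup K :=
  @KGroup K (fun R => G (resalg iota R))
    (fun R S f => pmap (resalg_mor iota f : {lrmorphism _ -> _}))
    (fun R S f => pmapM (resalg_mor iota f : {lrmorphism _ -> _}))
    (@base_change_pmap_id k K iota G)
    (@base_change_pmap_comp k K iota G).

Definition separable_algebraic (k K : fieldType) (iota : {rmorphism k -> K}) :
    Prop :=
  forall z : K, exists2 p : {poly k},
    separable_poly p & root (map_poly iota p) z.

(* A k-form of G becomes isomorphic to G over the separable closure k^sep.
   Since isomorphisms are preserved by base change and every separable
   algebraic extension of k embeds into k^sep, this is the same as becoming
   isomorphic to G over some separable algebraic extension. *)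
Definition kform (k : fieldType) (G H : kgroup k) : Prop :=
  affine_algebraic H /\
  exists (K : fieldType) (iota : {rmorphism k -> K}),
    separable_algebraic iota /\ kiso (base_change iota H) (base_change iota G).

Definition isoclass (k : fieldType) (H : kgroup k) : kgroup k -> Prop :=
  fun H' => kiso H H'.

Definition Prg (k : fieldType) (G : kgroup k) : Type :=
  {C : kgroup k -> Prop | exists2 H, kform G H & C = isoclass H}.
(* GL n R for an arbitrary commutative ring R: a matrix with its inverse. *)

Record GL (n : nat) (R : comNzRingType) := MkGL {
  GLpair : 'M[R]_n * 'M[R]_n;
  _ : GLpair.1 *m GLpair.2 == 1%:M
}.

HB.instance Definition _ n R := [isSub for @GLpair n R].
HB.instance Definition _ n R := [Choice of GL n R by <:].

Section GLTheory.
Variables (n : nat) (R : comNzRingType).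
Implicit Types g h : GL n R.

Definition GLmx g : 'M[R]_n := (val g).1.
Definition GLinvmx g : 'M[R]_n := (val g).2.

Lemma GLmulV g : GLmx g *m GLinvmx g = 1%:M.
Proof. exact/eqP/(valP g). Qed.
Lemma GLmulVl g : GLinvmx g *m GLmx g = 1%:M.
Proof. exact/mulmx1C/GLmulV. Qed.

Lemma GLmx_inj : injective GLmx.
Proof.
move=> g h gh; apply/val_inj.
have : GLinvmx g = GLinvmx h.
  by rewrite -[LHS]mulmx1 -(GLmulV h) -gh mulmxA GLmulVl mul1mx.
move: gh; rewrite /GLmx /GLinvmx.
by case: (val g) (val h) => a b [c d] /= -> ->.
Qed.

Fact GL_one_subproof : (1%:M : 'M[R]_n) *m 1%:M == 1%:M.
Proof. by rewrite mulmx1. Qed.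
Definition GL_one : GL n R := @MkGL n R (1%:M, 1%:M) GL_one_subproof.

Fact GL_mul_subproof g h :
  (GLmx g *m GLmx h) *m (GLinvmx h *m GLinvmx g) == 1%:M.
Proof.
by rewrite mulmxA -[X in X *m _]mulmxA GLmulV mulmx1 GLmulV.
Qed.
Definition GL_mul g h : GL n R := @MkGL n R (_, _) (GL_mul_subproof g h).

Fact GL_inv_subproof g : GLinvmx g *m GLmx g == 1%:M.
Proof. by rewrite GLmulVl. Qed.
Definition GL_inv g : GL n R := @MkGL n R (_, _) (GL_inv_subproof g).

Fact GL_mulA : associative GL_mul.
Proof. by move=> g h l; apply: GLmx_inj; exact: mulmxA. Qed.
Fact GL_mul1g : left_id GL_one GL_mul.
Proof. by move=> g; apply: GLmx_inj; exact: mul1mx. Qed.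
Fact GL_mulg1 : right_id GL_one GL_mul.
Proof. by move=> g; apply: GLmx_inj; exact: mulmx1. Qed.
Fact GL_mulVg : left_inverse GL_one GL_inv GL_mul.
Proof. by move=> g; apply: GLmx_inj; exact: GLmulVl. Qed.
Fact GL_mulgV : right_inverse GL_one GL_inv GL_mul.
Proof. by move=> g; apply: GLmx_inj; exact: GLmulV. Qed.

HB.instance Definition _ := isGroup.Build (GL n R)
  GL_mulA GL_mul1g GL_mulg1 GL_mulVg GL_mulgV.

End GLTheory.

Section GLMap.
Variables (n : nat) (R S : comNzRingType) (f : {rmorphism R -> S}).

Fact GLmap_subproof (g : GL n R) :
  map_mx f (GLmx g) *m map_mx f (GLinvmx g) == 1%:M.
Proof. by rewrite -map_mxM GLmulV map_mx1. Qed.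
Definition GLmap (g : GL n R) : GL n S := @MkGL n S (_, _) (GLmap_subproof g).

Lemma GLmapM : {morph GLmap : g h / (g * h)%g}.
Proof. by move=> g h; apply: GLmx_inj; exact: map_mxM. Qed.

End GLMap.

Section KGroups.
Variable k : fieldType.

Fact GLmap_id n (R : comAlgType k) (g : GL n R) :
  GLmap (idfun : {lrmorphism R -> R}) g = g.
Proof. by apply: GLmx_inj; apply/matrixP=> i j; rewrite /GLmx /= mxE. Qed.

Fact GLmap_comp n (R S T : comAlgType k) (b : {lrmorphism S -> T})
  (a : {lrmorphism R -> S}) (g : GL n R) :
  GLmap (b \o a : {lrmorphism R -> T}) g = GLmap b (GLmap a g).
Proof. by apply: GLmx_inj; apply/matrixP=> i j; rewrite /GLmx /= !mxE. Qed.

Definition GLk (n : nat) : kgroup k :=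
  @KGroup k (fun R => GL n R) (fun R S f => GLmap f)
    (fun R S f => GLmapM f) (@GLmap_id n) (@GLmap_comp n).

Definition prod_kgroup (G H : kgroup k) : kgroup k.
Proof.
refine (@KGroup k (fun R => G R * H R)%type
  (fun R S f x => (pmap f x.1, pmap f x.2)) _ _ _).
- by move=> R S f [x1 x2] [y1 y2]; congr (_, _); exact: pmapM.
- by move=> R [x1 x2]; congr (_, _); exact: pmap_id.
- by move=> R S T g f [x1 x2]; congr (_, _); exact: pmap_comp.
Defined.

End KGroups.
Record subgrp (G : groupType) (P : {pred G}) (gP : group_closed P) :=
  SubGrp { subgrp_val : G; _ : subgrp_val \in P }.

Section SubGroup.
Variables (G : groupType) (P : {pred G}) (gP : group_closed P).

HB.instance Definition _ := [isSub for @subgrp_val G P gP].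
HB.instance Definition _ := [Choice of subgrp gP by <:].
HB.instance Definition _ := SubChoice_isSubGroup.Build G P (subgrp gP) gP.

End SubGroup.

Section SubKGroup.
Variables (k : fieldType) (G : kgroup k) (P : forall R, {pred G R}).
Hypothesis gP : forall R, group_closed (@P R).
Hypothesis mP : forall (R S : comAlgType k) (f : {lrmorphism R -> S}) (x : G R),
  x \in @P R -> pmap f x \in @P S.

Definition sub_pmap (R S : comAlgType k) (f : {lrmorphism R -> S})
  (x : subgrp (gP R)) : subgrp (gP S) := SubGrp (gP S) (mP f (valP x)).

Fact sub_pmapM (R S : comAlgType k) (f : {lrmorphism R -> S}) :
  {morph sub_pmap f : x y / (x * y)%g}.
Proof. by move=> x y; apply: val_inj; exact: pmapM. Qed.

Fact sub_pmap_id (R : comAlgType k) (x : subgrp (gP R)) :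
  sub_pmap (idfun : {lrmorphism R -> R}) x = x.
Proof. by apply: val_inj; exact: pmap_id. Qed.

Fact sub_pmap_comp (R S T : comAlgType k) (g : {lrmorphism S -> T})
  (f : {lrmorphism R -> S}) (x : subgrp (gP R)) :
  sub_pmap (g \o f : {lrmorphism R -> T}) x = sub_pmap g (sub_pmap f x).
Proof. by apply: val_inj; exact: pmap_comp. Qed.

Definition sub_kgroup : kgroup k :=
  @KGroup k (fun R => subgrp (gP R)) sub_pmap sub_pmapM sub_pmap_id
    sub_pmap_comp.

End SubKGroup.

(* PGL_2, as the group scheme of algebra automorphisms of M_2; GL2_conj,
   GL2_conj_kernel and autM2_locally_conj below show that conjugation makes it
   the Zariski-sheaf quotient of GL_2 by the scalar matrices. *)

Section AutM2.
Variable R : comNzRingType.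
Implicit Types (u v : GL (2 * 2) R) (a b : 'M[R]_2).

(* transposed so that composition of endomorphisms matches the product *)
Definition endM2 u a : 'M[R]_2 := vec_mx (mxvec a *m (GLmx u)^T).

Fact endM2_is_linear u : linear (endM2 u).
Proof. by move=> c a b; rewrite /endM2 linearP mulmxDl -scalemxAl linearP. Qed.
HB.instance Definition _ u := GRing.isLinear.Build R 'M[R]_2 'M[R]_2 *:%R
  (endM2 u) (endM2_is_linear u).

Lemma endM2_1 a : endM2 1%g a = a.
Proof. by rewrite /endM2 trmx1 mulmx1 mxvecK. Qed.

Lemma endM2_M u v a : endM2 (u * v)%g a = endM2 u (endM2 v a).
Proof. by rewrite /endM2 vec_mxK -mulmxA -trmx_mul. Qed.

Definition autM2 : {pred GL (2 * 2) R} := fun u =>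
  (endM2 u 1%:M == 1%:M) &&
  [forall i : 'I_2, forall j : 'I_2, forall p : 'I_2, forall q : 'I_2,
     endM2 u (delta_mx i j *m delta_mx p q)
       == endM2 u (delta_mx i j) *m endM2 u (delta_mx p q)].

Lemma autM2P u : reflect
  (endM2 u 1%:M = 1%:M /\ {morph endM2 u : a b / a *m b}) (u \in autM2).
Proof.
apply: (iffP andP) => [[/eqP u1 uM]|[u1 uM]]; last first.
  by split; [exact/eqP | do 4![apply/forallP => ?]; rewrite uM].
split=> //.
have uMd i j b : endM2 u (delta_mx i j *m b)
    = endM2 u (delta_mx i j) *m endM2 u b.
  rewrite [b]matrix_sum_delta mulmx_sumr [LHS]raddf_sum [in RHS]raddf_sum.
  rewrite mulmx_sumr; apply: eq_bigr => p _.
  rewrite mulmx_sumr [LHS]raddf_sum [in RHS]raddf_sum.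
  rewrite mulmx_sumr; apply: eq_bigr => q _.
  rewrite -scalemxAr /= !linearZ /= -?scalemxAr.
  by move: uM => /forallP/(_ i)/forallP/(_ j)/forallP/(_ p)/forallP/(_ q)/eqP ->.
move=> a b /=; rewrite [a]matrix_sum_delta.
rewrite mulmx_suml [LHS]raddf_sum [in RHS]raddf_sum.
rewrite mulmx_suml; apply: eq_bigr => i _.
rewrite mulmx_suml [LHS]raddf_sum [in RHS]raddf_sum.
rewrite mulmx_suml; apply: eq_bigr => j _.
by rewrite -scalemxAl /= !linearZ /= uMd -scalemxAl.
Qed.

Lemma autM2_group_closed : group_closed autM2.
Proof.
split=> [|u v /autM2P[u1 uM] /autM2P[v1 vM]].
  by apply/autM2P; split=> [|a b]; rewrite !endM2_1.
have vK a : endM2 v (endM2 v^-1%g a) = a by rewrite -endM2_M mulgV endM2_1.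
have Kv a : endM2 v^-1%g (endM2 v a) = a by rewrite -endM2_M mulVg endM2_1.
apply/autM2P; split=> [|a b]; rewrite !endM2_M.
  by rewrite -[in endM2 v^-1%g _]v1 Kv.
by rewrite -uM; congr endM2; rewrite -[RHS]Kv vM !vK.
Qed.

End AutM2.

Arguments autM2 R : clear implicits.
Arguments autM2_group_closed R : clear implicits.

Lemma endM2_map (R S : comNzRingType) (f : {rmorphism R -> S})
  (u : GL (2 * 2) R) (a : 'M[R]_2) :
  endM2 (GLmap f u) (map_mx f a) = map_mx f (endM2 u a).
Proof. by rewrite /endM2 map_vec_mx map_mxM map_trmx map_mxvec. Qed.

Lemma autM2_map (R S : comNzRingType) (f : {rmorphism R -> S})
  (u : GL (2 * 2) R) : u \in autM2 R -> GLmap f u \in autM2 S.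
Proof.
move=> /autM2P[u1 uM]; apply/andP; split.
  by rewrite -[1%:M](map_mx1 f) endM2_map u1.
do 4![apply/forallP => ?].
by rewrite -!(map_delta_mx f) -map_mxM !endM2_map uM map_mxM.
Qed.

Definition PGL2 (k : fieldType) : kgroup k :=
  @sub_kgroup k (GLk k (2 * 2)) (fun R => autM2 R)
    (fun R => autM2_group_closed R) (fun R S f x => @autM2_map R S f x).

Lemma GL2_conj (R : comNzRingType) (g : GL 2 R) :
  exists2 u : GL (2 * 2) R, u \in autM2 R &
    forall a, endM2 u a = GLmx g *m a *m GLinvmx g.
Proof.
pose c (h : GL 2 R) (a : 'M[R]_2) := GLmx h *m a *m GLinvmx h.
have c_lin h : linear (c h).
  by move=> x a b; rewrite /c linearP mulmxDl /= -!scalemxAl.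
pose cL h : {linear 'M[R]_2 -> 'M[R]_2} :=
  HB.pack (c h) (GRing.isLinear.Build R 'M[R]_2 'M[R]_2 *:%R (c h) (c_lin h)).
have cK : (lin_mx (cL g))^T *m (lin_mx (cL g^-1%g))^T == 1%:M.
  rewrite -trmx_mul -[1%:M]trmx1 (inj_eq trmx_inj); apply/eqP/row_matrixP=> i.
  rewrite rowE [RHS]rowE mulmx1 mulmxA -[delta_mx 0 i]vec_mxK.
  rewrite !mul_vec_lin /= /c /GLmx /GLinvmx /= !mulmxA.
  by rewrite [_.1 *m _.2]GLmulV mul1mx -mulmxA [_.1 *m _.2]GLmulV mulmx1.
have cE a : endM2 (MkGL (GLpair := (_, _)) cK) a = c g a.
  by rewrite /endM2 trmxK mul_vec_lin mxvecK.
exists (MkGL (GLpair := (_, _)) cK) => //; apply/autM2P; split=> [|a b].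
  by rewrite cE /c mulmx1 GLmulV.
rewrite !cE /c -!mulmxA; congr (_ *m (_ *m _)).
by rewrite !mulmxA GLmulVl mul1mx.
Qed.

Lemma GL2_conj_kernel (R : comNzRingType) (g : GL 2 R) :
  (forall a, GLmx g *m a *m GLinvmx g = a) <-> exists c, GLmx g = c%:M.
Proof.
split=> [gC|[c gc] a]; last first.
  by rewrite gc mul_scalar_mx -mul_mx_scalar -mulmxA -gc GLmulV mulmx1.
have {}gC a : GLmx g *m a = a *m GLmx g.
  by rewrite -[in RHS](gC a) -mulmxA GLmulVl mulmx1.
have gE i j p q := congr1 (fun a : 'M[R]_2 => a p q) (gC (delta_mx i j)).
exists (GLmx g 0 0); apply/matrixP=> i j.
have := gE j 0 i 0; rewrite !mxE.
rewrite (bigD1 j) //= big1 ?addr0 => [|l /negPf lj]; last first.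
  by rewrite mxE lj mulr0.
rewrite !mxE !eqxx mulr1 => ->.
rewrite (bigD1 0) //= big1 ?addr0 => [|l /negPf l0]; last first.
  by rewrite mxE l0 andbF mul0r.
by rewrite !mxE eqxx andbT; case: (i == j); rewrite ?mul1r ?mul0r.
Qed.

Lemma autM2_locally_conj (R : comNzRingType) (u : GL (2 * 2) R) :
  u \in autM2 R ->
  exists (g h : 'M[R]_2) (r s : R),
    [/\ r * \det g + s * \det h = 1,
        forall a, endM2 u a *m g = g *m a
      & forall a, endM2 u a *m h = h *m a].
Proof.
move=> /autM2P[u1 uM]; pose f := endM2 u.
pose E (i j : 'I_2) : 'M[R]_2 := delta_mx i j.
pose g i j := \sum_l f (E l i) *m E j l.
pose h i j := \sum_l E l i *m f (E j l).
have gP i j a : f a *m g i j = g i j *m a.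
  rewrite mulmx_sumr mulmx_suml.
  transitivity (\sum_l \sum_m a m l *: (f (E m i) *m E j l)).
    apply: eq_bigr => l _; rewrite mulmxA -uM.
    have -> : a *m E l i = \sum_m a m l *: E m i.
      apply/matrixP=> p q; rewrite !mxE summxE (bigD1 l) //=.
      rewrite big1 => [|m /negPf ml]; last by rewrite mxE ml mulr0.
      rewrite (bigD1 p) //= big1 => [|m /negPf mp]; last first.
        by rewrite !mxE eq_sym mp mulr0.
      by rewrite !mxE !eqxx.
    rewrite /f raddf_sum mulmx_suml; apply: eq_bigr => m _.
    by rewrite /= linearZ -scalemxAl.
  rewrite exchange_big; apply: eq_bigr => m _.
  have -> : f (E m i) *m E j m *m a = \sum_l a m l *: (f (E m i) *m E j l).
    rewrite -mulmxA.
    have -> : E j m *m a = \sum_l a m l *: E j l.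
      apply/matrixP=> p q; rewrite !mxE summxE (bigD1 m) //=.
      rewrite big1 => [|l /negPf lm]; last first.
        by rewrite mxE lm andbF mul0r.
      rewrite (bigD1 q) //= big1 => [|l /negPf lq]; last first.
        by rewrite !mxE [q == l]eq_sym lq andbF mulr0.
      by rewrite !mxE !eqxx !andbT !addr0 mulrC.
    by rewrite mulmx_sumr; apply: eq_bigr => l _; rewrite -scalemxAr.
  by [].
have hgE i j p q : h i j *m g p q = (f (E j p) i q)%:M.
  rewrite /h mulmx_suml [RHS]scalar_mx_sum_delta.
  apply: eq_bigr => l _; rewrite mulmx_sumr (bigD1 l) //=.
  rewrite big1 ?addr0 => [|m /negPf ml]; last first.
    rewrite mulmxA -[_ *m f (E j l) *m _]mulmxA -uM.
    rewrite mul_delta_mx_0 ?(eq_sym l) ?ml //.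
    by rewrite /f raddf0 mulmx0 mul0mx.
  rewrite mulmxA -[_ *m f (E j l) *m _]mulmxA -uM mul_delta_mx -/(E j p).
  apply/matrixP=> a b; rewrite !mxE (bigD1 q) //=.
  rewrite big1 => [|c /negPf cq]; last first.
    by rewrite [E q l _ _]mxE cq mulr0.
  rewrite !mxE (bigD1 i) //= big1 => [|c /negPf ci]; last first.
    by rewrite [E l i _ _]mxE ci andbF mul0r.
  rewrite !mxE !eqxx andbT addr0 addr0 /=.
  by case: (a == l); case: (b == l); rewrite ?mul1r ?mulr1 ?mul0r ?mulr0.
pose x := f (E 0 0) 0 0; pose y := f (E 1 1) 0 0.
have xy1 : x + y = 1.
  have o1 : lift ord0 ord0 = 1 :> 'I_2 by exact/val_inj.
  have e1 : 1%:M = E 0 0 + E 1 1.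
    by rewrite mx1_sum_delta !big_ord_recl big_ord0 addr0 o1.
  have fe1 : f (E 0 0) + f (E 1 1) = 1%:M by rewrite -raddfD /= -e1.
  by have := congr1 (fun a : 'M[R]_2 => a 0 0) fe1; rewrite mxE [RHS]mxE.
have xE : x ^+ 2 = \det (h 0 0) * \det (g 0 0).
  by rewrite -det_mulmx hgE det_scalar.
have yE : y ^+ 2 = \det (h 0 1) * \det (g 1 0).
  by rewrite -det_mulmx hgE det_scalar.
exists (g 0 0), (g 1 0), ((x + 3%:R * y) * \det (h 0 0)),
  ((y + 3%:R * x) * \det (h 0 1)).
split=> [||]; [|exact: gP|exact: gP].
rewrite -!mulrA -xE -yE; transitivity ((x + y) ^+ 3); first by ring.
by rewrite xy1 expr1n.
Qed.

(* The representation.  W = A^4 consists of column vectors; /\^2 W is identified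
   with the alternating 4 x 4 matrices, b1 /\ b2 being b1 b2^T - b2 b1^T, so that
   g acts by a |-> g a g^T.  x.1 has the components x_1, x_2, x_3, indexed
   by 0, 1, 2, and x.2 is x_0. *)

Definition Vspace (R : comNzRingType) : Type :=
  ({ffun 'I_3 -> 'M[R]_4} * 'cV[R]_4)%type.

Definition alternating (R : comNzRingType) (a : 'M[R]_4) : bool :=
  (a^T == - a) && [forall i, a i i == 0].

Definition inV (R : comNzRingType) (x : Vspace R) : bool :=
  [forall i, alternating (x.1 i)].

Section Representation.
Variable R : comNzRingType.
Implicit Types (a : 'M[R]_4) (b : 'cV[R]_4) (x : Vspace R).

Definition act (g : GL 4 R * GL 3 R) (x : Vspace R) : Vspace R :=
  ([ffun j => \sum_i GLmx g.2 j i *: (GLmx g.1 *m x.1 i *m (GLmx g.1)^T)],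
   GLmx g.1 *m x.2).

Lemma act1 x : act 1%g x = x.
Proof.
case: x => x x0; congr (_, _); last exact: mul1mx.
apply/ffunP=> j; rewrite ffunE (bigD1 j) //= big1 ?addr0 => [|i /negPf ij].
  by rewrite mxE eqxx scale1r mul1mx trmx1 mulmx1.
by rewrite mxE eq_sym ij scale0r.
Qed.

Lemma actM g h x : act (g * h)%g x = act g (act h x).
Proof.
congr (_, _); last by rewrite mulmxA.
apply/ffunP=> j; rewrite !ffunE.
under [RHS]eq_bigr => i _ do
  rewrite ffunE mulmx_sumr mulmx_suml scaler_sumr.
rewrite exchange_big; apply: eq_bigr => i _ /=.
rewrite mxE scaler_suml; apply: eq_bigr => l _.
rewrite -scalemxAr -scalemxAl scalerA; congr (_ *: _).
by rewrite [in LHS]/GLmx /= trmx_mul !mulmxA.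
Qed.

Lemma alternatingP a :
  reflect (exists c : 'M[R]_4, a = c - c^T) (alternating a).
Proof.
apply: (iffP andP) => [[/eqP aT /forallP a0]|[c ->]]; last first.
  split; first by rewrite linearB /= trmxK opprB.
  by apply/forallP=> i; rewrite !mxE subrr.
exists (\matrix_(i, j) if (i < j)%N then a i j else 0).
apply/matrixP=> i j; rewrite !mxE.
have aN : a j i = - a i j by rewrite -[in RHS](trmxK a) aT !mxE opprK.
case: ltngtP => [||ij]; rewrite ?subr0 ?sub0r ?subrr //.
  by rewrite aN opprK.
by rewrite (val_inj ij); exact/eqP/a0.
Qed.

Lemma act_inV g x : inV x -> inV (act g x).
Proof.
move=> /forallP xV; apply/forallP=> j; apply/alternatingP; rewrite ffunE.
have [c cE] := fin_all_exists (fun i => elimT (alternatingP _) (xV i)).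
exists (\sum_i GLmx g.2 j i *: (GLmx g.1 *m c i *m (GLmx g.1)^T)).
rewrite [in RHS]raddf_sum -sumrB; apply: eq_bigr => i _ /=.
rewrite {1}cE.
by rewrite linearZ /= !trmx_mul trmxK mulmxBr mulmxBl scalerBr !mulmxA.
Qed.

(* Pfaffian of an alternating matrix, its polarization a1 /\ a2 in
   /\^4 W = A^1, and b1 /\ b2 in /\^2 W *)
Definition pf a : R :=
  a 0 1 * a 2%:R 3%:R - a 0 2%:R * a 1 3%:R + a 0 3%:R * a 1 2%:R.

Definition wedge22 a1 a2 : R :=
  a1 0 1 * a2 2%:R 3%:R - a1 0 2%:R * a2 1 3%:R + a1 0 3%:R * a2 1 2%:R
  + a1 1 2%:R * a2 0 3%:R - a1 1 3%:R * a2 0 2%:R + a1 2%:R 3%:R * a2 0 1.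

Definition wedge11 b1 b2 : 'M[R]_4 := b1 *m b2^T - b2 *m b1^T.

Definition wedge211 a b1 b2 : R := wedge22 a (wedge11 b1 b2).

Definition Phi2_wedge (x0 : 'cV[R]_4) a1 a2 b1 b2 : R :=
  wedge211 a1 b1 x0 * wedge211 a2 b2 x0 - wedge211 a1 b2 x0 * wedge211 a2 b1 x0.

Definition vecW (i : 'I_4) : 'cV[R]_4 := delta_mx i 0.

(* a3 = sum_(p < q) (a3)_pq e_p /\ e_q *)
Definition Phi2 (x0 : 'cV[R]_4) a1 a2 a3 : R :=
  \sum_(p < 4) \sum_(q < 4 | (p < q)%N) a3 p q * Phi2_wedge x0 a1 a2 (vecW p) (vecW q).

(* Phi_2 (Phi_1 x) *)
Definition Phi2_Phi1 x : R :=
  \sum_(s : 'S_3) (-1) ^+ s *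
    Phi2 x.2 (x.1 (s 0)) (x.1 (s 1)) (x.1 (s 2%:R)).

(* By Phi2_Phi1E this is -1/6 Phi_2(Phi_1(x)), as a polynomial over Z. *)
Definition P1 x : R := - Phi2 x.2 (x.1 0) (x.1 1) (x.1 2%:R).

Lemma wedge11E b1 b2 i j :
  wedge11 b1 b2 i j = b1 i 0 * b2 j 0 - b2 i 0 * b1 j 0.
Proof. by rewrite !mxE !big_ord1 !mxE. Qed.

Lemma sum4 (F : 'I_4 -> R) : \sum_i F i = F 0 + F 1 + F 2%:R + F 3%:R.
Proof.
rewrite !big_ord_recl big_ord0 addr0 !addrA.
by congr (_ + F _ + F _ + F _); apply: val_inj.
Qed.

Lemma sum4_lt (F : 'I_4 -> 'I_4 -> R) :
  \sum_(p < 4) \sum_(q < 4 | (p < q)%N) F p q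
  = F 0 1 + F 0 2%:R + F 0 3%:R + F 1 2%:R + F 1 3%:R + F 2%:R 3%:R.
Proof.
under eq_bigr => p _ do rewrite big_mkcond sum4.
by rewrite sum4 /= !add0r !addr0 !addrA.
Qed.

Lemma wedge211E a b (x0 : 'cV[R]_4) :
  wedge211 a b x0 = \sum_p b p 0 * wedge211 a (vecW p) x0.
Proof.
rewrite sum4 /wedge211 /wedge22 !wedge11E !mxE /=.
ring.
Qed.

Lemma Phi2E (x0 : 'cV[R]_4) a1 a2 b1 b2 :
  Phi2 x0 a1 a2 (wedge11 b1 b2) = Phi2_wedge x0 a1 a2 b1 b2.
Proof.
rewrite /Phi2 sum4_lt /Phi2_wedge !(wedge211E _ b1) !(wedge211E _ b2) !sum4.
rewrite !wedge11E; ring.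
Qed.

Lemma Phi2_swap12 (x0 : 'cV[R]_4) a1 a2 a3 : Phi2 x0 a2 a1 a3 = - Phi2 x0 a1 a2 a3.
Proof. by rewrite /Phi2 !sum4_lt /Phi2_wedge; ring. Qed.

Lemma Phi2_swap23 (x0 : 'cV[R]_4) a1 a2 a3 : Phi2 x0 a1 a3 a2 = - Phi2 x0 a1 a2 a3.
Proof.
rewrite /Phi2 !sum4_lt /Phi2_wedge /wedge211 /wedge22 !wedge11E !mxE /=; ring.
Qed.

Lemma Phi2_perm (x0 : 'cV[R]_4) (X : 'I_3 -> 'M[R]_4) (s : 'S_3) :
  Phi2 x0 (X (s 0)) (X (s 1)) (X (s 2%:R))
  = (-1) ^+ s * Phi2 x0 (X 0) (X 1) (X 2%:R).
Proof.
have swap02 a1 a2 a3 : Phi2 x0 a3 a2 a1 = - Phi2 x0 a1 a2 a3.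
  by rewrite Phi2_swap12 Phi2_swap23 Phi2_swap12 !opprK.
have [ts -> dts] := prod_tpermP s.
elim: ts dts X => [_|[i j] ts IH /= /andP[ij /IH{}IH]] X.
  by rewrite big_nil !perm1 odd_perm1 mul1r.
have swap (Y : 'I_3 -> 'M[R]_4) :
    Phi2 x0 (Y (tperm i j 0)) (Y (tperm i j 1)) (Y (tperm i j 2%:R))
    = - Phi2 x0 (Y 0) (Y 1) (Y 2%:R).
  case: i j ij => [[|[|[|//]]] ?] [[|[|[|//]]] ?] //= _; rewrite !permE /=;
    first [ rewrite -Phi2_swap12; congr (Phi2 _ (Y _) (Y _) (Y _)); exact: val_inj
          | rewrite -Phi2_swap23; congr (Phi2 _ (Y _) (Y _) (Y _)); exact: val_inj
          | rewrite -swap02; congr (Phi2 _ (Y _) (Y _) (Y _)); exact: val_inj ].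
rewrite big_cons odd_mul_tperm ij !permM (swap (X \o _)) /= IH.
by case: (odd_perm _); rewrite /= ?expr0 ?expr1 ?mulN1r ?mul1r ?opprK.
Qed.

Lemma Phi2_Phi1E x : Phi2_Phi1 x = - 6%:R * P1 x.
Proof.
rewrite /Phi2_Phi1 (eq_bigr (fun=> - P1 x)) => [|s _]; last first.
  by rewrite Phi2_perm mulrA -expr2 sqrr_sign mul1r opprK.
by rewrite sumr_const card_Sn mulNr mulrC mulr_natr mulNrn.
Qed.

(* the ternary quadratic form a u1^2 + b u1 u2 + c u1 u3 + d u2^2 + e u2 u3
   + f u3^2 *)
Record tqform := TQForm { qa : R; qb : R; qc : R; qd : R; qe : R; qf : R }.

Definition tqeval (Q : tqform) (u : 'I_3 -> R) : R :=
  qa Q * u 0 ^+ 2 + qb Q * (u 0 * u 1) + qc Q * (u 0 * u 2%:R)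
  + qd Q * u 1 ^+ 2 + qe Q * (u 1 * u 2%:R) + qf Q * u 2%:R ^+ 2.

(* the coefficients of pf (u1 x1 + u2 x2 + u3 x3), see Phi3E *)
Definition Phi3 x : tqform :=
  TQForm (pf (x.1 0)) (wedge22 (x.1 0) (x.1 1)) (wedge22 (x.1 0) (x.1 2%:R))
         (pf (x.1 1)) (wedge22 (x.1 1) (x.1 2%:R)) (pf (x.1 2%:R)).

Lemma Phi3E x (u : 'I_3 -> R) : tqeval (Phi3 x) u = pf (\sum_i u i *: x.1 i).
Proof.
have o1 : lift ord0 ord0 = 1 :> 'I_3 by exact: val_inj.
have o2 : lift ord0 (lift ord0 ord0) = 2%:R :> 'I_3 by exact: val_inj.
rewrite /tqeval /= /pf /wedge22 !big_ord_recl big_ord0 addr0 !o2 !o1 !mxE.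
ring.
Qed.

Definition Phi4 (Q : tqform) : R :=
  let: TQForm a b c d e f := Q in
  a * e ^+ 2 + d * c ^+ 2 + f * b ^+ 2 - 4%:R * a * d * f - b * c * e.

Definition P2 x : R := Phi4 (Phi3 x).

End Representation.

Definition Vmap (R S : comNzRingType) (f : {rmorphism R -> S})
  (x : Vspace R) : Vspace S := ([ffun i => map_mx f (x.1 i)], map_mx f x.2).

Lemma act_map (R S : comNzRingType) (f : {rmorphism R -> S})
  (g : GL 4 R * GL 3 R) (x : Vspace R) :
  Vmap f (act g x) = act (GLmap f g.1, GLmap f g.2) (Vmap f x).
Proof.
congr (_, _); last exact: map_mxM.
apply/ffunP=> j; rewrite !ffunE raddf_sum; apply: eq_bigr => i _ /=.
by rewrite map_mxZ !map_mxM map_trmx ffunE [in RHS]/GLmx /= mxE.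
Qed.

Section Stabilizer.
Variables (k : fieldType) (x : Vspace k).

Definition Gk : kgroup k := prod_kgroup (GLk k 4) (GLk k 3).

Definition stab_pred (R : comAlgType k) : {pred Gk R} :=
  fun g => act g (Vmap (in_alg R) x) == Vmap (in_alg R) x.

Fact stab_group_closed (R : comAlgType k) : group_closed (@stab_pred R).
Proof.
split=> [|g h /eqP gx /eqP hx]; apply/eqP; first exact: act1.
by rewrite -[in LHS]hx -actM mulgVK.
Qed.

Fact stab_pmap (R S : comAlgType k) (f : {lrmorphism R -> S}) (g : Gk R) :
  g \in @stab_pred R -> pmap f g \in @stab_pred S.
Proof.
move=> /eqP gx; apply/eqP.
have <- : Vmap f (Vmap (in_alg R) x) = Vmap (in_alg S) x.
  congr (_, _); last by apply/matrixP=> i j; rewrite !mxE /= rmorph_alg.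
  by apply/ffunP=> l; apply/matrixP=> i j; rewrite !ffunE !mxE /= rmorph_alg.
by rewrite -[in RHS]gx act_map.
Qed.

Definition stab : kgroup k := sub_kgroup stab_group_closed stab_pmap.

End Stabilizer.

Definition U (k : fieldType) : set (Vspace k) :=
  [set x | [/\ inV x, P1 x != 0 & P2 x != 0]].

Definition Gorbit (k : fieldType) (x : Vspace k) : set (Vspace k) :=
  [set act g x | g in [set: GL 4 k * GL 3 k]].

Definition orbits (k : fieldType) : Type :=
  {O : set (Vspace k) | exists2 x, U x & O = Gorbit x}.

Definition orbit_of (k : fieldType) (x : Vspace k) (Ux : U x) : orbits k :=
  exist _ (Gorbit x) (ex_intro2 _ _ x Ux erefl).

Definition Prg2 (k : fieldType) : Type := Prg (PGL2 k).

(* Main.v *)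
From HB Require Import structures.
From mathcomp Require Import all_boot fingroup all_algebra.
From mathcomp Require Import falgebra separable fieldext ring.
From mathcomp Require Import boolp classical_sets functions.
Require Import Defs.

(* For x in U put q = Phi3(x) and l_i(w) = x_i /\ w /\ x0. The vectors x0,
   -x_2 l_1, x_2 l_0, -x_1 l_0 (contracting the bivectors x_i with the linear
   forms l_j) depend equivariantly on x and form a basis of W, in which x
   becomes, up to a scalar, a normal form depending only on q. Hence orbits are
   nondegenerate ternary quadratic forms up to similarity, and the stabilizer
   of x is SO(q). Moreover PGL_2 is SO(u1 u3 + u2^2), acting on sl_2, and every
   q becomes similar to u1 u3 + u2^2 over a separable extension, as it acquires
   a zero there.

   It remains to recover q from the abstract group, without Galois cohomology.
   The tangent space of SO(q) at 1 is free of rank 3 and its adjoint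
   representation is the dual of the standard one. For a form H of PGL_2, split
   by K/k, a basis of the tangent space over K yields one over k, so the
   adjoint representation is defined over k; applying a k-linear functional
   K -> k to an invariant quadratic form over K gives one over k. This is again
   nondegenerate because the only invariant forms of SO(u1 u3 + u2^2) are the
   multiples of u1 u3 + u2^2, as two unipotent one-parameter subgroups already
   show. The resulting map H -> SO(q) is an isomorphism over K, hence over k by
   descent along R -> R (x) K. The same uniqueness shows that isomorphic groups
   SO(q) come from similar forms. *)

Set Implicit Arguments.
Unset Strict Implicit.
Unset Printing Implicit Defensive.

Import GRing.Theory.

Local Open Scope ring_scope.

(** Characteristic 2 shapes the proof. There the polar form of a ternary form is singular, so a form
    is not determined by its polarization, and so(q) cannot be found by inverting a Gram matrix.
    Forms are therefore kept as six coefficients, and tangent vectors are written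
    [crossmx v *m polmx Q]; this parametrisation is bijective as soon as [Phi4 Q] is a unit, and it
    is where the dual of the standard representation comes from. That representation is faithful in
    every characteristic, which is why the adjoint representation is enough to recover the group.
    The extension K/k may be infinite, so the only tool for descent is a k-linear retraction of k ->
    K. It brings derivations and forms back from K to k, and it makes R (x) K faithful enough to
    recover R. Groups being functors, tangent vectors are points over R + R^n eps for all R and n;
    one point over k + k^3 eps then encodes a basis that is compatible with every base change. *)

Lemma sum3 (V : nmodType) (F : 'I_3 -> V) : \sum_i F i = F 0 + F 1 + F 2%:R.
Proof.
rewrite !big_ord_recl big_ord0 addr0 !addrA.
by congr (_ + F _ + F _); apply: val_inj.
Qed.

Lemma ord3P (P : 'I_3 -> Prop) : P 0 -> P 1 -> P 2%:R -> forall i, P i.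
Proof.
move=> p0 p1 p2 [[|[|[|//]]] h].
- by rewrite [Ordinal h](_ : _ = 0) //; exact: val_inj.
- by rewrite [Ordinal h](_ : _ = 1) //; exact: val_inj.
- by rewrite [Ordinal h](_ : _ = 2%:R) //; exact: val_inj.
Qed.

Lemma ord4P (P : 'I_4 -> Prop) :
  P 0 -> P 1 -> P 2%:R -> P 3%:R -> forall i, P i.
Proof.
move=> p0 p1 p2 p3 [[|[|[|[|//]]]] h].
- by rewrite [Ordinal h](_ : _ = 0) //; exact: val_inj.
- by rewrite [Ordinal h](_ : _ = 1) //; exact: val_inj.
- by rewrite [Ordinal h](_ : _ = 2%:R) //; exact: val_inj.
- by rewrite [Ordinal h](_ : _ = 3%:R) //; exact: val_inj.
Qed.

(** * Ternary quadratic forms *)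

Section Forms.
Variable R : comNzRingType.
Implicit Types (Q : tqform R) (h : 'M[R]_3) (a : 'M[R]_4).

Lemma det_mx2 (m : 'M[R]_2) : \det m = m 0 0 * m 1 1 - m 0 1 * m 1 0.
Proof.
rewrite (expand_det_row _ 0) !big_ord_recl big_ord0 /cofactor !det_mx11 !mxE.
have -> : lift 0 0 = 1 :> 'I_2 by exact: val_inj.
have -> : lift 1 0 = 0 :> 'I_2 by exact: val_inj.
rewrite /=; ring.
Qed.

Lemma det3 h : \det h =
  h 0 0 * (h 1 1 * h 2%:R 2%:R - h 1 2%:R * h 2%:R 1)
  - h 0 1 * (h 1 0 * h 2%:R 2%:R - h 1 2%:R * h 2%:R 0)
  + h 0 2%:R * (h 1 0 * h 2%:R 1 - h 1 1 * h 2%:R 0).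
Proof.
rewrite (expand_det_row _ 0) sum3 /cofactor !det_mx2 !mxE.
have -> : lift 0 0 = 1 :> 'I_3 by exact: val_inj.
have -> : lift 0 1 = 2%:R :> 'I_3 by exact: val_inj.
have -> : lift 1 0 = 0 :> 'I_3 by exact: val_inj.
have -> : lift 1 1 = 2%:R :> 'I_3 by exact: val_inj.
have -> : lift 2%:R 0 = 0 :> 'I_3 by exact: val_inj.
have -> : lift 2%:R 1 = 1 :> 'I_3 by exact: val_inj.
rewrite /=; ring.
Qed.

Lemma det4 a : \det a =
  a 0 0 * (a 1 1 * (a 2%:R 2%:R * a 3%:R 3%:R - a 2%:R 3%:R * a 3%:R 2%:R)
   - a 1 2%:R * (a 2%:R 1 * a 3%:R 3%:R - a 2%:R 3%:R * a 3%:R 1)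
   + a 1 3%:R * (a 2%:R 1 * a 3%:R 2%:R - a 2%:R 2%:R * a 3%:R 1))
  - a 0 1 * (a 1 0 * (a 2%:R 2%:R * a 3%:R 3%:R - a 2%:R 3%:R * a 3%:R 2%:R)
   - a 1 2%:R * (a 2%:R 0 * a 3%:R 3%:R - a 2%:R 3%:R * a 3%:R 0)
   + a 1 3%:R * (a 2%:R 0 * a 3%:R 2%:R - a 2%:R 2%:R * a 3%:R 0))
  + a 0 2%:R * (a 1 0 * (a 2%:R 1 * a 3%:R 3%:R - a 2%:R 3%:R * a 3%:R 1)
   - a 1 1 * (a 2%:R 0 * a 3%:R 3%:R - a 2%:R 3%:R * a 3%:R 0)
   + a 1 3%:R * (a 2%:R 0 * a 3%:R 1 - a 2%:R 1 * a 3%:R 0))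
  - a 0 3%:R * (a 1 0 * (a 2%:R 1 * a 3%:R 2%:R - a 2%:R 2%:R * a 3%:R 1)
   - a 1 1 * (a 2%:R 0 * a 3%:R 2%:R - a 2%:R 2%:R * a 3%:R 0)
   + a 1 2%:R * (a 2%:R 0 * a 3%:R 1 - a 2%:R 1 * a 3%:R 0)).
Proof.
rewrite (expand_det_row _ 0) sum4 /cofactor !det3 !mxE.
do 12?[rewrite (_ : lift 0 0 = 1 :> 'I_4); last exact: val_inj].
do 12?[rewrite (_ : lift 0 1 = 2%:R :> 'I_4); last exact: val_inj].
do 12?[rewrite (_ : lift 0 2%:R = 3%:R :> 'I_4); last exact: val_inj].
do 12?[rewrite (_ : lift 1 0 = 0 :> 'I_4); last exact: val_inj].
do 12?[rewrite (_ : lift 1 1 = 2%:R :> 'I_4); last exact: val_inj].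
do 12?[rewrite (_ : lift 1 2%:R = 3%:R :> 'I_4); last exact: val_inj].
do 12?[rewrite (_ : lift 2%:R 0 = 0 :> 'I_4); last exact: val_inj].
do 12?[rewrite (_ : lift 2%:R 1 = 1 :> 'I_4); last exact: val_inj].
do 12?[rewrite (_ : lift 2%:R 2%:R = 3%:R :> 'I_4); last exact: val_inj].
do 12?[rewrite (_ : lift 3%:R 0 = 0 :> 'I_4); last exact: val_inj].
do 12?[rewrite (_ : lift 3%:R 1 = 1 :> 'I_4); last exact: val_inj].
do 12?[rewrite (_ : lift 3%:R 2%:R = 2%:R :> 'I_4); last exact: val_inj].
rewrite /=; ring.
Qed.

Definition qval Q (u : 'cV[R]_3) : R := tqeval Q (fun i => u i 0).

(** The polarization Q(u + v) - Q(u) - Q(v), expanded. *)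
Definition qpol Q (u v : 'cV[R]_3) : R :=
  qa Q * (u 0 0 * v 0 0) *+ 2 + qb Q * (u 0 0 * v 1 0 + u 1 0 * v 0 0)
  + qc Q * (u 0 0 * v 2%:R 0 + u 2%:R 0 * v 0 0) + qd Q * (u 1 0 * v 1 0) *+ 2
  + qe Q * (u 1 0 * v 2%:R 0 + u 2%:R 0 * v 1 0)
  + qf Q * (u 2%:R 0 * v 2%:R 0) *+ 2.

(** The form u |-> Q(h u). Its square coefficients are values of [Q] and its mixed ones are
    polarizations, so the formula is valid when 2 = 0. *)
Definition qcomp Q h : tqform R :=
  TQForm (qval Q (col 0 h)) (qpol Q (col 0 h) (col 1 h))
    (qpol Q (col 0 h) (col 2%:R h)) (qval Q (col 1 h))
    (qpol Q (col 1 h) (col 2%:R h)) (qval Q (col 2%:R h)).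

Definition qscale (c : R) Q : tqform R :=
  TQForm (c * qa Q) (c * qb Q) (c * qc Q) (c * qd Q) (c * qe Q) (c * qf Q).

Lemma qcompM Q g h : qcomp (qcomp Q g) h = qcomp Q (g *m h).
Proof.
by rewrite /qcomp /qval /qpol /tqeval /= !mxE !sum3; congr TQForm; ring.
Qed.

Lemma qcomp1 Q : qcomp Q 1%:M = Q.
Proof.
case: Q => a b c d e f; rewrite /qcomp /qval /qpol /tqeval /= !mxE /=.
congr TQForm; ring.
Qed.

Lemma qcomp_scale c Q h : qcomp (qscale c Q) h = qscale c (qcomp Q h).
Proof. by rewrite /qcomp /qscale /qval /qpol /tqeval /=; congr TQForm; ring. Qed.

Lemma qscaleA b c Q : qscale b (qscale c Q) = qscale (b * c) Q.
Proof. by rewrite /qscale /= !mulrA. Qed.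

Lemma qscale1 Q : qscale 1 Q = Q.
Proof. by case: Q => *; rewrite /qscale /= !mul1r. Qed.

(** [Phi4] is the half-discriminant: the Gram matrix of [qpol Q] has determinant -2 [Phi4 Q]. It
    scales like that determinant and stays meaningful when 2 = 0. *)
Lemma Phi4_qcomp Q h : Phi4 (qcomp Q h) = \det h ^+ 2 * Phi4 Q.
Proof.
case: Q => a b c d e f.
by rewrite /Phi4 /qcomp /qval /qpol /tqeval /= det3 !mxE; ring.
Qed.

Lemma Phi4_qscale c Q : Phi4 (qscale c Q) = c ^+ 3 * Phi4 Q.
Proof. by case: Q => *; rewrite /Phi4 /qscale /=; ring. Qed.

End Forms.

(** * The representation and its invariants *)

Section Rep.
Variable R : comNzRingType.
Implicit Types (Q : tqform R) (h : 'M[R]_3) (a b g : 'M[R]_4) (x : Vspace R).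

(** Six free entries, so that statements about alternating matrices become polynomial identities for
    [ring]. *)
Definition altmx (p q r s t u : R) : 'M[R]_4 :=
  \matrix_(i, j) nth 0 (nth [::] [:: [:: 0; p; q; r]; [:: - p; 0; s; t];
    [:: - q; - s; 0; u]; [:: - r; - t; - u; 0]] i) j.

Lemma altmxE a : alternating a ->
  a = altmx (a 0 1) (a 0 2%:R) (a 0 3%:R) (a 1 2%:R) (a 1 3%:R) (a 2%:R 3%:R).
Proof.
case/andP=> /eqP/matrixP aT /forallP a0.
have aN i j : a j i = - a i j by have := aT i j; rewrite !mxE.
apply/matrixP; apply: ord4P; apply: ord4P;
  by rewrite !mxE /= ?(eqP (a0 _)) // aN.
Qed.

Lemma alternating_altmx p q r s t u : alternating (altmx p q r s t u).
Proof.
apply/andP; split; last by apply/forallP; apply: ord4P; rewrite !mxE.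
apply/eqP/matrixP; apply: ord4P; apply: ord4P; by rewrite !mxE /= ?oppr0 ?opprK.
Qed.

Lemma pf_conj g a : alternating a -> pf (g *m a *m g^T) = \det g * pf a.
Proof.
move=> /altmxE ->; rewrite /pf !mxE !sum4 !mxE !sum4 !mxE /= det4.
ring.
Qed.

Lemma wedge22_pf a b : wedge22 a b = pf (a + b) - pf a - pf b.
Proof. by rewrite /wedge22 /pf !mxE; ring. Qed.

Lemma alternatingD a b : alternating a -> alternating b -> alternating (a + b).
Proof.
move=> /andP[/eqP aT /forallP a0] /andP[/eqP bT /forallP b0].
apply/andP; split; first by rewrite linearD /= aT bT opprD.
by apply/forallP=> i; rewrite mxE (eqP (a0 i)) (eqP (b0 i)) addr0.
Qed.

Lemma wedge22_conj g a b : alternating a -> alternating b ->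
  wedge22 (g *m a *m g^T) (g *m b *m g^T) = \det g * wedge22 a b.
Proof.
move=> aA bA; rewrite !wedge22_pf -mulmxDl -mulmxDr !pf_conj ?alternatingD //.
by rewrite !mulrBr.
Qed.

Lemma alternating_wedge11 u v : alternating (@wedge11 R u v).
Proof.
apply/alternatingP; exists (u *m v^T).
by rewrite trmx_mul trmxK.
Qed.

Lemma wedge11_mul g u v : wedge11 (g *m u) (g *m v) = g *m wedge11 u v *m g^T.
Proof. by rewrite /wedge11 !trmx_mul mulmxBr mulmxBl !mulmxA. Qed.

Lemma wedge211_conj g a u v : alternating a ->
  wedge211 (g *m a *m g^T) (g *m u) (g *m v) = \det g * wedge211 a u v.
Proof.
by move=> aA; rewrite /wedge211 wedge11_mul wedge22_conj ?alternating_wedge11.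
Qed.

Lemma sum4_ltV (V : nmodType) (F : 'I_4 -> 'I_4 -> V) :
  \sum_(p < 4) \sum_(q < 4 | (p < q)%N) F p q
  = F 0 1 + F 0 2%:R + F 0 3%:R + F 1 2%:R + F 1 3%:R + F 2%:R 3%:R.
Proof.
have sum4V (G : 'I_4 -> V) : \sum_i G i = G 0 + G 1 + G 2%:R + G 3%:R.
  rewrite !big_ord_recl big_ord0 addr0 !addrA.
  by congr (_ + G _ + G _ + G _); apply: val_inj.
under eq_bigr => p _ do rewrite big_mkcond sum4V.
by rewrite sum4V /= !add0r !addr0 !addrA.
Qed.

Lemma altmx_sum a : alternating a ->
  a = \sum_(p < 4) \sum_(q < 4 | (p < q)%N) a p q *: wedge11 (vecW R p) (vecW R q).
Proof.
move=> /altmxE ->; set p := a 0 1; set q := a 0 2%:R; set r := a 0 3%:R.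
set s := a 1 2%:R; set t := a 1 3%:R; set u := a 2%:R 3%:R; clearbody p q r s t u.
apply/matrixP=> i j; rewrite sum4_ltV !(wedge11E, mxE) /=.
move: i j; apply: ord4P; apply: ord4P;
  by rewrite /= !(mulr0, mulr1, mul0r, subr0, sub0r, mulrN, addr0, add0r, oppr0).
Qed.

Lemma Phi2_sum (I : Type) (r : seq I) (P : pred I) (F : I -> 'M[R]_4) (c : I -> R) (x0 : 'cV[R]_4) a b :
  Phi2 x0 a b (\sum_(i <- r | P i) c i *: F i) = \sum_(i <- r | P i) c i * Phi2 x0 a b (F i).
Proof.
elim/big_rec2: _ => [|i y1 y2 _ <-]; first by rewrite /Phi2 sum4_lt !mxE; ring.
by rewrite /Phi2 !sum4_lt !mxE; ring.
Qed.

Lemma Phi2_sum2 (c : 'I_4 -> 'I_4 -> R) (F : 'I_4 -> 'I_4 -> 'M[R]_4) (x0 : 'cV[R]_4) a b :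
  Phi2 x0 a b (\sum_(p < 4) \sum_(q < 4 | (p < q)%N) c p q *: F p q) =
  \sum_(p < 4) \sum_(q < 4 | (p < q)%N) c p q * Phi2 x0 a b (F p q).
Proof.
rewrite (eq_bigr (fun p : 'I_4 => 1 *: \sum_(q < 4 | (p < q)%N) c p q *: F p q)) => [|p _].
  by rewrite Phi2_sum; apply: eq_bigr => p _; rewrite mul1r Phi2_sum.
by rewrite scale1r.
Qed.

(** By linearity the third bivector may be taken decomposable. There [Phi2E] expresses the value by
    products of two factors [wedge211], each of which contributes one determinant. *)
Lemma Phi2_conj g (x0 : 'cV[R]_4) a b d : alternating a -> alternating b -> alternating d ->
  Phi2 (g *m x0) (g *m a *m g^T) (g *m b *m g^T) (g *m d *m g^T)
  = \det g ^+ 2 * Phi2 x0 a b d.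
Proof.
move=> aA bA dA; rewrite [in LHS](altmx_sum dA).
have -> : g *m (\sum_(p < 4) \sum_(q < 4 | (p < q)%N)
    d p q *: wedge11 (vecW R p) (vecW R q)) *m g^T
  = \sum_(p < 4) \sum_(q < 4 | (p < q)%N)
    d p q *: wedge11 (g *m vecW R p) (g *m vecW R q).
  rewrite mulmx_sumr mulmx_suml; apply: eq_bigr => p _.
  rewrite mulmx_sumr mulmx_suml; apply: eq_bigr => q _.
  by rewrite wedge11_mul -scalemxAr -scalemxAl.
rewrite Phi2_sum2 mulr_sumr; apply: eq_bigr => p _.
rewrite mulr_sumr; apply: eq_bigr => q _.
by rewrite Phi2E /Phi2_wedge !wedge211_conj //; ring.
Qed.

Lemma wedge211_vecW a (x0 : 'cV[R]_4) :
  (wedge211 a (vecW R 0) x0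
     = a 1 2%:R * x0 3%:R 0 - a 1 3%:R * x0 2%:R 0 + a 2%:R 3%:R * x0 1 0)
  * (wedge211 a (vecW R 1) x0
     = a 0 3%:R * x0 2%:R 0 - a 0 2%:R * x0 3%:R 0 - a 2%:R 3%:R * x0 0 0)
  * (wedge211 a (vecW R 2%:R) x0
     = a 0 1 * x0 3%:R 0 - a 0 3%:R * x0 1 0 + a 1 3%:R * x0 0 0)
  * (wedge211 a (vecW R 3%:R) x0
     = a 0 2%:R * x0 1 0 - a 0 1 * x0 2%:R 0 - a 1 2%:R * x0 0 0).
Proof. by rewrite /wedge211 /wedge22 !wedge11E !mxE /=; do ?split; ring. Qed.

(** [Phi2] is trilinear and alternating in its bivectors, vanishing on repeated arguments even when
    2 = 0, so a linear substitution multiplies it by the determinant. *)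
Lemma Phi2_comb (x0 : 'cV[R]_4) (X : 'I_3 -> 'M[R]_4) h :
  let Y j := \sum_i h j i *: X i in
  Phi2 x0 (Y 0) (Y 1) (Y 2%:R) = \det h * Phi2 x0 (X 0) (X 1) (X 2%:R).
Proof.
move=> /=.
pose cmb (c : 'I_3 -> R) (t : 'I_3 -> R) := c 0 * t 0 + c 1 * t 1 + c 2%:R * t 2%:R.
have lin3 (a b : 'M[R]_4) (c : 'I_3 -> R) :
    Phi2 x0 a b (\sum_i c i *: X i) = cmb c (fun i => Phi2 x0 a b (X i)).
  by rewrite Phi2_sum sum3.
have lin2 (a b : 'M[R]_4) (c : 'I_3 -> R) :
    Phi2 x0 a (\sum_i c i *: X i) b = cmb c (fun i => Phi2 x0 a (X i) b).
  by rewrite Phi2_swap23 lin3 /cmb !(Phi2_swap23 x0 a _ b) !mulrN -!opprD opprK.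
have lin1 (a b : 'M[R]_4) (c : 'I_3 -> R) :
    Phi2 x0 (\sum_i c i *: X i) a b = cmb c (fun i => Phi2 x0 (X i) a b).
  by rewrite Phi2_swap12 lin2 /cmb !(Phi2_swap12 x0 _ a b) !mulrN -!opprD opprK.
have d12 a b : Phi2 x0 a a b = 0 by rewrite /Phi2 sum4_lt /Phi2_wedge; ring.
have d23 a b : Phi2 x0 a b b = 0.
  by rewrite /Phi2 sum4_lt /Phi2_wedge !wedge211_vecW; ring.
have d13 a b : Phi2 x0 a b a = 0 by rewrite Phi2_swap12 d23 oppr0.
rewrite lin1 /cmb !lin2 /cmb !lin3 /cmb !d12 !d23 !d13 det3.
rewrite (Phi2_swap23 x0 (X 0) (X 1) (X 2%:R)) (Phi2_swap12 x0 (X 0) (X 1) (X 2%:R)).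
rewrite (Phi2_swap23 x0 (X 1) (X 0) (X 2%:R)) (Phi2_swap12 x0 (X 0) (X 1) (X 2%:R)).
rewrite (Phi2_swap12 x0 (X 0) (X 2%:R) (X 1)) (Phi2_swap23 x0 (X 0) (X 1) (X 2%:R)).
rewrite (Phi2_swap23 x0 (X 2%:R) (X 0) (X 1)) (Phi2_swap12 x0 (X 0) (X 2%:R) (X 1)).
rewrite (Phi2_swap23 x0 (X 0) (X 1) (X 2%:R)).
ring.
Qed.

Lemma P1_act (g : GL 4 R * GL 3 R) x : inV x ->
  P1 (act g x) = \det (GLmx g.1) ^+ 2 * \det (GLmx g.2) * P1 x.
Proof.
move=> /forallP xV; rewrite /P1 /act /= !ffunE.
pose X i := GLmx g.1 *m x.1 i *m (GLmx g.1)^T.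
have XA i : alternating (X i).
  have /alternatingP[c cE] := xV i; apply/alternatingP.
  exists (GLmx g.1 *m c *m (GLmx g.1)^T).
  by rewrite /X cE !trmx_mul trmxK mulmxBr mulmxBl !mulmxA.
rewrite (@Phi2_comb _ X) /X Phi2_conj //; ring.
Qed.

(** The transpose appears because [g.2] acts on the x_i, whereas the form is in the dual variables
    u_i. *)
Lemma Phi3_act (g : GL 4 R * GL 3 R) x : inV x ->
  Phi3 (act g x) = qscale (\det (GLmx g.1)) (qcomp (Phi3 x) (GLmx g.2)^T).
Proof.
move=> /forallP xV; set d := \det _.
pose X i := GLmx g.1 *m x.1 i *m (GLmx g.1)^T.
have XE i : (act g x).1 i = \sum_j GLmx g.2 i j *: X j by rewrite ffunE.
have W i j : wedge22 (X i) (X j) = d * wedge22 (x.1 i) (x.1 j).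
  by rewrite wedge22_conj.
have P i : pf (X i) = d * pf (x.1 i) by rewrite pf_conj.
have pfD3 (c : 'I_3 -> R) : pf (\sum_j c j *: X j) =
    d * tqeval (Phi3 x) c.
  pose y : Vspace R := ([ffun i => X i], x.2).
  rewrite (_ : \sum_j _ = \sum_j c j *: y.1 j); last first.
    by apply: eq_bigr => j _; rewrite ffunE.
  by rewrite -Phi3E /tqeval /Phi3 /= !ffunE !W !P; ring.
have wD3 (c e : 'I_3 -> R) : wedge22 (\sum_j c j *: X j) (\sum_j e j *: X j) =
    d * qpol (Phi3 x) (\col_i c i) (\col_i e i).
  rewrite wedge22_pf -big_split /=.
  rewrite (eq_bigr (fun i => (c i + e i) *: X i)); last first.
    by move=> i _; rewrite scalerDl.
  by rewrite !pfD3 /tqeval /qpol /= !mxE; ring.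
have colE i : col i (GLmx g.2)^T = \col_j GLmx g.2 i j.
  by apply/matrixP=> p q; rewrite !mxE.
rewrite /Phi3 !XE !pfD3 !wD3 /qscale /qcomp /= !colE.
by rewrite /qval /tqeval !mxE.
Qed.

End Rep.

(** * Normal forms and orbits *)

Section NF.
Variable R : comNzRingType.
Implicit Types (Q : tqform R) (h : 'M[R]_3) (a b g : 'M[R]_4) (x : Vspace R).

(** Modulo x0 = e_0 the bivectors are e_2 /\ e_3, - e_1 /\ e_3 and e_1 /\ e_2. Terms e_0 /\ e_j with
    upper triangular coefficients change nothing modulo x0 and put the six coefficients of [Q] into
    the Pfaffian. *)
Definition nform Q : Vspace R :=
  ([ffun i => nth 0 [:: altmx (qa Q) (qb Q) (qc Q) 0 0 1;
                        altmx 0 (qd Q) (qe Q) 0 (- 1) 0;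
                        altmx 0 0 (qf Q) 1 0 0] (nat_of_ord (i : 'I_3))],
   vecW R 0).

(** Coordinates of the linear form w |-> x_i /\ w /\ x0 on W. *)
Definition lamv x (i : 'I_3) : 'cV[R]_4 :=
  \col_p wedge211 (x.1 i) (vecW R p) x.2.

(* An equivariant basis of W, equal to the standard one at a normal form. *)
Definition framemx x : 'M[R]_4 :=
  \matrix_(p, j) nth 0 [:: x.2 p 0; - (x.1 2%:R *m lamv x 1) p 0;
    (x.1 2%:R *m lamv x 0) p 0; - (x.1 1 *m lamv x 0) p 0] (nat_of_ord (j : 'I_4)).

Lemma alternating_eq a b : alternating a -> alternating b ->
  a 0 1 = b 0 1 -> a 0 2%:R = b 0 2%:R -> a 0 3%:R = b 0 3%:R ->
  a 1 2%:R = b 1 2%:R -> a 1 3%:R = b 1 3%:R -> a 2%:R 3%:R = b 2%:R 3%:R ->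
  a = b.
Proof. by move=> aA bA *; rewrite (altmxE aA) (altmxE bA); congr altmx. Qed.

Lemma alternating_conj g a : alternating a -> alternating (g *m a *m g^T).
Proof.
move=> /alternatingP[c ->]; apply/alternatingP; exists (g *m c *m g^T).
by rewrite !trmx_mul trmxK mulmxBr mulmxBl !mulmxA.
Qed.

Lemma alternatingZ c a : alternating a -> alternating (c *: a).
Proof.
move=> /alternatingP[d ->]; apply/alternatingP; exists (c *: d).
by rewrite linearZ /= scalerBr.
Qed.

Lemma nform_inV Q : inV (nform Q).
Proof.
by apply/forallP; apply: ord3P; rewrite ffunE /= alternating_altmx.
Qed.

Lemma Phi3_nform Q : Phi3 (nform Q) = Q.
Proof.
case: Q => a b c d e f.
rewrite /Phi3 /pf /wedge22 /nform /= !ffunE /= !mxE /=; congr TQForm; ring.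
Qed.

Lemma conj_altmx g p q r s t u i j : (g *m altmx p q r s t u *m g^T) i j =
  p * (g i 0 * g j 1 - g i 1 * g j 0) + q * (g i 0 * g j 2%:R - g i 2%:R * g j 0)
  + r * (g i 0 * g j 3%:R - g i 3%:R * g j 0)
  + s * (g i 1 * g j 2%:R - g i 2%:R * g j 1)
  + t * (g i 1 * g j 3%:R - g i 3%:R * g j 1)
  + u * (g i 2%:R * g j 3%:R - g i 3%:R * g j 2%:R).
Proof. rewrite mxE sum4 !mxE !sum4 !mxE /=; ring. Qed.

Lemma mul_altmx p q r s t u (v : 'cV[R]_4) :
  ((altmx p q r s t u *m v) 0 0
     = p * v 1 0 + q * v 2%:R 0 + r * v 3%:R 0)
  * ((altmx p q r s t u *m v) 1 0
     = - p * v 0 0 + s * v 2%:R 0 + t * v 3%:R 0)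
  * ((altmx p q r s t u *m v) 2%:R 0
     = - q * v 0 0 - s * v 1 0 + u * v 3%:R 0)
  * ((altmx p q r s t u *m v) 3%:R 0
     = - r * v 0 0 - t * v 1 0 - u * v 2%:R 0).
Proof. by rewrite !mxE !sum4 !mxE /=; do ?split; ring. Qed.

Lemma P1_nform Q : P1 (nform Q) = - 1.
Proof.
rewrite /P1 /nform /= !ffunE /= /Phi2 sum4_lt /Phi2_wedge !wedge211_vecW !mxE /=.
ring.
Qed.

Lemma framemx_nform Q : framemx (nform Q) = 1%:M.
Proof.
apply/matrixP=> i j; rewrite !mxE.
move: i j; apply: ord4P; apply: ord4P; rewrite /= ?ffunE /=;
  rewrite ?(mxE, sum4) /= ?wedge211_vecW ?ffunE /= ?mxE /=; ring.
Qed.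

Lemma framemxE x p :
  (framemx x p 0 = x.2 p 0) * (framemx x p 1 = - (x.1 2%:R *m lamv x 1) p 0)
  * (framemx x p 2%:R = (x.1 2%:R *m lamv x 0) p 0)
  * (framemx x p 3%:R = - (x.1 1 *m lamv x 0) p 0).
Proof. by rewrite !mxE. Qed.

Lemma lamvE x i :
  (lamv x i 0 0 = wedge211 (x.1 i) (vecW R 0) x.2)
  * (lamv x i 1 0 = wedge211 (x.1 i) (vecW R 1) x.2)
  * (lamv x i 2%:R 0 = wedge211 (x.1 i) (vecW R 2%:R) x.2)
  * (lamv x i 3%:R 0 = wedge211 (x.1 i) (vecW R 3%:R) x.2).
Proof. by rewrite !mxE. Qed.

(** The linear forms are transported by the inverse transpose of g and scaled by det g. Hence each
    contraction of a bivector with one of them picks up det g, while the column x0 does not. *)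
Lemma framemx_conj (g : GL 4 R) x : inV x ->
  framemx (act (g, 1%g) x) =
  GLmx g *m framemx x *m diag_mx (\row_j (if j == 0 then 1 else \det (GLmx g))).
Proof.
move=> /forallP xV; set y := act _ _; set d := \det _.
have yE i : y.1 i = GLmx g *m x.1 i *m (GLmx g)^T.
  rewrite ffunE (bigD1 i) //= big1 ?addr0 => [|j /negPf ji].
    by rewrite mxE eqxx scale1r.
  by rewrite mxE eq_sym ji scale0r.
have lamE i : (GLmx g)^T *m lamv y i = d *: lamv x i.
  apply/matrixP=> p q; rewrite !mxE -wedge211_conj //.
  rewrite wedge211E; apply: eq_bigr => r _; rewrite !mxE yE; congr (_ * _).
  rewrite (bigD1 p) //= big1 ?addr0 => [|s /negPf sp].
    by rewrite mxE !eqxx mulr1.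
  by rewrite mxE sp mulr0.
have colE i j : y.1 i *m lamv y j = d *: (GLmx g *m (x.1 i *m lamv x j)).
  by rewrite yE -mulmxA lamE !scalemxAr mulmxA.
apply/matrixP=> i j; rewrite mul_mx_diag [RHS]mxE [in X in _ = _ * X]mxE.
have gF c (u : 'cV[R]_4) : (forall k, framemx x k j = c * u k 0) ->
    (GLmx g *m framemx x) i j = c * (GLmx g *m u) i 0.
  move=> FE; rewrite !mxE mulr_sumr; apply: eq_bigr => k _.
  by rewrite FE mulrCA.
move: j gF; apply: ord4P => /= gF.
- by rewrite (gF 1 x.2) ?framemxE ?mul1r ?mulr1 // => k; rewrite framemxE mul1r.
- rewrite (gF (-1) (x.1 2%:R *m lamv x 1)) => [|k]; last by rewrite framemxE mulN1r.
  by rewrite framemxE colE mxE mulN1r mulNr mulrC.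
- rewrite (gF 1 (x.1 2%:R *m lamv x 0)) => [|k]; last by rewrite framemxE mul1r.
  by rewrite framemxE colE mxE mul1r mulrC.
rewrite (gF (-1) (x.1 1 *m lamv x 0)) => [|k]; last by rewrite framemxE mulN1r.
by rewrite framemxE colE mxE mulN1r mulNr mulrC.
Qed.

(** A polynomial identity in the 22 coordinates of [x], checked by expansion rather than by
    equivariance, so that it holds over any ring and also where [P1] vanishes. *)
Lemma framemx_nform_conj x i : inV x ->
  framemx x *m (nform (Phi3 x)).1 i *m (framemx x)^T = - P1 x *: x.1 i.
Proof.
move=> xV; have xA j := forallP xV j.
have yA : alternating (framemx x *m (nform (Phi3 x)).1 i *m (framemx x)^T).
  by apply: alternating_conj; exact: (forallP (nform_inV _)).
have mE j p := congr1 (fun a => (a *m lamv x _) p 0) (altmxE (xA j)).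
have /= := (framemxE x 0, framemxE x 1, framemxE x 2%:R, framemxE x 3%:R).
rewrite ?mE !mul_altmx !lamvE !wedge211_vecW => FE.
have := erefl (P1 x); rewrite {2}/P1 /Phi2 sum4_lt /Phi2_wedge !wedge211_vecW => PE.
(* [ring] is only fast once the entries of [x] are variables. *)
have AE j : x.1 j = altmx (x.1 j 0 1) (x.1 j 0 2%:R) (x.1 j 0 3%:R)
  (x.1 j 1 2%:R) (x.1 j 1 3%:R) (x.1 j 2%:R 3%:R) := altmxE (xA j).
have [[E0 E1] E2] := (AE 0, AE 1, AE 2%:R).
move: FE PE E0 E1 E2 yA; rewrite /Phi3 /pf /wedge22.
move: (x.1 0 0 1) (x.1 0 0 2%:R) (x.1 0 0 3%:R) (x.1 0 1 2%:R) (x.1 0 1 3%:R) (x.1 0 2%:R 3%:R)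
  (x.1 1 0 1) (x.1 1 0 2%:R) (x.1 1 0 3%:R) (x.1 1 1 2%:R) (x.1 1 1 3%:R) (x.1 1 2%:R 3%:R)
  (x.1 2%:R 0 1) (x.1 2%:R 0 2%:R) (x.1 2%:R 0 3%:R) (x.1 2%:R 1 2%:R) (x.1 2%:R 1 3%:R) (x.1 2%:R 2%:R 3%:R)
  (x.2 0 0) (x.2 1 0) (x.2 2%:R 0) (x.2 3%:R 0)
  (framemx x) (P1 x) => p0 q0 r0 s0 t0 u0
  p1 q1 r1 s1 t1 u1
  p2 q2 r2 s2 t2 u2
  w0 w1 w2 w3 M P FE -> E0 E1 E2 yA.
move: i yA; apply: ord3P => yA; apply: alternating_eq => //; try exact: alternatingZ;
rewrite ffunE /= conj_altmx !FE mxE ?E0 ?E1 ?E2 mxE /=; ring.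
Qed.

Lemma det_framemx x : inV x -> \det (framemx x) = P1 x ^+ 2.
Proof.
move=> xV; have xA j := forallP xV j.
have mE j p := congr1 (fun a => (a *m lamv x _) p 0) (altmxE (xA j)).
have /= := (framemxE x 0, framemxE x 1, framemxE x 2%:R, framemxE x 3%:R).
rewrite ?mE !mul_altmx !lamvE !wedge211_vecW => FE.
have := erefl (P1 x); rewrite {2}/P1 /Phi2 sum4_lt /Phi2_wedge !wedge211_vecW => PE.
rewrite det4 !FE PE; ring.
Qed.

End NF.

(** * Isomorphisms of group functors *)

Lemma inj_surj_bijective (A B : Type) (f : A -> B) :
  injective f -> (forall y, exists x, f x = y) -> bijective f.
Proof.
move=> fI /choice[g gK]; exists g => // x; apply: fI; exact: gK.
Qed.

Lemma group_mor1 (G H : groupType) (phi : G -> H) :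
  {morph phi : x y / (x * y)%g} -> phi 1%g = 1%g.
Proof. by move=> phiM; apply: (mulgI (phi 1%g)); rewrite -phiM !mulg1. Qed.

Lemma group_morV (G H : groupType) (phi : G -> H) :
  {morph phi : x y / (x * y)%g} -> {morph phi : x / (x^-1)%g}.
Proof.
move=> phiM x; apply: (mulgI (phi x)).
by rewrite -phiM !mulgV group_mor1.
Qed.

Section KIso.
Variable k : fieldType.
Implicit Types G H : kgroup k.

Lemma pmap1 G (R S : comAlgType k) (f : {lrmorphism R -> S}) :
  pmap f (1%g : G R) = 1%g.
Proof. exact: group_mor1 (pmapM f). Qed.

Lemma pmapV G (R S : comAlgType k) (f : {lrmorphism R -> S}) (x : G R) :
  pmap f x^-1%g = (pmap f x)^-1%g.
Proof. exact: group_morV (pmapM f) x. Qed.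

Lemma kiso_refl G : kiso G G.
Proof. by exists (fun R x => x); split=> // R; exists id. Qed.

Lemma kiso_sym G H : kiso G H -> kiso H G.
Proof.
case=> phi [phib phiM phiN].
have ex R : exists g : H R -> G R, cancel (phi R) g /\ cancel g (phi R).
  by case: (phib R) => g; exists g.
pose psi R := projT1 (cid (ex R)).
have psiK R : cancel (phi R) (psi R) by case: (projT2 (cid (ex R))).
have phiK R : cancel (psi R) (phi R) by case: (projT2 (cid (ex R))).
exists psi; split=> [R|R x y|R S f x].
- by exists (phi R).
- by rewrite -{1}[x]phiK -{1}[y]phiK -phiM psiK.
by apply: (can_inj (psiK S)); rewrite phiN !phiK.
Qed.

Lemma kiso_trans G H L : kiso G H -> kiso H L -> kiso G L.
Proof.
case=> phi [phib phiM phiN] [psi [psib psiM psiN]].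
exists (fun R x => psi R (phi R x)); split=> [R|R x y|R S f x].
- exact: (bij_comp (psib R) (phib R)).
- by rewrite phiM psiM.
by rewrite phiN psiN.
Qed.

Lemma kiso_base_change (K : fieldType) (iota : {rmorphism k -> K}) G H :
  kiso G H -> kiso (base_change iota G) (base_change iota H).
Proof.
case=> phi [phib phiM phiN].
by exists (fun R x => phi (resalg iota R) x); split=> *; rewrite ?phiM //=; apply: phiN.
Qed.

End KIso.

Section GLaux.
Variables (n : nat) (R : comNzRingType).

Fact GLtr_subproof (g : GL n R) : (GLinvmx g)^T *m (GLmx g)^T == 1%:M.
Proof. by rewrite -trmx_mul GLmulV trmx1. Qed.

(** The contragredient of [g], that is, its inverse transpose: plain transposition would reverse
    products. *)
Definition GLtr (g : GL n R) : GL n R := @MkGL n R (_, _) (GLtr_subproof g).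

Lemma GLtrM g h : GLtr (g * h)%g = (GLtr g * GLtr h)%g.
Proof. by apply: GLmx_inj; rewrite /GLmx /= trmx_mul. Qed.

Lemma GLtrK : involutive GLtr.
Proof. by move=> g; apply: GLmx_inj; rewrite /GLmx /= trmxK. Qed.

Lemma GLmxM (g h : GL n R) : GLmx (g * h)%g = GLmx g *m GLmx h.
Proof. by []. Qed.

Lemma GLmx1 : GLmx (1%g : GL n R) = 1%:M.
Proof. by []. Qed.

Lemma GLmxV (g : GL n R) : GLmx (g^-1)%g = GLinvmx g.
Proof. by []. Qed.

Lemma GL_of_det_subproof (a : 'M[R]_n) c : \det a * c = 1 ->
  a *m (c *: \adj a) == 1%:M.
Proof. by move=> ac; rewrite -scalemxAr mul_mx_adj scale_scalar_mx mulrC ac. Qed.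

Definition GL_of_det (a : 'M[R]_n) c (ac : \det a * c = 1) : GL n R :=
  @MkGL n R (_, _) (GL_of_det_subproof ac).

Lemma GL_of_detE (a : 'M[R]_n) c (ac : \det a * c = 1) :
  GLmx (GL_of_det ac) = a.
Proof. by []. Qed.

End GLaux.

Lemma GLtr_map n (R S : comNzRingType) (f : {rmorphism R -> S}) (g : GL n R) :
  GLtr (GLmap f g) = GLmap f (GLtr g).
Proof. by apply: GLmx_inj; rewrite /GLmx /= map_trmx. Qed.

(** * Orbits and similarity classes of forms *)

Section Orbits.
Variable R : comNzRingType.
Implicit Types (Q : tqform R) (h : 'M[R]_3) (x y : Vspace R).

Lemma act_scalar (g : GL 4 R * GL 3 R) c x i : GLmx g.2 = c%:M ->
  (act g x).1 i = c *: (GLmx g.1 *m x.1 i *m (GLmx g.1)^T).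
Proof.
move=> gc; rewrite ffunE (bigD1 i) //= big1 ?addr0 => [|j /negPf ji].
  by rewrite gc mxE eqxx.
by rewrite gc mxE eq_sym ji scale0r.
Qed.

Lemma Vspace_eq x y : (forall i, x.1 i = y.1 i) -> x.2 = y.2 -> x = y.
Proof. by case: x y => [a b] [c d] /= ac ->; congr (_, _); apply/ffunP. Qed.

(** The frame reproduces [x] up to the factor [- P1 x], which the scalar [c] in GL_3 cancels. The
    inverse [c] is explicit because the lemma is also applied to points over an arbitrary
    algebra. *)
Lemma act_nform x c : inV x -> - P1 x * c = 1 ->
  exists g : GL 4 R * GL 3 R,
    [/\ act g (nform (Phi3 x)) = x, GLmx g.1 = framemx x & GLmx g.2 = c%:M].
Proof.
move=> xV xc.
have d1 : \det (framemx x) * c ^+ 2 = 1.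
  by rewrite det_framemx // -sqrrN -exprMn xc expr1n.
have d2 : \det (c%:M : 'M[R]_3) * (- P1 x) ^+ 3 = 1.
  by rewrite det_scalar -exprMn mulrC xc expr1n.
exists (GL_of_det d1, GL_of_det d2); split=> //.
apply: Vspace_eq => [i|].
  by rewrite (@act_scalar _ c) //= framemx_nform_conj // scalerA mulrC xc scale1r.
apply/matrixP=> i j; rewrite ord1 /= mxE (bigD1 0) //= big1 => [|p /negPf p0].
  by rewrite GL_of_detE framemxE mxE !eqxx mulr1 addr0.
by rewrite [vecW _ _ _ _]mxE p0 mulr0.
Qed.

End Orbits.

Definition similar (k : fieldType) (Q Q' : tqform k) : Prop :=
  exists (c : k) (h : 'M[k]_3),
    [/\ c != 0, h \in unitmx & Q' = qscale c (qcomp Q h)].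

Section OrbitsField.
Variable k : fieldType.
Implicit Types (x y : Vspace k) (Q : tqform k).

Lemma GL_unit n (g : GL n k) : GLmx g \in unitmx.
Proof. by have [] := mulmx1_unit (GLmulV g). Qed.

Lemma GL_det_neq0 n (g : GL n k) : \det (GLmx g) != 0.
Proof. by rewrite -unitfE; have := GL_unit g; rewrite unitmxE. Qed.

Lemma unitmx_GL n (a : 'M[k]_n) : a \in unitmx -> exists g : GL n k, GLmx g = a.
Proof.
rewrite unitmxE unitfE => a0.
by exists (GL_of_det (mulfV a0)).
Qed.

Lemma U_nform Q : Phi4 Q != 0 -> U (nform Q).
Proof.
by move=> Q0; split; rewrite ?nform_inV ?P1_nform ?oppr_eq0 ?oner_eq0 // /P2 Phi3_nform.
Qed.

Lemma act_U (g : GL 4 k * GL 3 k) x : U x -> U (act g x).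
Proof.
case=> xV x1 x2; split; first exact: act_inV.
  by rewrite P1_act // !mulf_neq0 ?expf_neq0 ?GL_det_neq0.
rewrite /P2 Phi3_act // Phi4_qscale Phi4_qcomp det_tr.
by rewrite !mulf_neq0 ?expf_neq0 ?GL_det_neq0.
Qed.

Lemma orbit_nform x : U x -> exists g : GL 4 k * GL 3 k, act g (nform (Phi3 x)) = x.
Proof.
case=> xV x1 _; rewrite -oppr_eq0 in x1.
by have [g [gx _ _]] := act_nform xV (mulfV x1); exists g.
Qed.

(** Moving [x] by an element that realises the similarity makes the two forms equal, and then both
    vectors lie in the orbit of the same normal form. *)
Lemma orbit_similar x y : U x -> U y -> similar (Phi3 x) (Phi3 y) ->
  exists g : GL 4 k * GL 3 k, act g x = y.
Proof.
move=> Ux Uy [c [h [c0 hU yE]]].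
(* Any matrix of determinant [c] would do, since GL_4 scales [Phi3] by the determinant. *)
have d1 : \det (diag_mx (\row_(j < 4) if j == 0 then c else 1)) * c^-1 = 1.
  rewrite det_diag (bigD1 0) //= mxE eqxx big1 ?mulr1 ?mulfV // => j /negPf j0.
  by rewrite mxE j0.
have [g2 g2E] := unitmx_GL (etrans (unitmx_tr h) hU).
pose z := act (GL_of_det d1, g2) x.
have Uz : U z := act_U _ Ux.
have zE : Phi3 z = Phi3 y.
  have [xV _ _] := Ux.
  rewrite /z Phi3_act //= g2E trmxK yE; congr qscale.
  by apply: (mulIf (invr_neq0 c0)); rewrite mulfV.
have [a aE] := orbit_nform Uz; have [b bE] := orbit_nform Uy.
exists (b * a^-1 * (GL_of_det d1, g2))%g.
rewrite actM -/z -aE -actM -mulgA mulVg mulg1 zE.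
exact: bE.
Qed.

Lemma GorbitE x : Gorbit x x.
Proof. by exists 1%g => //; apply: act1. Qed.

Lemma Gorbit_act (g : GL 4 k * GL 3 k) x : Gorbit (act g x) = Gorbit x.
Proof.
apply/seteqP; split=> _ [h _ <-].
  by exists (h * g)%g => //; rewrite actM.
by exists (h * g^-1)%g => //; rewrite -actM mulgKV.
Qed.

Lemma kiso_stab_act (g : GL 4 k * GL 3 k) x : kiso (stab x) (stab (act g x)).
Proof.
pose gR (R : comAlgType k) : Gk k R := (GLmap (in_alg R) g.1, GLmap (in_alg R) g.2).
have gRE (R : comAlgType k) : Vmap (in_alg R) (act g x) = act (gR R) (Vmap (in_alg R) x).
  exact: act_map.
have gRN (R S : comAlgType k) (f : {lrmorphism R -> S}) : pmap f (gR R) = gR S.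
  by congr (_, _); apply: GLmx_inj; apply/matrixP=> i j;
     rewrite /GLmx /= !mxE rmorph_alg.
have conjP (R : comAlgType k) (u : stab x R) :
    (gR R * val u * (gR R)^-1)%g \in @stab_pred k (act g x) R.
  apply/eqP; rewrite gRE -actM mulgKV actM; congr act; exact/eqP/(valP u).
have conjP' (R : comAlgType k) (u : stab (act g x) R) :
    ((gR R)^-1 * val u * gR R)%g \in @stab_pred k x R.
  apply/eqP; have /eqP := valP u; rewrite gRE => uE.
  by rewrite actM actM uE -actM mulVg act1.
exists (fun R u => SubGrp (@stab_group_closed k (act g x) R) (conjP R u)).
split=> [R|R u v|R S f u].
- exists (fun u => SubGrp (@stab_group_closed k x R) (conjP' R u)) => u;
    apply: val_inj => /=; last by rewrite !mulgA mulgV mul1g mulgK.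
  by rewrite !mulgA mulVg mul1g mulgKV.
- by apply: val_inj; rewrite /= !mulgA mulgKV.
apply: val_inj.
transitivity (pmap f (gR R * val u * (gR R)^-1)%g); last by [].
by rewrite !pmapM pmapV gRN.
Qed.

End OrbitsField.

(** * Stabilizers are special orthogonal groups *)

Section SO.
Variable k : fieldType.

(** [f] is a bare function, because k-linear functionals are applied to forms as well as ring
    morphisms. *)
Definition qmap (R S : comNzRingType) (f : R -> S) (Q : tqform R) : tqform S :=
  TQForm (f (qa Q)) (f (qb Q)) (f (qc Q)) (f (qd Q)) (f (qe Q)) (f (qf Q)).

Lemma qmap_qcomp (R S : comNzRingType) (f : {rmorphism R -> S}) (Q : tqform R) h :
  qmap f (qcomp Q h) = qcomp (qmap f Q) (map_mx f h).
Proof.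
case: Q => a b c d e g; rewrite /qmap /qcomp /qval /qpol /tqeval /= !mxE.
by congr TQForm; rewrite ?(rmorphD, rmorphM, rmorphXn, rmorphMn).
Qed.

(** For nondegenerate q in odd dimension O(q) is SO(q) x mu_2, so the determinant singles out SO(q)
    in every characteristic. *)
Definition SO_pred (Q : tqform k) (R : comAlgType k) : {pred GLk k 3 R} :=
  fun h => `[< qcomp (qmap (in_alg R) Q) (GLmx h) = qmap (in_alg R) Q
               /\ \det (GLmx h) = 1 >].

Lemma SO_group_closed Q R : group_closed (@SO_pred Q R).
Proof.
split=> [|g h /asboolP[gQ g1] /asboolP[hQ h1]]; apply/asboolP.
  by rewrite GLmx1 qcomp1 det1.
have hV : \det (GLinvmx h) = 1.
  by have := det_mulmx (GLmx h) (GLinvmx h); rewrite GLmulV det1 h1 mul1r.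
rewrite GLmxM GLmxV det_mulmx g1 hV mulr1; split=> //.
by rewrite -qcompM gQ -[in LHS]hQ qcompM GLmulV qcomp1.
Qed.

Lemma SO_pmap Q (R S : comAlgType k) (f : {lrmorphism R -> S}) (g : GLk k 3 R) :
  g \in @SO_pred Q R -> pmap f g \in @SO_pred Q S.
Proof.
move=> /asboolP[gQ g1]; apply/asboolP.
have QE : qmap (in_alg S) Q = qmap f (qmap (in_alg R) Q).
  by rewrite /qmap /=; congr TQForm; rewrite rmorph_alg.
by rewrite [GLmx _]/= QE -qmap_qcomp gQ det_map_mx g1 rmorph1.
Qed.

Definition SO (Q : tqform k) : kgroup k :=
  sub_kgroup (@SO_group_closed Q) (@SO_pmap Q).

Lemma Phi4_map (R S : comNzRingType) (f : {rmorphism R -> S}) (Q : tqform R) :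
  Phi4 (qmap f Q) = f (Phi4 Q).
Proof.
by case: Q => *; rewrite /Phi4 /qmap /=; ring.
Qed.

Lemma Vmap_nform (R S : comNzRingType) (f : {rmorphism R -> S}) (Q : tqform R) :
  Vmap f (nform Q) = nform (qmap f Q).
Proof.
apply: Vspace_eq => [|/=]; last by rewrite /vecW map_delta_mx.
apply: ord3P; rewrite !ffunE /=; apply/matrixP; apply: ord4P; apply: ord4P;
  by rewrite !mxE /= ?(rmorphN, rmorph0, rmorph1).
Qed.

(** The two invariants leave no room for scalars: [P1] gives d^2 e = 1 and [Phi4] gives d^3 e^2 = 1,
    so d = d (d^3 e^2) = (d^2 e)^2 = 1 and then e = 1. *)
Lemma stab_nform_SO (R : comNzRingType) (Q : tqform R) c (g : GL 4 R * GL 3 R) :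
  Phi4 Q * c = 1 -> act g (nform Q) = nform Q ->
  [/\ \det (GLmx g.1) = 1, \det (GLmx g.2) = 1 & qcomp Q (GLmx g.2)^T = Q].
Proof.
move=> Qc gQ; set d := \det _; set e := \det _.
have d2e : d ^+ 2 * e = 1.
  apply: oppr_inj; rewrite -mulrN1 -[RHS](P1_nform Q) -[in RHS]gQ.
  by rewrite P1_act ?nform_inV // P1_nform.
have QE : qscale d (qcomp Q (GLmx g.2)^T) = Q.
  by rewrite -[in RHS](Phi3_nform Q) -[in RHS]gQ Phi3_act ?nform_inV // Phi3_nform.
have d3e2 : d ^+ 3 * e ^+ 2 = 1.
  rewrite -[LHS]mulr1 -Qc mulrA; congr (_ * c).
  by rewrite -mulrA -[in RHS]QE Phi4_qscale Phi4_qcomp det_tr.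
have d1 : d = 1.
  rewrite -[LHS]mulr1 -d3e2; transitivity ((d ^+ 2 * e) ^+ 2); first ring.
  by rewrite d2e expr1n.
split=> //; first by rewrite -d2e d1 expr1n mul1r.
by rewrite -[RHS]QE d1 qscale1.
Qed.

(** The isomorphism is the projection to GL_3 followed by the contragredient, which undoes the
    transpose in [Phi3_act] while preserving the order of products. *)
Lemma kiso_stab_nform Q : Phi4 Q != 0 -> kiso (stab (nform Q)) (SO Q).
Proof.
move=> Q0.
have Qc (R : comAlgType k) : Phi4 (qmap (in_alg R) Q) * in_alg R (Phi4 Q)^-1 = 1.
  by rewrite Phi4_map -rmorphM mulfV // rmorph1.
have stE (R : comAlgType k) (g : stab (nform Q) R) :
    act (val g) (nform (qmap (in_alg R) Q)) = nform (qmap (in_alg R) Q).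
  by have /eqP := valP g; rewrite Vmap_nform.
have phiP (R : comAlgType k) (g : stab (nform Q) R) :
    GLtr (val g).2 \in @SO_pred Q R.
  have [_ e1 gQ] := stab_nform_SO (Qc R) (stE R g).
  have g1 : \det (GLinvmx (val g).2) = 1.
    by have := det_mulmx (GLmx (val g).2) (GLinvmx (val g).2); rewrite GLmulV det1 e1 mul1r.
  apply/asboolP; rewrite [GLmx _]/= det_tr; split=> //.
  by rewrite -[in LHS]gQ qcompM -trmx_mul GLmulVl trmx1 qcomp1.
exists (fun R g => SubGrp (@SO_group_closed Q R) (phiP R g)).
split=> [R|R g h|R S f g]; last 2 first.
- by apply: val_inj; rewrite /= GLtrM.
- by apply: val_inj; rewrite /= GLtr_map.
apply: inj_surj_bijective => [g h /(congr1 val)/= gh|h].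
  have {}gh : (val g).2 = (val h).2 by apply: (can_inj (@GLtrK _ _)).
  have : (val (g^-1 * h)%g).2 = 1%g by rewrite /= gh mulVg.
  have := stE _ (g^-1 * h)%g; case uE: (val (g^-1 * h)%g) => [u1 u2] /= uQ u2E.
  rewrite u2E in uQ uE.
  have [d1 _ _] := stab_nform_SO (Qc R) uQ.
  (* An element of the kernel has trivial GL_3 part and determinant 1, so it fixes the equivariant
     frame of the normal form, which is the standard basis. *)
  have := framemx_conj u1 (nform_inV (qmap (in_alg R) Q)).
  rewrite uQ framemx_nform mulmx1 /= d1 => u1E.
  have {}u1E : u1 = 1%g.
    apply: GLmx_inj; rewrite GLmx1 u1E -[LHS]mulmx1; congr (_ *m _).
    by apply/matrixP=> i j; rewrite !mxE if_same.
  apply/esym/(mulgI g^-1%g); rewrite mulVg; apply: val_inj.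
  by rewrite uE u1E.
have /asboolP[hQ h1] := valP h.
pose g2 := GLtr (val h).
have e1 : \det (GLmx g2) = 1.
  have := det_mulmx (GLmx (val h)) (GLinvmx (val h)).
  by rewrite GLmulV det1 h1 mul1r /= det_tr => <-.
(* [y] has the same form and the same [P1] as the normal form, so [act_nform] with c = 1 reaches it
   by an element with trivial GL_3 part. Comparing the two ways of reaching [y] gives a stabilizing
   element above [h]. *)
pose q := qmap (in_alg R) Q; pose y := act (1%g, g2) (nform q).
have yV : inV y by apply: act_inV; apply: nform_inV.
have y3 : Phi3 y = q.
  rewrite /y Phi3_act ?nform_inV //= Phi3_nform GLmx1 det1 qscale1.
  by rewrite [GLmx g2]/= trmxK /q -[in LHS]hQ qcompM GLmulV qcomp1.
have y1 : - P1 y * 1 = 1.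
  by rewrite /y P1_act ?nform_inV //= P1_nform e1 GLmx1 det1 expr1n !mulr1 mul1r opprK.
have [a [aE _ a2]] := act_nform yV y1.
have {}a2 : a.2 = 1%g by apply: GLmx_inj.
have gP : (a^-1 * (1%g, g2))%g \in @stab_pred k (nform Q) R.
  by apply/eqP; rewrite Vmap_nform actM -/q -/y -aE y3 -actM mulVg act1.
exists (SubGrp (@stab_group_closed k (nform Q) R) gP).
apply: val_inj => /=; rewrite a2 invg1 mul1g; exact: GLtrK.
Qed.

Lemma kiso_stab_SO x : U x -> kiso (stab x) (SO (Phi3 x)).
Proof.
move=> Ux; have [g gx] := orbit_nform Ux; have [_ _ x2] := Ux.
rewrite -[in stab x]gx; apply: kiso_trans (kiso_stab_nform x2).
exact/kiso_sym/kiso_stab_act.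
Qed.

End SO.

Lemma det_GLmxV (R : comNzRingType) n (g : GL n R) :
  \det (GLinvmx g) * \det (GLmx g) = 1.
Proof. by rewrite -det_mulmx GLmulVl det1. Qed.

Lemma SO_conj (R : comNzRingType) (Q : tqform R) c (g h : GL 3 R) :
  qcomp Q (GLmx g) = Q ->
  qcomp (qscale c (qcomp Q (GLmx h))) (GLmx (h^-1 * g * h)%g)
  = qscale c (qcomp Q (GLmx h)).
Proof.
move=> gQ; rewrite qcomp_scale qcompM -GLmxM !mulgA mulgV mul1g GLmxM.
by rewrite -qcompM gQ.
Qed.

Lemma qmap_qscale (R S : comNzRingType) (f : {rmorphism R -> S}) c (Q : tqform R) :
  qmap f (qscale c Q) = qscale (f c) (qmap f Q).
Proof. by rewrite /qmap /qscale /= !rmorphM. Qed.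

Lemma SO_similar (k : fieldType) (Q Q' : tqform k) :
  similar Q Q' -> kiso (SO Q) (SO Q').
Proof.
case=> c [h [c0 hU Q'E]]; have [g gh] := unitmx_GL hU.
pose gR (R : comAlgType k) : GLk k 3 R := GLmap (in_alg R) g.
have gRN (R S : comAlgType k) (f : {lrmorphism R -> S}) : pmap f (gR R) = gR S.
  by apply: GLmx_inj; apply/matrixP=> i j; rewrite /GLmx /= !mxE rmorph_alg.
have Q'R (R : comAlgType k) : qmap (in_alg R) Q' =
    qscale (in_alg R c) (qcomp (qmap (in_alg R) Q) (GLmx (gR R))).
  by rewrite Q'E -gh qmap_qscale qmap_qcomp.
have QR (R : comAlgType k) : qmap (in_alg R) Q =
    qscale (in_alg R c^-1) (qcomp (qmap (in_alg R) Q') (GLmx (gR R)^-1%g)).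
  rewrite Q'R qcomp_scale qscaleA qcompM -rmorphM mulVf // rmorph1 qscale1.
  by rewrite -GLmxM mulgV qcomp1.
have phiP (R : comAlgType k) (u : SO Q R) :
    ((gR R)^-1 * val u * gR R)%g \in @SO_pred k Q' R.
  have /asboolP[uQ u1] := valP u; apply/asboolP; split.
    by rewrite Q'R SO_conj.
  by rewrite !GLmxM !det_mulmx u1 mulr1 det_GLmxV.
have psiP (R : comAlgType k) (u : SO Q' R) :
    (gR R * val u * (gR R)^-1)%g \in @SO_pred k Q R.
  have /asboolP[uQ u1] := valP u; apply/asboolP; split.
    rewrite QR -[X in (X * _ * _)%g]invgK.
    exact: SO_conj.
  by rewrite !GLmxM !det_mulmx u1 mulr1 mulrC det_GLmxV.
exists (fun R u => SubGrp (@SO_group_closed k Q' R) (phiP R u)).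
split=> [R|R u v|R S f u].
- exists (fun u => SubGrp (@SO_group_closed k Q R) (psiP R u)) => u;
    apply: val_inj => /=; last by rewrite !mulgA mulVg mul1g mulgKV.
  by rewrite !mulgA mulgV mul1g mulgK.
- by apply: val_inj; rewrite /= !mulgA mulgK.
apply: val_inj.
transitivity (pmap f ((gR R)^-1 * val u * gR R)%g); last by [].
by rewrite !pmapM pmapV gRN.
Qed.

(** Both sides have the same points, since k acts on a restricted K-algebra through [iota]; only the
    subtypes differ. *)
Lemma SO_base_change (k K : fieldType) (iota : {rmorphism k -> K}) (Q : tqform k) :
  kiso (base_change iota (SO Q)) (SO (qmap iota Q)).
Proof.
have phiP (R : comAlgType K) (u : SO Q (resalg iota R)) :
    (val u : GL 3 R) \in @SO_pred K (qmap iota Q) R.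
  by have /asboolP[uQ u1] := valP u; apply/asboolP; split.
exists (fun R u => SubGrp (@SO_group_closed K (qmap iota Q) R) (phiP R u)).
split=> [R|R u v|R S f u]; last 2 first.
- exact: val_inj.
- by apply: val_inj; apply: GLmx_inj; apply/matrixP=> i j; rewrite /GLmx /= !mxE.
apply: inj_surj_bijective => [u v /(congr1 val) uv|u]; first exact: val_inj.
have uP : (val u : GL 3 (resalg iota R)) \in @SO_pred k Q (resalg iota R).
  by have /asboolP[uQ u1] := valP u; apply/asboolP; split.
by exists (SubGrp (@SO_group_closed k Q (resalg iota R)) uP); apply: val_inj.
Qed.

(** * Tangent spaces and the adjoint representation *)

(* R + R^n eps, with square-zero ideal R^n eps. *)
Definition sqz (k : fieldType) (n : nat) (R : comAlgType k) : Type :=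
  (R * 'rV[R]_n)%type.

Section Sqz.
Variables (k : fieldType) (n : nat) (R : comAlgType k).
Local Notation T := (sqz n R).
Implicit Types x y z : T.

HB.instance Definition _ := GRing.Zmodule.on T.

Definition sqz_one : T := (1, 0).
Definition sqz_mul x y : T := (x.1 * y.1, x.1 *: y.2 + y.1 *: x.2).

Fact sqz_mulA : associative sqz_mul.
Proof.
move=> x y z; rewrite /sqz_mul /= mulrA !scalerDr !scalerA addrA.
by congr (_, _ + _ *: _ + _ *: _); rewrite mulrC.
Qed.
Fact sqz_mulC : commutative sqz_mul.
Proof. by move=> x y; rewrite /sqz_mul mulrC addrC. Qed.
Fact sqz_mul1 : left_id sqz_one sqz_mul.
Proof. by move=> [x v]; rewrite /sqz_mul /= mul1r scale1r scaler0 addr0. Qed.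
Fact sqz_mulDl : left_distributive sqz_mul +%R.
Proof.
move=> x y z; rewrite /sqz_mul /= mulrDl; congr (_, _).
by rewrite /= scalerDl scalerDr addrACA.
Qed.
Fact sqz_one_neq0 : sqz_one != 0.
Proof. by apply/eqP=> /(congr1 fst)/eqP; rewrite /= oner_eq0. Qed.

HB.instance Definition _ := GRing.Zmodule_isComNzRing.Build T
  sqz_mulA sqz_mulC sqz_mul1 sqz_mulDl sqz_one_neq0.

Definition sqz_scale (c : k) x : T := (c *: x.1, c%:A *: x.2).
Fact sqz_scaleA a b x : sqz_scale a (sqz_scale b x) = sqz_scale (a * b) x.
Proof. by rewrite /sqz_scale /= !scalerA mulr_algl scalerA. Qed.
Fact sqz_scale1 : left_id 1 sqz_scale.
Proof. by move=> [x v]; rewrite /sqz_scale /= !scale1r. Qed.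
Fact sqz_scaleDr : right_distributive sqz_scale +%R.
Proof. by move=> a x y; rewrite /sqz_scale /= !scalerDr. Qed.
Fact sqz_scaleDl x : {morph sqz_scale^~ x : a b / a + b}.
Proof. by move=> a b; rewrite /sqz_scale !scalerDl. Qed.
HB.instance Definition _ := GRing.Zmodule_isLmodule.Build k T
  sqz_scaleA sqz_scale1 sqz_scaleDr sqz_scaleDl.

Fact sqz_scaleAl (a : k) x y : a *: (x * y) = a *: x * y.
Proof.
rewrite [LHS]/(sqz_scale _ (sqz_mul _ _)) [RHS]/(sqz_mul (sqz_scale _ _) _).
rewrite /sqz_scale /sqz_mul /= scalerAl scalerDr !scalerA mulr_algl.
by rewrite mulr_algl mulr_algr.
Qed.
HB.instance Definition _ := GRing.Lmodule_isLalgebra.Build k T sqz_scaleAl.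
Fact sqz_scaleAr (a : k) x y : a *: (x * y) = x * (a *: y).
Proof. by rewrite mulrC sqz_scaleAl mulrC. Qed.
HB.instance Definition _ := GRing.Lalgebra_isAlgebra.Build k T sqz_scaleAr.

Definition sqz_proj (x : T) : R := x.1.
Fact sqz_proj_zmod : zmod_morphism sqz_proj. Proof. by []. Qed.
Fact sqz_proj_mon : monoid_morphism sqz_proj. Proof. by []. Qed.
Fact sqz_proj_scal : scalable sqz_proj. Proof. by []. Qed.
HB.instance Definition _ := GRing.isZmodMorphism.Build T R sqz_proj sqz_proj_zmod.
HB.instance Definition _ := GRing.isMonoidMorphism.Build T R sqz_proj sqz_proj_mon.
HB.instance Definition _ := GRing.isScalable.Build k T R *:%R sqz_proj sqz_proj_scal.

Definition sqz_inc (r : R) : T := (r, 0).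
Fact sqz_inc_zmod : zmod_morphism sqz_inc.
Proof. by move=> x y; congr (_, _); rewrite /= subr0. Qed.
Fact sqz_inc_mon : monoid_morphism sqz_inc.
Proof. by split=> // x y; congr (_, _); rewrite /= !scaler0 addr0. Qed.
Fact sqz_inc_scal : scalable sqz_inc.
Proof. by move=> c x; congr (_, _); rewrite /= scaler0. Qed.
HB.instance Definition _ := GRing.isZmodMorphism.Build R T sqz_inc sqz_inc_zmod.
HB.instance Definition _ := GRing.isMonoidMorphism.Build R T sqz_inc sqz_inc_mon.
HB.instance Definition _ := GRing.isScalable.Build k R T *:%R sqz_inc sqz_inc_scal.

End Sqz.

Section SqzMap.
Variables (k : fieldType) (n m : nat) (R S : comAlgType k).
Variables (f : {lrmorphism R -> S}) (M : 'M[S]_(n, m)).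

Definition sqz_map (x : sqz n R) : sqz m S := (f x.1, map_mx f x.2 *m M).
Fact sqz_map_zmod : zmod_morphism sqz_map.
Proof. by move=> x y; congr (_, _); rewrite /= ?rmorphB // map_mxB mulmxBl. Qed.
Fact sqz_map_mon : monoid_morphism sqz_map.
Proof.
split; first by congr (_, _); rewrite /= ?rmorph1 // map_mx0 mul0mx.
move=> x y; congr (_, _); rewrite /= ?rmorphM //.
by rewrite map_mxD !map_mxZ mulmxDl -!scalemxAl.
Qed.
Fact sqz_map_scal : scalable sqz_map.
Proof.
move=> c x; congr (_, _); first by rewrite /= linearZ.
transitivity (f c%:A *: (map_mx f x.2 *m M)); last by rewrite rmorph_alg.
by rewrite scalemxAl -map_mxZ.
Qed.
HB.instance Definition _ := GRing.isZmodMorphism.Build _ _ sqz_map sqz_map_zmod.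
HB.instance Definition _ := GRing.isMonoidMorphism.Build _ _ sqz_map sqz_map_mon.
HB.instance Definition _ := GRing.isScalable.Build k _ _ *:%R sqz_map sqz_map_scal.

End SqzMap.

Section AlgHom.
Variables (k : fieldType) (R : comAlgType k).
Definition algin (c : k^o) : R := c%:A.
Fact algin_zmod : zmod_morphism algin.
Proof. by move=> x y; rewrite /algin scalerBl. Qed.
Fact algin_mon : monoid_morphism algin.
Proof. by split=> [|x y]; rewrite /algin ?scale1r // -scalerAl mul1r scalerA. Qed.
Fact algin_scal : scalable algin.
Proof. by move=> c x; rewrite /algin scalerA. Qed.
HB.instance Definition _ := GRing.isZmodMorphism.Build _ _ algin algin_zmod.
HB.instance Definition _ := GRing.isMonoidMorphism.Build _ _ algin algin_mon.
HB.instance Definition _ := GRing.isScalable.Build k _ _ *:%R algin algin_scal.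
End AlgHom.
Arguments algin {k} R c.

Lemma pmap_ext (k : fieldType) (H : kgroup k) (R S : comAlgType k)
  (f g : {lrmorphism R -> S}) (x : H R) : f =1 g -> pmap f x = pmap g x.
Proof. by move=> /lrmorphism_ext ->. Qed.

Section Frames.
Variables (k : fieldType) (H : kgroup k).

(** Each column of [M] lists the coordinates of one tangent vector in the frame, so [n] columns
    describe a point over R + R^n eps. *)
Definition tanmap (R : comAlgType k) n (M : 'M[R]_(3, n)) :
    {lrmorphism sqz 3 (k^o) -> sqz n R} :=
  sqz_map (algin R : {lrmorphism k^o -> R}) M.

(* A basis, over every R at once, of the tangent space of H at 1; [t] is the
   universal combination of the three basis vectors. *)
Definition isframe (t : H (sqz 3 (k^o))) : Prop :=
  pmap (sqz_proj (n := 3) (R := k^o) : {lrmorphism _ -> _}) t = 1%g /\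
  forall (R : comAlgType k) n (u : H (sqz n R)),
    pmap (sqz_proj (n := n) (R := R) : {lrmorphism _ -> _}) u = 1%g ->
    exists! M : 'M[R]_(3, n), u = pmap (tanmap M) t.

Variables (t : H (sqz 3 (k^o))) (tP : isframe t).

Lemma pmap_compE (R S T : comAlgType k) (f : {lrmorphism R -> S})
  (g : {lrmorphism S -> T}) (h : {lrmorphism R -> T}) (x : H R) :
  (forall a, g (f a) = h a) -> pmap g (pmap f x) = pmap h x.
Proof. by move=> gf; rewrite -pmap_comp; apply: pmap_ext. Qed.

Lemma isframe_ker (R : comAlgType k) n (M : 'M[R]_(3, n)) :
  pmap (sqz_proj (n := n) (R := R) : {lrmorphism _ -> _}) (pmap (tanmap M) t) = 1%g.
Proof.
case: tP => t1 _.
rewrite -[RHS](pmap1 H (algin R : {lrmorphism k^o -> R})) -t1 -!pmap_comp.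
exact: pmap_ext.
Qed.

Lemma isframe_inj (R : comAlgType k) n (M M' : 'M[R]_(3, n)) :
  pmap (tanmap M) t = pmap (tanmap M') t -> M = M'.
Proof.
case: tP => _ /(_ R n _ (isframe_ker M))[M0 [_ M0u]] MM'.
by rewrite -(M0u M) // (M0u M').
Qed.

Lemma sqz_map_tanmap (R S : comAlgType k) (f : {lrmorphism R -> S}) n m
    (M : 'M[R]_(3, n)) (N : 'M[S]_(n, m)) (x : H (sqz 3 (k^o))) :
  pmap (sqz_map f N : {lrmorphism _ -> _}) (pmap (tanmap M) x)
  = pmap (tanmap (map_mx f M *m N)) x.
Proof.
apply: pmap_compE => -[c v]; congr (_, _); first exact: (rmorph_alg f).
rewrite /= map_mxM -mulmxA; congr (_ *m _).
by apply/matrixP=> i j; rewrite !mxE; exact: (rmorph_alg f).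
Qed.

Definition conj_frame (R : comAlgType k) (x : H R) : H (sqz 3 R) :=
  let y := pmap (sqz_inc 3 (R := R) : {lrmorphism _ -> _}) x in
  (y * pmap (tanmap 1%:M) t * y^-1)%g.

Lemma conj_frame_ker (R : comAlgType k) (x : H R) :
  pmap (sqz_proj (n := 3) (R := R) : {lrmorphism _ -> _}) (conj_frame x) = 1%g.
Proof.
rewrite /conj_frame !pmapM pmapV isframe_ker mulg1 -pmapV -pmapM.
by rewrite mulgV !pmap1.
Qed.

(** The matrix of Ad(x) in the frame: column j holds the coordinates of the conjugate of the j-th
    basis vector. *)
Definition adrho (R : comAlgType k) (x : H R) : 'M[R]_3 :=
  projT1 (cid (proj2 tP R 3 _ (conj_frame_ker x))).

Lemma adrhoP (R : comAlgType k) (x : H R) :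
  conj_frame x = pmap (tanmap (adrho x)) t.
Proof. by rewrite /adrho; case: cid => M []. Qed.

(** The case [M = 1%:M] defines [adrho]; the general one follows by functoriality along the algebra
    morphism that [M] induces on the eps part. *)
Lemma adrho_conj (R : comAlgType k) n (M : 'M[R]_(3, n)) (x : H R) :
  let y := pmap (sqz_inc n (R := R) : {lrmorphism _ -> _}) x in
  (y * pmap (tanmap M) t * y^-1)%g = pmap (tanmap (adrho x *m M)) t.
Proof.
have := congr1 (pmap (sqz_map (idfun : {lrmorphism R -> R}) M : {lrmorphism _ -> _}))
  (adrhoP x).
rewrite sqz_map_tanmap !pmapM pmapV sqz_map_tanmap !map_mx_id // mul1mx => <- /=.
suff -> : pmap (sqz_map (idfun : {lrmorphism R -> R}) M : {lrmorphism _ -> _})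
    (pmap (sqz_inc 3 (R := R) : {lrmorphism _ -> _}) x) =
    pmap (sqz_inc n (R := R) : {lrmorphism _ -> _}) x by [].
apply: pmap_compE => a; congr (_, _).
by rewrite /= map_mx0 mul0mx.
Qed.

Lemma adrhoM (R : comAlgType k) (x y : H R) : adrho (x * y)%g = adrho x *m adrho y.
Proof.
apply: isframe_inj; rewrite -adrhoP -adrho_conj /= -adrhoP /conj_frame.
by rewrite !pmapM invMg !mulgA.
Qed.

Lemma adrho1 (R : comAlgType k) : adrho (1%g : H R) = 1%:M.
Proof.
by apply: isframe_inj; rewrite -adrhoP /conj_frame pmap1 mul1g invg1 mulg1.
Qed.

Lemma adrho_map (R S : comAlgType k) (f : {lrmorphism R -> S}) (x : H R) :
  adrho (pmap f x) = map_mx f (adrho x).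
Proof.
apply: isframe_inj; rewrite -adrhoP.
rewrite -[X in tanmap X]mulmx1 -sqz_map_tanmap -adrhoP /conj_frame.
rewrite !pmapM !pmapV sqz_map_tanmap map_mx1 mulmx1.
suff -> : pmap (sqz_map f 1%:M : {lrmorphism _ -> _})
    (pmap (sqz_inc 3 (R := R) : {lrmorphism _ -> _}) x) =
  pmap (sqz_inc 3 (R := S) : {lrmorphism _ -> _}) (pmap f x) by [].
rewrite -!pmap_comp; apply: pmap_ext => a; congr (_, _).
by rewrite /= map_mx0 mul0mx.
Qed.

End Frames.

Lemma isframe_kiso (k : fieldType) (H H' : kgroup k)
  (phi : forall R : comAlgType k, H R -> H' R) (t : H (sqz 3 (k^o))) :
  (forall R, bijective (phi R)) ->
  (forall R, {morph phi R : x y / (x * y)%g}) ->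
  (forall (R S : comAlgType k) (f : {lrmorphism R -> S}) (x : H R),
          phi S (pmap f x) = pmap f (phi R x)) ->
  isframe t -> isframe (phi _ t).
Proof.
move=> phib phiM phiN [t1 tP].
have phi1 R : phi R 1%g = 1%g.
  exact: group_mor1 (phiM R).
split=> [|R n u u1]; first by rewrite -phiN t1 phi1.
have [psi phiK psiK] := phib (sqz n R).
have [|M [Mt Mu]] := tP R n (psi u).
  by apply: (bij_inj (phib R)); rewrite phiN psiK u1 phi1.
exists M; split=> [|N]; first by rewrite -phiN -Mt psiK.
by rewrite -phiN => uN; apply: Mu; rewrite uN phiK.
Qed.

(** Each frame has coordinates in the other, and uniqueness of coordinates makes the two matrices
    mutually inverse. *)
Lemma isframe_change (k : fieldType) (H : kgroup k) (s t : H (sqz 3 (k^o))) :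
  isframe s -> isframe t ->
  exists2 T : 'M[k]_3, T \in unitmx & s = pmap (tanmap (T : 'M[k^o]_3)) t.
Proof.
move=> sP tP; have [s1 sF] := sP; have [t1 tF] := tP.
have [T [sT _]] := tF (k^o) 3%N s s1; have [S [tS _]] := sF (k^o) 3%N t t1.
exists T => //.
have tanE M (u : H (sqz 3 (k^o))) : pmap (tanmap M) u =
    pmap (sqz_map (idfun : {lrmorphism k^o -> k^o}) M : {lrmorphism _ -> _}) u.
  apply: pmap_ext => -[a v]; congr (_, _); first by rewrite /= /algin [LHS]mulr1.
  by congr (_ *m _); apply/matrixP=> i j; rewrite !mxE [LHS]mulr1.
have TS : T *m S = 1%:M.
  apply: (isframe_inj tP); rewrite -[in T *m S](map_mx_id (f := idfun) _ T) //.
  rewrite -(sqz_map_tanmap (idfun : {lrmorphism k^o -> k^o})) -sT -tanE -tS tanE.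
  rewrite -[LHS]pmap_id; apply: pmap_ext => -[a v]; congr (_, _).
  by rewrite /= map_mx_id // mulmx1.
by have [] := mulmx1_unit TS.
Qed.

(** Both products are the coordinates in [t'] of the image under [phi] of the conjugated frame
    [t]. *)
Lemma adrho_kiso (k : fieldType) (H H' : kgroup k)
  (phi : forall R : comAlgType k, H R -> H' R)
  (phiM : forall R, {morph phi R : x y / (x * y)%g})
  (phiN : forall (R S : comAlgType k) (f : {lrmorphism R -> S}) (x : H R),
          phi S (pmap f x) = pmap f (phi R x))
  (t : H (sqz 3 (k^o))) (t' : H' (sqz 3 (k^o)))
  (tP : isframe t) (tP' : isframe t') (T : 'M[k]_3) :
  phi _ t = pmap (tanmap (T : 'M[k^o]_3)) t' ->
  forall (R : comAlgType k) (x : H R),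
    map_mx (in_alg R) T *m adrho tP x = adrho tP' (phi R x) *m map_mx (in_alg R) T.
Proof.
move=> phit R x.
have phiV S y : phi S y^-1%g = (phi S y)^-1%g := group_morV (phiM S) y.
have tanE M : phi _ (pmap (tanmap M) t) =
    pmap (tanmap (map_mx (in_alg R) T *m M)) t'.
  rewrite phiN phit; apply: pmap_compE => -[c v].
  congr (_, _); first by congr algin; exact: mulr1.
  rewrite /= map_mxM -mulmxA; congr (_ *m _).
  by apply/matrixP=> i j; rewrite !mxE; congr algin; exact: mulr1.
apply: (isframe_inj tP'); rewrite -tanE -adrhoP -adrho_conj.
rewrite /conj_frame !phiM phiV phiN tanE.
by rewrite mulmx1.
Qed.

(** * The tangent space of SO(Q) *)

Section LieSO.
Variable R : comNzRingType.
Implicit Types (Q : tqform R) (X h : 'M[R]_3) (v : 'cV[R]_3).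

Definition mx3 (a b c d e f g h i : R) : 'M[R]_3 :=
  \matrix_(p, q) nth 0 (nth [::] [:: [:: a; b; c]; [:: d; e; f]; [:: g; h; i]] p) q.

(** The Gram matrix of [qpol Q]; it is never inverted, being singular when 2 = 0. *)
Definition polmx Q : 'M[R]_3 :=
  mx3 (2%:R * qa Q) (qb Q) (qc Q) (qb Q) (2%:R * qd Q) (qe Q) (qc Q) (qe Q) (2%:R * qf Q).

(** The matrix of the cross product w |-> v x w. *)
Definition crossmx v : 'M[R]_3 :=
  mx3 0 (- v 2%:R 0) (v 1 0) (v 2%:R 0) 0 (- v 0 0) (- v 1 0) (v 0 0) 0.

Lemma mul3 (X Y : 'M[R]_3) i j :
  (X *m Y) i j = X i 0 * Y 0 j + X i 1 * Y 1 j + X i 2%:R * Y 2%:R j.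
Proof. by rewrite mxE sum3. Qed.

Lemma crossmxE v :
  (crossmx v 0 0 = 0) * (crossmx v 0 1 = - v 2%:R 0) * (crossmx v 0 2%:R = v 1 0)
  * ((crossmx v 1 0 = v 2%:R 0) * (crossmx v 1 1 = 0) * (crossmx v 1 2%:R = - v 0 0))
  * ((crossmx v 2%:R 0 = - v 1 0) * (crossmx v 2%:R 1 = v 0 0)
     * (crossmx v 2%:R 2%:R = 0)).
Proof. by rewrite !mxE. Qed.

Lemma polmxE Q :
  (polmx Q 0 0 = 2%:R * qa Q) * (polmx Q 0 1 = qb Q) * (polmx Q 0 2%:R = qc Q)
  * ((polmx Q 1 0 = qb Q) * (polmx Q 1 1 = 2%:R * qd Q) * (polmx Q 1 2%:R = qe Q))
  * ((polmx Q 2%:R 0 = qc Q) * (polmx Q 2%:R 1 = qe Q)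
     * (polmx Q 2%:R 2%:R = 2%:R * qf Q)).
Proof. by rewrite !mxE. Qed.

(* Chosen so that [liev Q (crossmx v *m polmx Q) = Phi4 Q *: v]. *)
Definition liev Q X : 'cV[R]_3 :=
  let: TQForm a b c d e f := Q in
  \col_i nth 0 [::
  a * c * X 0 1 + 4%:R * a * d * X 1 2%:R + a * e * X 2%:R 2%:R + 2%:R * a * f * X 2%:R 1 - b * b * X 1 2%:R + b * c * X 1 1 - b * f * X 2%:R 0 - c * d * X 1 0;
  2%:R * a * d * X 0 2%:R - a * e * X 0 1 + b * d * X 1 2%:R + b * e * X 2%:R 2%:R - b * f * X 2%:R 1 + c * d * X 0 0 + 4%:R * d * f * X 2%:R 0 - e * e * X 2%:R 0;
  - a * e * X 0 2%:R + 4%:R * a * f * X 0 1 + b * f * X 1 1 - c * c * X 0 1 - c * d * X 1 2%:R + c * e * X 0 0 + 2%:R * d * f * X 1 0 + e * f * X 2%:R 0] (nat_of_ord i).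

(* The tangent space at 1 of SO(Q). *)
Definition lieP Q X : Prop :=
  [/\ (polmx Q *m X) 0 0 = 0, (polmx Q *m X) 1 1 = 0 & (polmx Q *m X) 2%:R 2%:R = 0]
  /\ [/\ (polmx Q *m X) 0 1 + (polmx Q *m X) 1 0 = 0,
         (polmx Q *m X) 0 2%:R + (polmx Q *m X) 2%:R 0 = 0,
         (polmx Q *m X) 1 2%:R + (polmx Q *m X) 2%:R 1 = 0
       & X 0 0 + X 1 1 + X 2%:R 2%:R = 0].

Lemma liev_cross Q v : liev Q (crossmx v *m polmx Q) = Phi4 Q *: v.
Proof.
case: Q => a b c d e f; apply/matrixP=> i j; rewrite ord1 !mxE.
by move: i; apply: ord3P; rewrite /= !(mxE, sum3) /=; ring.
Qed.

Lemma lieP_cross Q v : lieP Q (crossmx v *m polmx Q).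
Proof.
case: Q => a b c d e f; rewrite /lieP !mul3 !polmxE !crossmxE /=.
by split; split; ring.
Qed.

(** With [liev_cross] and [lieP_cross] this makes v |-> [crossmx v *m polmx Q] a bijection onto the
    tangent space when [Phi4 Q] is a unit. Inverting [polmx Q] instead would require 2 to be a unit
    as well. *)
Lemma lieP_liev Q X : lieP Q X -> Phi4 Q *: X = crossmx (liev Q X) *m polmx Q.
Proof.
case: Q => a b c d e f [[r11 r22 r33] [r12 r13 r23 tr]].
rewrite !(mxE, sum3) /= in r11 r22 r33 r12 r13 r23.
(* Each entry is an explicit linear combination of the equations of [lieP]. *)
pose sr11 := 2%:R * a * X 0 0 + b * X 1 0 + c * X 2%:R 0.
pose sr22 := b * X 0 1 + 2%:R * d * X 1 1 + e * X 2%:R 1.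
pose sr33 := c * X 0 2%:R + e * X 1 2%:R + 2%:R * f * X 2%:R 2%:R.
pose sr12 := 2%:R * a * X 0 1 + b * X 0 0 + b * X 1 1 + c * X 2%:R 1 + 2%:R * d * X 1 0 + e * X 2%:R 0.
pose sr13 := 2%:R * a * X 0 2%:R + b * X 1 2%:R + c * X 0 0 + c * X 2%:R 2%:R + e * X 1 0 + 2%:R * f * X 2%:R 0.
pose sr23 := b * X 0 2%:R + c * X 0 1 + 2%:R * d * X 1 2%:R + e * X 1 1 + e * X 2%:R 2%:R + 2%:R * f * X 2%:R 1.
pose str := X 0 0 + X 1 1 + X 2%:R 2%:R.
have zr11 : sr11 = 0 by rewrite -[RHS]r11 /sr11; ring.
have zr22 : sr22 = 0 by rewrite -[RHS]r22 /sr22; ring.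
have zr33 : sr33 = 0 by rewrite -[RHS]r33 /sr33; ring.
have zr12 : sr12 = 0 by rewrite -[RHS]r12 /sr12; ring.
have zr13 : sr13 = 0 by rewrite -[RHS]r13 /sr13; ring.
have zr23 : sr23 = 0 by rewrite -[RHS]r23 /sr23; ring.
have ztr : str = 0 by rewrite -[RHS]tr /str; ring.
apply/matrixP; apply: ord3P; apply: ord3P; rewrite !(mxE, sum3) /=;
  apply/eqP; rewrite -subr_eq0; apply/eqP.
- transitivity (2%:R * a * f * sr22
    - c * c * sr22
    + 2%:R * a * d * sr33
    + b * f * sr12
    + c * e * sr12
    - 2%:R * c * d * sr13
    - a * e * sr23
    - 4%:R * a * d * f * str
    + a * e * e * str
    - b * c * e * str
    + 2%:R * c * c * d * str); first by rewrite /sr12 /sr13 /sr22 /sr23 /sr33 /str; ring.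
  by rewrite zr12 zr13 zr22 zr23 zr33 ztr; ring.
- transitivity (b * f * sr22
    - c * e * sr22
    + b * d * sr33
    + 2%:R * d * f * sr12
    + e * e * sr12
    - 2%:R * d * e * sr13
    - c * d * sr23
    - 2%:R * b * d * f * str
    - b * e * e * str
    + 3%:R * c * d * e * str); first by rewrite /sr12 /sr13 /sr22 /sr23 /sr33 /str; ring.
  by rewrite zr12 zr13 zr22 zr23 zr33 ztr; ring.
- transitivity (- c * f * sr22
    + c * d * sr33
    + 3%:R * e * f * sr12
    - 4%:R * d * f * sr13
    + b * f * sr23
    - c * e * sr23
    - 3%:R * b * e * f * str
    + 2%:R * c * d * f * str
    + c * e * e * str); first by rewrite /sr12 /sr13 /sr22 /sr23 /sr33 /str; ring.
  by rewrite zr12 zr13 zr22 zr23 zr33 ztr; ring.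
- transitivity (b * f * sr11
    - a * b * sr33
    - 4%:R * a * f * sr12
    + a * e * sr13
    - b * c * sr13
    + 3%:R * a * c * sr23
    + 2%:R * a * b * f * str
    - 3%:R * a * c * e * str
    + b * c * c * str); first by rewrite /sr11 /sr12 /sr13 /sr23 /sr33 /str; ring.
  by rewrite zr11 zr12 zr13 zr23 zr33 ztr; ring.
- transitivity (2%:R * d * f * sr11
    + 2%:R * a * d * sr33
    - b * b * sr33
    - 2%:R * b * f * sr12
    - c * d * sr13
    + a * e * sr23
    + b * c * sr23
    - 4%:R * a * d * f * str
    + 2%:R * b * b * f * str
    - b * c * e * str
    + c * c * d * str); first by rewrite /sr11 /sr12 /sr13 /sr23 /sr33 /str; ring.
  by rewrite zr11 zr12 zr13 zr23 zr33 ztr; ring.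
- transitivity (e * f * sr11
    + a * e * sr33
    - b * c * sr33
    - 2%:R * c * f * sr12
    - b * f * sr13
    + 2%:R * a * f * sr23
    + c * c * sr23
    - 2%:R * a * e * f * str
    + 3%:R * b * c * f * str
    - c * c * e * str); first by rewrite /sr11 /sr12 /sr13 /sr23 /sr33 /str; ring.
  by rewrite zr11 zr12 zr13 zr23 zr33 ztr; ring.
- transitivity (- b * e * sr11
    + c * d * sr11
    + a * c * sr22
    - a * e * sr12
    + 2%:R * a * d * sr13
    + b * b * sr13
    - 2%:R * a * b * sr23
    + 3%:R * a * b * e * str
    - 2%:R * a * c * d * str
    - b * b * c * str); first by rewrite /sr11 /sr12 /sr13 /sr22 /sr23 /str; ring.
  by rewrite zr11 zr12 zr13 zr22 zr23 ztr; ring.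
- transitivity (- d * e * sr11
    + a * e * sr22
    - b * e * sr12
    + c * d * sr12
    + 3%:R * b * d * sr13
    - 4%:R * a * d * sr23
    + 2%:R * a * d * e * str
    + b * b * e * str
    - 3%:R * b * c * d * str); first by rewrite /sr11 /sr12 /sr13 /sr22 /sr23 /str; ring.
  by rewrite zr11 zr12 zr13 zr22 zr23 ztr; ring.
- transitivity (2%:R * d * f * sr11
    - e * e * sr11
    + 2%:R * a * f * sr22
    - b * f * sr12
    + b * e * sr13
    + c * d * sr13
    - 2%:R * a * e * sr23
    - 4%:R * a * d * f * str
    + 2%:R * a * e * e * str
    + b * b * f * str
    - b * c * e * str); first by rewrite /sr11 /sr12 /sr13 /sr22 /sr23 /str; ring.
  by rewrite zr11 zr12 zr13 zr22 zr23 ztr; ring.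
Qed.

Lemma polmx_qcomp Q h : polmx (qcomp Q h) = h^T *m polmx Q *m h.
Proof.
case: Q => a b c d e f; apply/matrixP; apply: ord3P; apply: ord3P;
by rewrite !(mxE, sum3) /= /qval /qpol /tqeval /= !mxE; ring.
Qed.

(** The cofactor rule h (h^T v x h^T w) = det(h) (v x w), which involves no inverse. *)
Lemma crossmx_conj h v : h *m crossmx (h^T *m v) *m h^T = \det h *: crossmx v.
Proof.
have wE i : (h^T *m v) i 0 = h 0 i * v 0 0 + h 1 i * v 1 0 + h 2%:R i * v 2%:R 0.
  by rewrite mxE sum3 !mxE.
apply/matrixP; apply: ord3P; apply: ord3P;
  rewrite !mul3 [RHS]mxE !crossmxE !wE det3 ![h^T _ _]mxE; ring.
Qed.

(** Products of entries of [N] vanish, so first-order expansions are exact. The square coefficients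
    change by the diagonal of [polmx Q *m N] itself, not by its double: that matrix must be
    alternating and not merely skew. *)
Lemma SO_tangent Q (N : 'M[R]_3) : (forall i j p q, N i j * N p q = 0) ->
  (qcomp Q (1%:M + N) = Q /\ \det (1%:M + N) = 1) <-> lieP Q N.
Proof.
case: Q => a b c d e f NN.
have dE : \det (1%:M + N) = 1 + (N 0 0 + N 1 1 + N 2%:R 2%:R).
  rewrite det3 !mxE /=.
  transitivity (1 + (N 0 0 + N 1 1 + N 2%:R 2%:R)
    + N 0 0 * N 1 1 * (1 + N 2%:R 2%:R) + N 0 0 * N 2%:R 2%:R
    + N 1 1 * N 2%:R 2%:R - N 1 2%:R * N 2%:R 1 * (1 + N 0 0)
    - N 0 1 * N 1 0 * (1 + N 2%:R 2%:R) + N 0 1 * N 1 2%:R * N 2%:R 0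
    + N 0 2%:R * N 1 0 * N 2%:R 1 - N 0 2%:R * N 2%:R 0 * (1 + N 1 1)).
    by ring.
  by rewrite !NN !(mul0r, subr0, addr0).
pose B := polmx (TQForm a b c d e f) *m N.
have qE : qcomp (TQForm a b c d e f) (1%:M + N) =
    TQForm (a + B 0 0) (b + (B 0 1 + B 1 0)) (c + (B 0 2%:R + B 2%:R 0))
      (d + B 1 1) (e + (B 1 2%:R + B 2%:R 1)) (f + B 2%:R 2%:R).
  pose qv i := a * (N 0 i * N 0 i) + b * (N 0 i * N 1 i) + c * (N 0 i * N 2%:R i)
    + d * (N 1 i * N 1 i) + e * (N 1 i * N 2%:R i) + f * (N 2%:R i * N 2%:R i).
  pose qp i j := 2%:R * a * (N 0 i * N 0 j) + b * (N 0 i * N 1 j + N 1 i * N 0 j)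
    + c * (N 0 i * N 2%:R j + N 2%:R i * N 0 j)
    + 2%:R * d * (N 1 i * N 1 j) + e * (N 1 i * N 2%:R j + N 2%:R i * N 1 j)
    + 2%:R * f * (N 2%:R i * N 2%:R j).
  have qv0 i : qv i = 0 by rewrite /qv !NN !mulr0 !addr0.
  have qp0 i j : qp i j = 0 by rewrite /qp !NN !(addr0, mulr0).
  rewrite /qcomp /qval /qpol /tqeval /= !mxE /B !(mxE, sum3) /=; congr TQForm.
  - by rewrite -[RHS]addr0 -(qv0 0) /qv; ring.
  - by rewrite -[RHS]addr0 -(qp0 0 1) /qp; ring.
  - by rewrite -[RHS]addr0 -(qp0 0 2%:R) /qp; ring.
  - by rewrite -[RHS]addr0 -(qv0 1) /qv; ring.
  - by rewrite -[RHS]addr0 -(qp0 1 2%:R) /qp; ring.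
  - by rewrite -[RHS]addr0 -(qv0 2%:R) /qv; ring.
rewrite dE qE /lieP -/B; split=> [[[r11 r12 r13 r22 r23 r33] tr]|].
  have cancel0 (x y : R) : x + y = x -> y = 0.
    by move=> xy; apply: (addrI x); rewrite xy addr0.
  by split; split; apply: cancel0; eassumption.
by case=> [[-> -> ->] [-> -> -> ->]]; rewrite !addr0.
Qed.

End LieSO.

Lemma map_crossmx (R S : comNzRingType) (f : {rmorphism R -> S}) (v : 'cV[R]_3) :
  map_mx f (crossmx v) = crossmx (map_mx f v).
Proof.
apply/matrixP; apply: ord3P; apply: ord3P;
  by rewrite !mxE /= ?mxE ?rmorphN ?rmorph0.
Qed.

Lemma map_polmx (R S : comNzRingType) (f : {rmorphism R -> S}) (Q : tqform R) :
  map_mx f (polmx Q) = polmx (qmap f Q).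
Proof.
apply/matrixP; apply: ord3P; apply: ord3P;
  by rewrite !mxE /= ?rmorphM ?rmorph_nat.
Qed.

Lemma map_liev (R S : comNzRingType) (f : {rmorphism R -> S}) (Q : tqform R) X :
  map_mx f (liev Q X) = liev (qmap f Q) (map_mx f X).
Proof.
case: Q => *; apply/matrixP=> i j; rewrite ord1 /qmap !mxE /=.
by move: i; apply: ord3P; rewrite /= ?mxE; ring.
Qed.

Lemma crossmx0 (R : comNzRingType) : crossmx 0 = 0 :> 'M[R]_3.
Proof.
by apply/matrixP; apply: ord3P; apply: ord3P; rewrite !mxE /= ?mxE ?oppr0.
Qed.

(** Invariance of the form moves [hi] across [polmx Q] as [h^T]; then [crossmx_conj] applies with
    determinant 1. *)
Lemma SO_adjoint (R : comNzRingType) (Q : tqform R) (h hi : 'M[R]_3) w :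
  qcomp Q h = Q -> \det h = 1 -> h *m hi = 1%:M ->
  h *m (crossmx w *m polmx Q) *m hi = crossmx (hi^T *m w) *m polmx Q.
Proof.
move=> hQ h1 hhi.
have BE : polmx Q *m hi = h^T *m polmx Q.
  by rewrite -[in LHS]hQ polmx_qcomp -!mulmxA hhi mulmx1.
rewrite -!mulmxA BE !mulmxA; congr (_ *m _).
have := crossmx_conj h (hi^T *m w).
by rewrite h1 scale1r mulmxA -trmx_mul (mulmx1C hhi) trmx1 mul1mx.
Qed.

Lemma map_tangent (R S : comNzRingType) (f : {rmorphism R -> S}) v (Q : tqform R) :
  map_mx f (1%:M + crossmx v *m polmx Q)
  = 1%:M + crossmx (map_mx f v) *m polmx (qmap f Q).
Proof. by rewrite map_mxD map_mx1 map_mxM map_crossmx map_polmx. Qed.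

Lemma tangent_inj (R : comNzRingType) (Q : tqform R) c v v' : c * Phi4 Q = 1 ->
  crossmx v *m polmx Q = crossmx v' *m polmx Q -> v = v'.
Proof.
move=> cQ /(congr1 (fun X => c *: liev Q X)).
by rewrite !liev_cross !scalerA cQ !scale1r.
Qed.

Lemma tangent_surj (R : comNzRingType) (Q : tqform R) c N : c * Phi4 Q = 1 ->
  lieP Q N -> N = crossmx (c *: liev Q N) *m polmx Q.
Proof.
move=> cQ /lieP_liev/(congr1 (fun X => c *: X)).
rewrite scalerA cQ scale1r => {1}->; rewrite scalemxAl; congr (_ *m _).
by apply/matrixP; apply: ord3P; apply: ord3P; rewrite !mxE /= ?mxE ?mulr0 ?mulrN.
Qed.

Lemma liev0 (R : comNzRingType) (Q : tqform R) : liev Q 0 = 0.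
Proof.
case: Q => *; apply/matrixP=> i j; rewrite !mxE.
by move: i; apply: ord3P; rewrite /= ?mxE; ring.
Qed.

Lemma Phi4_in_alg (k : fieldType) (R : comAlgType k) (Q : tqform k) :
  Phi4 Q != 0 -> in_alg R (Phi4 Q)^-1 * Phi4 (qmap (in_alg R) Q) = 1.
Proof. by move=> Q0; rewrite Phi4_map -rmorphM mulVf // rmorph1. Qed.

Section SOFrame.
Variables (k : fieldType) (Q : tqform k) (Q0 : Phi4 Q != 0).

(** The vector sum_j (column j of [M]) eps_j, without constant part. *)
Definition epsv n (R : comAlgType k) (M : 'M[R]_(3, n)) : 'cV[sqz n R]_3 :=
  \col_i (0, row i M).

Lemma sqz_mul0 n (R : comAlgType k) (x y : sqz n R) : x.1 = 0 -> y.1 = 0 -> x * y = 0.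
Proof.
case: x y => [x v] [y w] /= -> ->; congr (_, _); rewrite /= ?mulr0 //.
by rewrite !scale0r addr0.
Qed.

Lemma map_proj_epsv n (R : comAlgType k) (M : 'M[R]_(3, n)) :
  map_mx (@sqz_proj k n R) (epsv M) = 0.
Proof. by apply/matrixP=> i j; rewrite !mxE. Qed.

Definition tanN n (R : comAlgType k) (M : 'M[R]_(3, n)) : 'M[sqz n R]_3 :=
  crossmx (epsv M) *m polmx (qmap (in_alg (sqz n R)) Q).

Lemma map_proj_tanN n (R : comAlgType k) (M : 'M[R]_(3, n)) :
  map_mx (@sqz_proj k n R) (tanN M) = 0.
Proof. by rewrite map_mxM map_crossmx map_proj_epsv crossmx0 mul0mx. Qed.

Lemma sqz_proj0_mul n (R : comAlgType k) (N : 'M[sqz n R]_3) :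
  map_mx (@sqz_proj k n R) N = 0 -> forall i j p q, N i j * N p q = 0.
Proof.
move=> /matrixP N0 i j p q; apply: sqz_mul0.
  by have := N0 i j; rewrite !mxE.
by have := N0 p q; rewrite !mxE.
Qed.

Lemma tanN_SO n (R : comAlgType k) (M : 'M[R]_(3, n)) :
  qcomp (qmap (in_alg (sqz n R)) Q) (1%:M + tanN M) = qmap (in_alg (sqz n R)) Q
  /\ \det (1%:M + tanN M) = 1.
Proof.
apply/SO_tangent; last exact: lieP_cross.
exact/sqz_proj0_mul/map_proj_tanN.
Qed.

Lemma qmap_algin (R S : comAlgType k) (f : {lrmorphism R -> S}) :
  qmap f (qmap (in_alg R) Q) = qmap (in_alg S) Q.
Proof. by rewrite /qmap /=; congr TQForm; rewrite rmorph_alg. Qed.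

Lemma map_tanN n (R : comAlgType k) (M : 'M[R]_(3, n)) :
  map_mx (tanmap M) (1%:M + tanN (1%:M : 'M[k^o]_3)) = 1%:M + tanN M.
Proof.
apply: etrans (map_tangent _ _ _) _; rewrite [qmap _ _](qmap_algin (tanmap M)).
congr (_ + crossmx _ *m _); apply/matrixP=> i j; rewrite !mxE.
congr (_, _); first exact: raddf0.
by rewrite /= map_row map_mx1 row1 -rowE.
Qed.

Lemma tanN_inj n (R : comAlgType k) (M M' : 'M[R]_(3, n)) : tanN M = tanN M' -> M = M'.
Proof.
move=> /(tangent_inj (Phi4_in_alg _ Q0)) MM.
apply/row_matrixP=> i.
by have /matrixP/(_ i 0) := MM; rewrite !mxE => -[].
Qed.

Lemma tanN_surj n (R : comAlgType k) (N : 'M[sqz n R]_3) :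
  map_mx (@sqz_proj k n R) N = 0 -> lieP (qmap (in_alg (sqz n R)) Q) N ->
  exists M, N = tanN M.
Proof.
move=> N0 NQ; set q := qmap _ Q in NQ; pose c := in_alg (sqz n R) (Phi4 Q)^-1.
(* Since [c] inverts [Phi4], the vector attached to [N] is [c *: liev q N]. Its constant part is
   zero, as [liev] maps 0 to 0, so only eps coefficients remain to be recorded. *)
exists (\matrix_(m, l) (c * liev q N m 0).2 0 l).
apply: etrans (tangent_surj (Phi4_in_alg _ Q0) NQ) _.
congr (crossmx _ *m _); apply/matrixP=> i j; rewrite ord1 [LHS]mxE [RHS]mxE -/c.
have vp : sqz_proj (liev q N i 0) = 0.
  have /matrixP/(_ i 0) := map_liev (@sqz_proj k n R) q N.
  by rewrite N0 liev0 !mxE.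
have cvp : (c * liev q N i 0).1 = 0.
  exact: (etrans (rmorphM (@sqz_proj k n R) c _)
    (etrans (congr1 ( *%R _) vp) (mulr0 _))).
rewrite [LHS]surjective_pairing cvp; congr (_, _).
by apply/matrixP=> p l; rewrite ord1 !mxE.
Qed.

Lemma GL_of_tanN_subproof n (R : comAlgType k) (M : 'M[R]_(3, n)) :
  \det (1%:M + tanN M) * 1 = 1.
Proof. by rewrite mulr1; case: (tanN_SO M). Qed.

Lemma GL_of_tanN_SO n (R : comAlgType k) (M : 'M[R]_(3, n)) :
  (GL_of_det (GL_of_tanN_subproof M) : GLk k 3 (sqz n R)) \in @SO_pred k Q (sqz n R).
Proof. apply/asboolP; exact: tanN_SO. Qed.

Definition SOtan n (R : comAlgType k) (M : 'M[R]_(3, n)) : SO Q (sqz n R) :=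
  SubGrp (@SO_group_closed k Q (sqz n R)) (GL_of_tanN_SO M).

Lemma pmap_SOtan n (R : comAlgType k) (M : 'M[R]_(3, n)) :
  pmap (tanmap M) (SOtan (1%:M : 'M[k^o]_3)) = SOtan M.
Proof. apply: val_inj; apply: GLmx_inj; exact: map_tanN. Qed.

Lemma SO_isframe : isframe (SOtan (1%:M : 'M[k^o]_3)).
Proof.
split.
  apply: val_inj; apply: GLmx_inj; rewrite [LHS]map_mxD map_mx1.
  by rewrite (map_proj_tanN (1%:M : 'M[k^o]_3)) addr0.
move=> R n u /(congr1 (fun x => GLmx (val x))) u1.
have N0 : map_mx (@sqz_proj k n R) (GLmx (val u) - 1%:M) = 0.
  by rewrite map_mxB [X in X - _]u1 map_mx1 subrr.
have [M NM] : exists M, GLmx (val u) - 1%:M = tanN M.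
  apply: tanN_surj => //; apply/SO_tangent; first exact: sqz_proj0_mul.
  rewrite addrC subrK; exact/asboolP/(valP u).
exists M; split=> [|M' uM'].
  by rewrite pmap_SOtan; apply: val_inj; apply: GLmx_inj; rewrite -[LHS](subrK 1%:M) NM addrC.
apply: tanN_inj; rewrite -NM uM' pmap_SOtan.
by rewrite /SOtan /= GL_of_detE addrC addKr.
Qed.

Lemma adrho_SO (R : comAlgType k) (h : SO Q R) :
  adrho SO_isframe h = (GLinvmx (val h))^T.
Proof.
apply: (isframe_inj SO_isframe); rewrite -adrhoP /conj_frame !pmap_SOtan.
apply: val_inj; apply: GLmx_inj.
have /asboolP[hQ h1] := valP h.
pose i := @sqz_inc k 3 R.
rewrite [LHS](_ : _ = map_mx i (GLmx (val h)) *m (1%:M + tanN 1%:M)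
   *m map_mx i (GLinvmx (val h))) //.
rewrite mulmxDr mulmxDl mulmx1 -map_mxM GLmulV map_mx1; congr (_ + _).
rewrite SO_adjoint; last 3 first.
- by rewrite -{1}(qmap_algin i) -qmap_qcomp hQ qmap_algin.
- by rewrite det_map_mx h1 rmorph1.
- by rewrite -map_mxM GLmulV map_mx1.
congr (crossmx _ *m _); rewrite map_trmx; set A := _^T.
apply/matrixP=> p q; rewrite !mxE.
rewrite (eq_bigr (fun j => ((0 : R), A p j *: row j (1%:M : 'M[R]_3)) : sqz 3 R)); last first.
  move=> j _; rewrite !mxE; congr (_, _); first by rewrite /= mulr0.
  by rewrite /= scale0r addr0.
apply/eqP; rewrite -pair_eqE /= ; apply/andP; split; apply/eqP.
  by rewrite (raddf_sum (@sqz_proj k 3 R)) /= big1.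
have sndE (F : 'I_3 -> sqz 3 R) : (\sum_j F j).2 = \sum_j (F j).2.
  by rewrite !sum3.
rewrite sndE /=; apply/matrixP=> a b; rewrite ord1 summxE !mxE (bigD1 b) //=.
rewrite !mxE eqxx mulr1 big1 ?addr0 // => j /negPf jb.
by rewrite !mxE jb mulr0.
Qed.

End SOFrame.

(** * Base change along a field extension *)

Section Functionals.
Variables (k K : fieldType) (iota : {rmorphism k -> K}).

Record functional := Functional {
  fnal :> K -> k;
  fnalP : forall a x y, fnal (iota a * x + y) = a * fnal x + fnal y
}.

Lemma fnal_ext (f g : functional) : f =1 g -> f = g.
Proof.
case: f g => [f fP] [g gP] /= /funext fg; subst g.
by rewrite (Prop_irrelevance fP gP).
Qed.

Lemma fnal0 (l : functional) : l 0 = 0.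
Proof.
have := fnalP l 1 0 0; rewrite mulr0 addr0 mul1r => e.
by apply: (addrI (l 0)); rewrite addr0 -e.
Qed.

Lemma fnalD (l : functional) : {morph l : x y / x + y}.
Proof. by move=> x y; have := fnalP l 1 x y; rewrite rmorph1 !mul1r. Qed.

Lemma fnalZ (l : functional) a x : l (iota a * x) = a * l x.
Proof. by have := fnalP l a x 0; rewrite fnal0 !addr0. Qed.

Fact fnal_mul_subproof (l : functional) (c : K) a x y :
  l (c * (iota a * x + y)) = a * l (c * x) + l (c * y).
Proof. by rewrite mulrDr mulrCA fnalP. Qed.

Definition fnal_mul (l : functional) (c : K) : functional :=
  Functional (fnal_mul_subproof l c).

(** Zorn yields a k-subspace [A] of K maximal among those avoiding 1. It is a complement of the line
    k 1, and [l] is the projection along it. *)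
Lemma retraction_exists : exists l : functional, l 1 = 1.
Proof.
pose closed (X : set K) := forall a x y, X x -> X y -> X (iota a * x + y).
pose P (X : set K) := closed X /\ ~ X 1.
have [|A [[Ac A1] Amax]] := @Zorn_bigcup K P.
  move=> F FP Ft; split=> [a x y [X FX Xx] [Y FY Yy]|[X FX X1]]; last first.
    by have [_] := FP X FX; apply.
  have [XY|YX] := Ft _ _ FX FY.
    by exists Y => //; apply: (FP Y FY).1 => //; apply: XY.
  by exists X => //; apply: (FP X FX).1 => //; apply: YX.
(* The empty set also satisfies [P], so that 0 lies in [A] has to be extracted from maximality. *)
have A0 : A 0.
  apply: contrapT => nA0.
  have AE x : ~ A x.
    by move=> Ax; apply: nA0; have := Ac (-1) x x Ax Ax; rewrite rmorphN1 mulN1r addNr.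
  apply: (Amax [set 0]%classic); last first.
    by split=> [a x y /= -> ->|/= /eqP]; rewrite ?oner_eq0 ?mulr0 ?addr0.
  by split=> [x /AE//|/(_ 0 erefl)].
have AZ a x : A x -> A (iota a * x) by move=> Ax; rewrite -[_ * _]addr0; apply: Ac.
have AD x y : A x -> A y -> A (x + y).
  by move=> Ax Ay; rewrite -[x]mul1r -(rmorph1 iota); apply: Ac.
(* For z outside [A], maximality gives 1 = a + c z with a in [A] and c nonzero, so z - 1/c = - a/c
   lies in [A]. *)
have ex z : exists c, A (z - iota c).
  have [Az|nAz] := pselect (A z); first by exists 0; rewrite rmorph0 subr0.
  pose B : set K := [set x | exists a c, A a /\ x = a + iota c * z]%classic.
  have AB : (A `<` B)%classic.
    split=> [x Ax|BA]; first by exists x, 0; rewrite rmorph0 mul0r addr0.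
    by apply: nAz; apply: BA; exists 0, 1; rewrite rmorph1 mul1r add0r.
  have [a [c [Aa aE]]] : B 1.
    apply: contrapT => nB1; apply: (Amax B AB); split=> //.
    move=> a x y [u [c [Au ->]]] [v [d [Av ->]]].
    exists (iota a * u + v), (a * c + d); split; first exact: Ac.
    by rewrite rmorphD rmorphM; ring.
  have c0 : c != 0.
    by apply/eqP=> c0; apply: A1; rewrite aE c0 rmorph0 mul0r addr0.
  exists c^-1; have -> : z - iota c^-1 = iota (- c^-1) * a.
    apply: (mulfI (_ : iota c != 0)); first by rewrite fmorph_eq0.
    rewrite mulrBr -rmorphM mulfV // rmorph1 mulrA -rmorphM mulrN mulfV //.
    by rewrite rmorphN1 mulN1r {1}aE; ring.
  exact: AZ.
have inj c c' z : A (z - iota c) -> A (z - iota c') -> c = c'.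
  move=> Ac1 Ac2; apply/eqP; rewrite -subr_eq0; apply/negPn/negP => d0; apply: A1.
  have := Ac (-1) _ _ Ac1 Ac2; rewrite rmorphN1 mulN1r opprB.
  rewrite addrA subrK -rmorphB => /(AZ (c - c')^-1).
  by rewrite -rmorphM mulVf // rmorph1.
have [l lP] := choice ex.
have lL a x y : l (iota a * x + y) = a * l x + l y.
  apply: (inj _ _ (iota a * x + y)); first exact: lP.
  have -> : iota a * x + y - iota (a * l x + l y) =
      iota a * (x - iota (l x)) + (y - iota (l y)).
    by rewrite rmorphD rmorphM; ring.
  exact: Ac.
exists (Functional lL) => /=; apply: (inj _ _ 1); first exact: lP.
by rewrite rmorph1 subrr.
Qed.

End Functionals.

(** * The tensor product with K *)

Section Tensor.
Variables (k K : fieldType) (iota : {rmorphism k -> K}).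
Local Notation functional := (functional iota).

Section TensorAlg.
Variable R : comAlgType k.

Definition tval (s : seq (R * K)) (l : functional) : R :=
  \sum_(p <- s) l p.2 *: p.1.

Definition tens_pred : {pred functional -> R} :=
  fun F => `[< exists s, F = tval s >].

(* R (x) K, an element sum_i r_i (x) b_i being represented by the function
   l |-> sum_i l(b_i) r_i on the k-linear forms l on K. *)
Record tens := Tens { tfun : functional -> R; _ : tfun \in tens_pred }.

HB.instance Definition _ := [isSub for tfun].
HB.instance Definition _ := [Choice of tens by <:].

Lemma tval_cat s t l : tval (s ++ t) l = tval s l + tval t l.
Proof. exact: big_cat. Qed.

Fact tens_zmod_closed : zmod_closed tens_pred.
Proof.
split=> [|F G /asboolP[s ->] /asboolP[t ->]]; apply/asboolP.
  by exists [::]; apply/funext=> l; rewrite /tval big_nil.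
exists (s ++ [seq (- p.1, p.2) | p <- t]); apply/funext=> l.
rewrite tval_cat; congr (_ + _); rewrite /tval big_map -[LHS]sumrN.
by apply: eq_bigr => p _; rewrite scalerN.
Qed.
HB.instance Definition _ := GRing.isZmodClosed.Build (functional -> R) tens_pred tens_zmod_closed.
HB.instance Definition _ := [SubChoice_isSubZmodule of tens by <:].

Fact tens_of_subproof s : tval s \in tens_pred.
Proof. by apply/asboolP; exists s. Qed.
Definition tens_of s : tens := Tens (tens_of_subproof s).

Lemma tensP (x : tens) : exists s, x = tens_of s.
Proof. by case: x => F FP; have /asboolP[s sF] := FP; exists s; apply: val_inj. Qed.

Lemma tens_eqP s t : tens_of s = tens_of t <-> tval s =1 tval t.
Proof.
split=> [/(congr1 tfun)/= -> //|st]; apply: val_inj; exact/funext.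
Qed.

Lemma tens_ofD s t : tens_of s + tens_of t = tens_of (s ++ t).
Proof. by apply: val_inj; apply/funext=> l; rewrite /= tval_cat. Qed.

Definition lmul (s t : seq (R * K)) : seq (R * K) :=
  [seq (p.1 * q.1, p.2 * q.2) | p <- s, q <- t].

Lemma tval_lmul s t l :
  tval (lmul s t) l = \sum_(p <- s) \sum_(q <- t) l (p.2 * q.2) *: (p.1 * q.1).
Proof. by rewrite /tval big_allpairs_dep. Qed.

(** Only the values of [t] on shifted functionals enter, so the product depends on its right factor
    as a function and not on the list; by commutativity the same holds on the left. *)
Lemma tval_lmulr s t l :
  tval (lmul s t) l = \sum_(p <- s) p.1 * tval t (fnal_mul l p.2).
Proof.
rewrite tval_lmul; apply: eq_bigr => p _; rewrite /tval mulr_sumr.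
by apply: eq_bigr => q _; rewrite scalerAr.
Qed.

Lemma tval_lmulC s t l : tval (lmul s t) l = tval (lmul t s) l.
Proof.
rewrite !tval_lmul exchange_big; apply: eq_bigr => q _; apply: eq_bigr => p _.
by rewrite [p.1 * _]mulrC [p.2 * _]mulrC.
Qed.

Lemma tval_lmulA s t u l : tval (lmul s (lmul t u)) l = tval (lmul (lmul s t) u) l.
Proof.
rewrite !tval_lmul big_allpairs_dep; apply: eq_bigr => p _.
rewrite big_allpairs_dep; apply: eq_bigr => q _; apply: eq_bigr => v _.
by rewrite /= !mulrA.
Qed.

Lemma tval_lmul_congr s s' t t' : tval s =1 tval s' -> tval t =1 tval t' ->
  tval (lmul s t) =1 tval (lmul s' t').
Proof.
move=> ss tt l; transitivity (tval (lmul s t') l).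
  by rewrite !tval_lmulr; apply: eq_bigr => p _; rewrite tt.
by rewrite tval_lmulC [RHS]tval_lmulC !tval_lmulr; apply: eq_bigr => p _; rewrite ss.
Qed.

Definition tlist (x : tens) : seq (R * K) := projT1 (cid (tensP x)).
Lemma tlistK x : tens_of (tlist x) = x.
Proof. by rewrite /tlist; case: cid => s /= ->. Qed.

Definition tmul (x y : tens) : tens := tens_of (lmul (tlist x) (tlist y)).
Definition tone : tens := tens_of [:: (1, 1)].

Lemma tmulE s t : tmul (tens_of s) (tens_of t) = tens_of (lmul s t).
Proof. by apply/tens_eqP; apply: tval_lmul_congr; apply/tens_eqP; rewrite tlistK. Qed.

Fact tmulA : associative tmul.
Proof.
move=> x y z; have [s ->] := tensP x; have [t ->] := tensP y.
have [u ->] := tensP z; rewrite !tmulE; apply/tens_eqP=> l; exact: tval_lmulA.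
Qed.
Fact tmulC : commutative tmul.
Proof.
move=> x y; have [s ->] := tensP x; have [t ->] := tensP y.
by rewrite !tmulE; apply/tens_eqP=> l; exact: tval_lmulC.
Qed.
Fact tmul1 : left_id tone tmul.
Proof.
move=> x; have [s ->] := tensP x; rewrite tmulE; apply/tens_eqP=> l.
by rewrite tval_lmul big_seq1; apply: eq_bigr => p _; rewrite !mul1r.
Qed.
Fact tmulDl : left_distributive tmul +%R.
Proof.
move=> x y z; have [s ->] := tensP x; have [t ->] := tensP y.
have [u ->] := tensP z; rewrite tens_ofD !tmulE tens_ofD; apply/tens_eqP=> l.
by rewrite tval_cat !tval_lmul big_cat.
Qed.
Fact tone_neq0 : tone != 0.
Proof.
have [l l1] := retraction_exists iota.
apply/eqP=> /(congr1 (fun x => tfun x l)); rewrite /= /tval big_seq1 /= l1 scale1r.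
by move/eqP; rewrite oner_eq0.
Qed.

HB.instance Definition _ := GRing.Zmodule_isComNzRing.Build tens
  tmulA tmulC tmul1 tmulDl tone_neq0.

(** K acts on the second tensor factor, which amounts to precomposing the functional with
    multiplication by [c]. *)
Fact tscale_subproof (c : K) (x : tens) :
  (fun l => tfun x (fnal_mul l c)) \in tens_pred.
Proof.
have [s ->] := tensP x; apply/asboolP; exists [seq (p.1, c * p.2) | p <- s].
by apply/funext=> l; rewrite /= /tval big_map.
Qed.
Definition tscale (c : K) (x : tens) : tens := Tens (tscale_subproof c x).

Lemma tscaleE c s : tscale c (tens_of s) = tens_of [seq (p.1, c * p.2) | p <- s].
Proof. by apply: val_inj; apply/funext=> l; rewrite /= /tval big_map. Qed.

Fact tscaleA a b x : tscale a (tscale b x) = tscale (a * b) x.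
Proof.
apply: val_inj; apply/funext=> l /=; congr (tfun x _); apply: fnal_ext => z /=.
by rewrite mulrA.
Qed.
Fact tscale1 : left_id 1 tscale.
Proof.
move=> x; apply: val_inj; apply/funext=> l /=; congr (tfun x _).
by apply: fnal_ext => z /=; rewrite mul1r.
Qed.
Fact tscaleDr : right_distributive tscale +%R.
Proof. by move=> a x y; apply: val_inj; apply/funext. Qed.
Fact tscaleDl x : {morph tscale^~ x : a b / a + b}.
Proof.
move=> a b; have [s ->] := tensP x; rewrite !tscaleE tens_ofD; apply/tens_eqP=> l.
rewrite tval_cat /tval !big_map -big_split /=; apply: eq_bigr => p _.
by rewrite mulrDl fnalD scalerDl.
Qed.
HB.instance Definition _ := GRing.Zmodule_isLmodule.Build K tens
  tscaleA tscale1 tscaleDr tscaleDl.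

Fact tscaleAl (a : K) (x y : tens) : a *: (x * y) = a *: x * y.
Proof.
have [s ->] := tensP x; have [t ->] := tensP y.
rewrite [LHS](congr1 (tscale a) (tmulE s t)) tscaleE.
rewrite [RHS](congr1 (fun z => tmul z _) (tscaleE a s)) tmulE.
apply/tens_eqP=> l; rewrite tval_lmul /tval !big_map.
rewrite big_allpairs_dep /=; apply: eq_bigr => p _; apply: eq_bigr => q _ /=.
by rewrite mulrA.
Qed.
HB.instance Definition _ := GRing.Lmodule_isLalgebra.Build K tens tscaleAl.
Fact tscaleAr (a : K) (x y : tens) : a *: (x * y) = x * (a *: y).
Proof. by rewrite mulrC tscaleAl mulrC. Qed.
HB.instance Definition _ := GRing.Lalgebra_isAlgebra.Build K tens tscaleAr.

Definition tin (r : R) : resalg iota tens := tens_of [:: (r, 1)].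

Lemma tinE r l : tfun (tin r) l = l 1 *: r.
Proof. by rewrite /= /tval big_seq1. Qed.

Fact tin_zmod : zmod_morphism tin.
Proof.
move=> x y; apply: val_inj; apply/funext=> l.
by rewrite [LHS]tinE [RHS](congr2 (fun a b => a - b) (tinE x l) (tinE y l)) scalerBr.
Qed.
Fact tin_mon : monoid_morphism tin.
Proof.
split=> // x y; rewrite [RHS](tmulE [:: (x, 1)] [:: (y, 1)]); apply/tens_eqP=> l.
by rewrite tval_lmul /tval !big_seq1 /= mulr1.
Qed.
Fact tin_scal : scalable tin.
Proof.
move=> c x; apply: val_inj; apply/funext=> l; rewrite [LHS]tinE.
rewrite [RHS](_ : _ = tfun (tin x) (fnal_mul l (iota c))) //.
by rewrite tinE /= fnalZ scalerA mulrC.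
Qed.
HB.instance Definition _ := GRing.isZmodMorphism.Build R (resalg iota tens) tin tin_zmod.
HB.instance Definition _ := GRing.isMonoidMorphism.Build R (resalg iota tens) tin tin_mon.
HB.instance Definition _ := GRing.isScalable.Build k R (resalg iota tens) *:%R tin tin_scal.

End TensorAlg.

Section TensorMap.
Variables (R S : comAlgType k) (f : {lrmorphism R -> S}).

Fact tmap_subproof (x : tens R) : (fun l => f (tfun x l)) \in @tens_pred S.
Proof.
have [s ->] := tensP x; apply/asboolP; exists [seq (f p.1, p.2) | p <- s].
apply/funext=> l; rewrite /= /tval big_map raddf_sum.
by apply: eq_bigr => p _; rewrite /= linearZ.
Qed.
Definition tmap (x : tens R) : tens S := Tens (tmap_subproof x).

Lemma tmapE s : tmap (tens_of s) = tens_of [seq (f p.1, p.2) | p <- s].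
Proof.
apply: val_inj; apply/funext=> l; rewrite /= /tval big_map raddf_sum.
by apply: eq_bigr => p _; rewrite /= linearZ.
Qed.

Fact tmap_zmod : zmod_morphism tmap.
Proof. by move=> x y; apply: val_inj; apply/funext=> l; exact: (rmorphB f). Qed.
Fact tmap_mon : monoid_morphism tmap.
Proof.
split=> [|x y]; first by rewrite [LHS](tmapE [:: (1, 1)]) /= rmorph1.
have [s ->] := tensP x; have [t ->] := tensP y.
rewrite [LHS](congr1 tmap (tmulE s t)) !tmapE [RHS]tmulE; apply/tens_eqP=> l.
rewrite tval_lmul /tval !big_map big_allpairs_dep; apply: eq_bigr => p _.
by rewrite big_map; apply: eq_bigr => q _; rewrite /= rmorphM.
Qed.
Fact tmap_scal : scalable tmap.
Proof. by move=> c x; apply: val_inj; apply/funext. Qed.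
HB.instance Definition _ := GRing.isZmodMorphism.Build (tens R) (tens S) tmap tmap_zmod.
HB.instance Definition _ := GRing.isMonoidMorphism.Build (tens R) (tens S) tmap tmap_mon.
HB.instance Definition _ := GRing.isScalable.Build K (tens R) (tens S) *:%R tmap tmap_scal.

Lemma tmap_tin r : tmap (tin r) = tin (f r).
Proof. exact: (tmapE [:: (r, 1)]). Qed.

End TensorMap.

Lemma tfun_scale_tin (R : comAlgType k) (c : K) (r : R) l :
  tfun (c *: (tin r : tens R)) l = l c *: r.
Proof. by rewrite [LHS](tinE r (fnal_mul l c)) /= mulr1. Qed.

Lemma tin_inj (R : comAlgType k) : injective (@tin R).
Proof.
move=> x y /(congr1 (fun z : tens R => tfun z)).
have [l l1] := retraction_exists iota.
by move=> /(congr1 (fun F => F l)); rewrite !tinE l1 !scale1r.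
Qed.

(* The equaliser of the two maps R (x) K -> R (x) K (x) K is R. *)
Lemma tens_descent (R : comAlgType k) (z : tens R) :
  tin (R := resalg iota (tens R)) z = tmap (@tin R) z -> exists r, z = tin r.
Proof.
have [l l1] := retraction_exists iota.
(* Contracting the outer copy of K with [l] turns the left side into z and the right side into
   [tin (tfun z l)]. *)
move=> /(congr1 (fun F : tens (resalg iota (tens R)) => tfun F l)).
by rewrite tinE l1 scale1r => zE; exists (tfun z l).
Qed.

End Tensor.

Lemma pmap_square (k : fieldType) (H : kgroup k) (R S S' T : comAlgType k)
    (f : {lrmorphism R -> S}) (g : {lrmorphism S -> T})
    (f' : {lrmorphism R -> S'}) (g' : {lrmorphism S' -> T}) (x : H R) :
  (forall a, g (f a) = g' (f' a)) -> pmap g (pmap f x) = pmap g' (pmap f' x).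
Proof. by move=> e; rewrite -!pmap_comp; apply: pmap_ext. Qed.

Lemma lrmorphism_lift (k : fieldType) (A R S : comAlgType k)
    (j : {lrmorphism R -> S}) (a : {lrmorphism A -> S}) :
  injective j -> (forall x, exists r, a x = j r) ->
  exists b : {lrmorphism A -> R}, forall x, a x = j (b x).
Proof.
move=> jI /choice[b bE].
have bB : zmod_morphism b by move=> x y; apply: jI; rewrite [RHS]rmorphB /= -!bE rmorphB.
have bM : monoid_morphism b.
  by split=> [|x y]; apply: jI; rewrite ?[RHS]rmorphM /= -!bE ?(rmorphM, rmorph1).
have bZ : scalable b.
  by move=> c x; apply: jI; rewrite -bE linearZ [RHS]linearZ /= -bE.
pose B : {lrmorphism A -> R} := HB.pack b (GRing.isZmodMorphism.Build A R b bB)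
  (GRing.isMonoidMorphism.Build A R b bM) (GRing.isScalable.Build k A R *:%R b bZ).
by exists B.
Qed.

(** Greedy choice: while fewer than three rows are chosen, a nonzero column of their cokernel
    annihilates them all, and by hypothesis some [D a] is not annihilated by it. *)
Lemma row_free_family (K : fieldType) (A : Type) (D : A -> 'rV[K]_3) :
  (forall c : 'cV[K]_3, (forall a, D a *m c = 0) -> c = 0) ->
  exists b : 'I_3 -> A, (\matrix_i D (b i)) \in unitmx.
Proof.
move=> Dc.
suff /(_ 3%N (leqnn _))[b bf] : forall m, (m <= 3)%N ->
    exists b : 'I_m -> A, row_free (\matrix_i D (b i)).
  by exists b; rewrite -row_free_unit.
elim=> [_|m IH m3].
  exists (fun i : 'I_0 => match notF (ltn_ord i) with end).
  by apply: inj_row_free => v _; rewrite thinmx0.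
have [b bf] := IH (ltnW m3); set M := \matrix_i D (b i) in bf.
have [j cj] : exists j, col j (cokermx M) != 0.
  apply/existsP; rewrite -[[exists _, _]]negbK negb_exists; apply/negP=> /forallP c0.
  have /eqP : cokermx M = 0.
    apply/matrixP=> p q; have /negPn/eqP/matrixP/(_ p 0) := c0 q.
    by rewrite !mxE.
  rewrite -mxrank_eq0 mxrank_coker; move: bf => /eqP ->.
  by rewrite subn_eq0 leqNgt m3.
have Mc : M *m col j (cokermx M) = 0.
  by rewrite colE mulmxA mulmx_coker mul0mx.
have [a Da] : exists a, D a *m col j (cokermx M) != 0.
  apply: contrapT => /forallNP na; move/eqP: cj; apply; apply: Dc => a.
  by have /negP/negPn/eqP := na a.
rewrite -addn1; exists (fun i : 'I_(m + 1) => match fintype.split i with inl i => b i | inr _ => a end).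
have -> : (\matrix_(i < m + 1) D match fintype.split i with inl i => b i | inr _ => a end)
    = col_mx M (D a).
  apply/matrixP=> p q; rewrite !mxE; case: fintype.split => r; rewrite ?mxE //.
  by rewrite (ord1 r).
apply: inj_row_free => v; rewrite -[v]hsubmxK mul_row_col.
set x := lsubmx v; set y := rsubmx v => xy0.
have y0 : y = 0.
  have := congr1 (fun X => X *m col j (cokermx M)) xy0.
  rewrite mulmxDl -mulmxA Mc mulmx0 add0r mul0mx -mulmxA.
  rewrite [D a *m _]mx11_scalar mul_mx_scalar => /eqP; rewrite scaler_eq0.
  case/orP=> [/eqP z|/eqP //]; move/eqP: Da; case.
  by rewrite [D a *m _]mx11_scalar z raddf0.
move: xy0; rewrite y0 mul0mx addr0 => /eqP.
rewrite mulmx_free_eq0 // => /eqP ->; exact: row_mx0.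
Qed.

Lemma isframe_tan (k : fieldType) (H : kgroup k) (s : H (sqz 3 (k^o)))
    (T S : 'M[k^o]_3) : isframe s -> T *m S = 1%:M -> isframe (pmap (tanmap T) s).
Proof.
move=> sF TS; split=> [|R n u u1]; first exact: (isframe_ker sF).
have [M [uM Mu]] := sF.2 R n u u1.
have TSR : map_mx (algin R) T *m map_mx (algin R) S = 1%:M.
  by rewrite -map_mxM TS map_mx1.
have tanE (N : 'M[R]_(3, n)) :
    pmap (tanmap N) (pmap (tanmap T) s) = pmap (tanmap (map_mx (algin R) T *m N)) s.
  apply: pmap_compE => -[c v]; congr (_, _); first by congr algin; exact: mulr1.
  rewrite /= map_mxM -mulmxA; congr (_ *m _).
  by apply/matrixP=> i j; rewrite !mxE; congr algin; exact: mulr1.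
exists (map_mx (algin R) S *m M); split=> [|N].
  by rewrite tanE mulmxA TSR mul1mx.
rewrite tanE => /Mu ->; rewrite mulmxA.
by rewrite (mulmx1C TSR) mul1mx.
Qed.

Section SqzRes.
Variables (k K : fieldType) (iota : {rmorphism k -> K}) (n : nat).
Variables (R : comAlgType k) (S : comAlgType K) (f : {lrmorphism R -> resalg iota S}).

Definition sqzres (x : sqz n R) : resalg iota (sqz n S) :=
  ((f x.1 : S), map_mx (f : R -> S) x.2).
Fact sqzres_zmod : zmod_morphism sqzres.
Proof. by move=> x y; congr (_, _); [exact: (rmorphB f) | exact: (map_mxB f)]. Qed.
Fact sqzres_mon : monoid_morphism sqzres.
Proof.
split; first by congr (_, _); [exact: (rmorph1 f) | exact: (map_mx0 f)].
move=> x y; congr (_, _); first exact: (rmorphM f).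
apply/matrixP=> i j; rewrite !mxE [LHS](rmorphD f).
by congr (_ + _); exact: (rmorphM f).
Qed.
Fact sqzres_scal : scalable sqzres.
Proof.
move=> c x; congr (_, _); first exact: (linearZ_LR f).
apply/matrixP=> i j; rewrite !mxE.
apply: (etrans (rmorphM f _ _)).
by congr (_ * _); exact: (rmorph_alg f).
Qed.
HB.instance Definition _ := GRing.isZmodMorphism.Build (sqz n R) (resalg iota (sqz n S)) sqzres sqzres_zmod.
HB.instance Definition _ := GRing.isMonoidMorphism.Build (sqz n R) (resalg iota (sqz n S)) sqzres sqzres_mon.
HB.instance Definition _ := GRing.isScalable.Build k (sqz n R) (resalg iota (sqz n S)) *:%R sqzres sqzres_scal.

End SqzRes.

Section ResMaps.
Variables (k K : fieldType) (iota : {rmorphism k -> K}).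

Definition iotares (c : k^o) : resalg iota (K^o) := iota c.
Fact iotares_zmod : zmod_morphism iotares. Proof. exact: (rmorphB iota). Qed.
Fact iotares_mon : monoid_morphism iotares.
Proof. by split; [exact: (rmorph1 iota) | exact: (rmorphM iota)]. Qed.
Fact iotares_scal : scalable iotares.
Proof. by move=> c x; exact: (rmorphM iota). Qed.
HB.instance Definition _ := GRing.isZmodMorphism.Build (k^o) (resalg iota (K^o)) iotares iotares_zmod.
HB.instance Definition _ := GRing.isMonoidMorphism.Build (k^o) (resalg iota (K^o)) iotares iotares_mon.
HB.instance Definition _ := GRing.isScalable.Build k (k^o) (resalg iota (K^o)) *:%R iotares iotares_scal.

Definition frame_ext (H : kgroup k) (t : H (sqz 3 (k^o))) :
    base_change iota H (sqz 3 (K^o)) :=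
  pmap (sqzres (n := 3) (iotares : {lrmorphism _ -> _}) : {lrmorphism _ -> _}) t.

(** This links the adjoint representation over k with the one over K, which the splitting makes
    explicit. *)
Lemma adrho_ext (H : kgroup k) (t : H (sqz 3 (k^o))) (tP : isframe t)
    (tK : isframe (frame_ext t)) (R : comAlgType K) (x : H (resalg iota R)) :
  adrho tK (x : base_change iota H R) = adrho tP x.
Proof.
pose g := sqzres (n := 3) (idfun : {lrmorphism resalg iota R -> resalg iota R}).
have := congr1 (pmap (g : {lrmorphism _ -> _})) (adrhoP tP x).
move=> e; apply: (isframe_inj tK); rewrite -adrhoP /conj_frame.
have tanE (M : 'M[R]_3) : pmap (tanmap M) (frame_ext t) =
    pmap (g : {lrmorphism _ -> _}) (pmap (tanmap (M : 'M[resalg iota R]_3)) t).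
  rewrite /frame_ext [LHS]/=; apply: (@pmap_square k H _ _ _ (resalg iota (sqz 3 R))) => -[c v].
  by congr (_, _); apply/matrixP=> i j; rewrite !mxE;
    apply: eq_bigr => l _; rewrite !mxE.
rewrite !tanE -e /conj_frame [RHS]/= !pmapM pmapV.
suff -> : pmap (g : {lrmorphism _ -> _})
    (pmap (sqz_inc 3 (R := resalg iota R) : {lrmorphism _ -> _}) x) =
  pmap (sqz_inc 3 (R := R) : {lrmorphism _ -> _}) (x : base_change iota H R) by [].
apply: pmap_compE => a; congr (_, _).
by apply/matrixP=> i j; rewrite !mxE.
Qed.

End ResMaps.

(** * Descent *)

Section Represented.
Variables (k : fieldType) (H : kgroup k) (A : comAlgType k).
Variable theta : forall R : comAlgType k, {lrmorphism A -> R} -> H R.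
Hypothesis thetab : forall R, bijective (theta (R := R)).
Hypothesis thetaN : forall (R S : comAlgType k) (f : {lrmorphism R -> S})
  (a : {lrmorphism A -> R}),
  theta (f \o a : {lrmorphism A -> S}) = pmap f (theta a).

Lemma theta_surj (R : comAlgType k) (x : H R) : exists a, x = theta a.
Proof. by have [g _ gK] := thetab R; exists (g x). Qed.

Lemma theta_pmap (R S S' T : comAlgType k) (f : {lrmorphism S -> T})
    (f' : {lrmorphism S' -> T}) (a : {lrmorphism A -> S}) (a' : {lrmorphism A -> S'}) :
  pmap f (theta a) = pmap f' (theta a') <-> forall z, f (a z) = f' (a' z).
Proof.
rewrite -!thetaN; split=> [/(bij_inj (thetab T)) e z|e].
  exact: (congr1 (fun h : {lrmorphism A -> T} => h z) e).
by congr theta; apply: lrmorphism_ext.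
Qed.

Lemma theta_eq (R : comAlgType k) (a b : {lrmorphism A -> R}) : a =1 b -> theta a = theta b.
Proof. by move=> /lrmorphism_ext ->. Qed.

Lemma rep_pmap_inj (R S : comAlgType k) (f : {lrmorphism R -> S}) :
  injective f -> injective (pmap f : H R -> H S).
Proof.
move=> fI x y; have [a ->] := theta_surj x; have [b ->] := theta_surj y.
move=> /(theta_pmap R) ab; apply: theta_eq => z; exact: fI.
Qed.

Variables (K : fieldType) (iota : {rmorphism k -> K}).

Lemma rep_descent (R : comAlgType k) (z : H (resalg iota (tens iota R))) :
  pmap (@tin k K iota (resalg iota (tens iota R)) : {lrmorphism _ -> _}) z
  = pmap (resalg_mor iota (tmap (@tin k K iota R)) : {lrmorphism _ -> _}) z ->
  exists x : H R, z = pmap (@tin k K iota R : {lrmorphism _ -> _}) x.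
Proof.
have [a ->] := theta_surj z; move=> /(theta_pmap R) az.
have [b bE] : exists b : {lrmorphism A -> R}, forall x, a x = tin iota (b x).
  by apply: lrmorphism_lift => [|x]; [exact: tin_inj | exact: tens_descent (az x)].
by exists (theta b); rewrite -thetaN; apply: theta_eq.
Qed.

(** [e] is the counit, and the neutral element over R is the counit followed by k -> R. *)
Lemma kernel_fst (e : {lrmorphism A -> k^o}) : theta e = 1%g ->
  forall (R : comAlgType k) (f : {lrmorphism A -> R}),
  theta f = 1%g <-> forall a, f a = (e a : k)%:A.
Proof.
move=> e1 R f.
have eR : theta (algin R \o e : {lrmorphism A -> R}) = 1%g by rewrite thetaN e1 pmap1.
rewrite -eR; split=> [/(bij_inj (thetab R)) -> //|fe]; exact: theta_eq.
Qed.

(** A frame over K is read as a derivation d of A into K^3 over the counit, normalised so that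
    d(b_i) is the i-th basis vector. So normalised, d takes its values in k^3, which makes the frame
    defined over k. *)
Lemma frame_descent_aux (sg : {lrmorphism A -> resalg iota (sqz 3 (K^o))})
    (b : 'I_3 -> A) :
  isframe (theta sg : base_change iota H (sqz 3 (K^o))) ->
  (forall i, (sg (b i)).2 = delta_mx 0 i) ->
  exists2 t : H (sqz 3 (k^o)), isframe t & isframe (frame_ext iota t).
Proof.
move=> sF sb; have [l l1] := retraction_exists iota.
have [e /esym e1] := theta_surj (1%g : H (k^o)); have eP := kernel_fst e1.
pose d a : 'rV[K]_3 := (sg a).2.
have sg1 a : (sg a).1 = iota (e a).
  have := sF.1; rewrite [X in X = _](_ : _ =
    theta (resalg_mor iota (@sqz_proj K 3 (K^o)) \o sg : {lrmorphism A -> resalg iota (K^o)})).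
    by move/eP=> sgE; apply: (etrans (sgE a)); exact: mulr1.
  by rewrite thetaN.
have dB x y : d (x - y) = d x - d y by rewrite /d (rmorphB sg).
have d1 : d 1 = 0 by rewrite /d (rmorph1 sg).
have dM x y : d (x * y) = iota (e x) *: d y + iota (e y) *: d x.
  by rewrite /d (rmorphM sg) -!sg1.
have dZ c x : d (c *: x) = iota c *: d x.
  rewrite /d (linearZ_LR sg) [LHS]/=; congr (_ *: _); exact: mulr1.
(* Composing d entrywise with the retraction [l] gives a derivation into k^3, that is, a tangent
   point over k. *)
pose tt a : sqz 3 (k^o) := (e a, map_mx l (d a)).
have lB (u v : 'rV[K]_3) : map_mx l (u - v) = map_mx l u - map_mx l v.
  apply/matrixP=> i j; rewrite !mxE -[- v i j]mulN1r -(rmorphN1 iota) fnalD fnalZ.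
  by rewrite mulN1r.
have lZ c (u : 'rV[K]_3) : map_mx l (iota c *: u) = c *: map_mx l u.
  by apply/matrixP=> i j; rewrite !mxE fnalZ.
have lD (u v : 'rV[K]_3) : map_mx l (u + v) = map_mx l u + map_mx l v.
  by apply/matrixP=> i j; rewrite !mxE fnalD.
have ttB : zmod_morphism tt.
  by move=> x y; congr (_, _); rewrite ?dB ?lB //; exact: (rmorphB e).
have ttM : monoid_morphism tt.
  split; first congr (_, _); first exact: (rmorph1 e).
    by rewrite d1; apply/matrixP=> i j; rewrite !mxE fnal0.
  by move=> x y; congr (_, _); rewrite ?dM ?lD ?lZ //; exact: (rmorphM e).
have ttZ : scalable tt.
  move=> c x; congr (_, _); first exact: (linearZ_LR e).
  by rewrite dZ lZ /=; congr (_ *: _); exact/esym/mulr1.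
pose tL : {lrmorphism A -> sqz 3 (k^o)} := HB.pack tt
  (GRing.isZmodMorphism.Build A (sqz 3 (k^o)) tt ttB)
  (GRing.isMonoidMorphism.Build A (sqz 3 (k^o)) tt ttM)
  (GRing.isScalable.Build k A (sqz 3 (k^o)) *:%R tt ttZ).
have tkE a : sqzres (n := 3) (iotares iota : {lrmorphism _ -> _}) (tL a) =
    (iota (e a), map_mx iota (map_mx l (d a))) by [].
have extE : frame_ext iota (theta tL) =
    theta (sqzres (n := 3) (iotares iota : {lrmorphism _ -> _}) \o tL
      : {lrmorphism A -> resalg iota (sqz 3 (K^o))}).
  by rewrite thetaN.
(* Seen over K, the new derivation is d times some matrix M by the frame property. Both have the
   same values at the b_i, because [l] fixes 0 and 1, so M = 1. *)
have dl a : map_mx iota (map_mx l (d a)) = d a.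
  have [|M [+ _]] := sF.2 (K^o) 3%N (frame_ext iota (theta tL)).
    rewrite extE [LHS]/= -thetaN; apply/eP => x /=.
    by rewrite /iotares; exact/esym/mulr1.
  rewrite extE [RHS]/= -thetaN => /(bij_inj (thetab _)) E.
  have {}E x : map_mx iota (map_mx l (d x)) = d x *m M.
    have := congr1 (fun h : {lrmorphism A -> resalg iota (sqz 3 (K^o))} => (h x).2) E.
    move=> /= ->; congr (_ *m _); apply/matrixP=> i j; rewrite !mxE; exact: mulr1.
  rewrite E; suff -> : M = 1%:M by rewrite mulmx1.
  apply/row_matrixP=> i; rewrite !rowE mulmx1 -(sb i) -/(d (b i)) -E /d sb.
  by apply/matrixP=> p q; rewrite !mxE; case: andP => _;
     rewrite ?fnal0 ?l1 ?rmorph0 ?rmorph1.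
have extS : frame_ext iota (theta tL) = theta sg.
  rewrite extE; apply: theta_eq => a; rewrite [RHS]surjective_pairing sg1.
  by rewrite [LHS]tkE dl.
exists (theta tL); last by rewrite extS.
have tb i : (tL (b i)).2 = delta_mx 0 i.
  rewrite /= /tt /= /d sb; apply/matrixP=> p q; rewrite !mxE.
  by case: andP => _; rewrite ?fnal0 ?l1.
split; first by rewrite -thetaN; apply/eP => a; exact/esym/mulr1.
move=> R n u; have [up ->] := theta_surj u.
rewrite -thetaN => /eP up1.
(* The coordinates of a tangent point over R can only be its values at the b_i. *)
pose M0 : 'M[R]_(3, n) := \matrix_i (up (b i)).2.
have M0E (N : 'M[R]_(3, n)) :
    theta up = pmap (tanmap N) (theta tL) -> M0 = N.
  rewrite -thetaN => /(bij_inj (thetab _)) E; apply/row_matrixP=> i.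
  rewrite rowK E [LHS](_ : _ = map_mx (algin R) (tL (b i)).2 *m N) //.
  by rewrite tb map_delta_mx -rowE.
exists M0; split=> //.
(* That these coordinates do work is checked over R (x) K, where the frame over K is available and
   into which R embeds. *)
pose S := tens iota R; pose j : {lrmorphism R -> resalg iota S} := @tin k K iota R.
pose upS : {lrmorphism A -> resalg iota (sqz n S)} := sqzres (n := n) j \o up.
have [|M [+ _]] := sF.2 S n (theta upS).
  rewrite [LHS]/= -thetaN; apply/eP => a /=.
  by rewrite [X in tin _ X]up1; exact: (rmorph_alg j).
rewrite [RHS]/= -thetaN => /(bij_inj (thetab _)) E.
have {}E x : map_mx (@tin k K iota R : R -> S) (up x).2 = map_mx (algin S) (d x) *m M.
  exact: (congr1 (fun h : {lrmorphism A -> resalg iota (sqz n S)} => (h x).2) E).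
have ME : M = map_mx (@tin k K iota R : R -> S) M0.
  apply/row_matrixP=> i; rewrite -map_row rowK E /d sb.
  by rewrite map_delta_mx -rowE.
rewrite -thetaN; apply: theta_eq => a; rewrite [LHS]surjective_pairing.
congr (_, _); first by rewrite [LHS]up1.
apply/matrixP=> p q; apply: (@tin_inj k K iota R).
have := congr1 (fun X : 'rV[S]_n => X p q) (E a); rewrite mxE => ->.
rewrite ME !mxE [RHS](rmorph_sum j); apply: eq_bigr => i _; rewrite !mxE.
rewrite [RHS](rmorphM j); congr (_ * _); apply/esym.
rewrite [LHS](rmorph_alg j); rewrite -{2}dl !mxE.
by [].
Qed.

(** A vector killed by all differentials would give the trivial tangent point a second set of
    coordinates. Hence the differentials span K^3, and inverting a matrix of three of them achieves
    the normalisation of [frame_descent_aux]. *)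
Lemma frame_descent (s : base_change iota H (sqz 3 (K^o))) : isframe s ->
  exists2 t : H (sqz 3 (k^o)), isframe t & isframe (frame_ext iota t).
Proof.
move=> sF; have [sg sgE] := theta_surj (s : H (resalg iota (sqz 3 (K^o)))).
have tanE n (N : 'M[K]_(3, n)) : pmap (tanmap (N : 'M[K^o]_(3, n))) s =
    theta (resalg_mor iota (tanmap (N : 'M[K^o]_(3, n))) \o sg
      : {lrmorphism A -> resalg iota (sqz n (K^o))}).
  by rewrite thetaN -sgE.
have sndE n (N : 'M[K]_(3, n)) a :
    (resalg_mor iota (tanmap (N : 'M[K^o]_(3, n))) (sg a)).2 = (sg a).2 *m N.
  by congr (_ *m _); apply/matrixP=> i j; rewrite !mxE; exact: mulr1.
have [b bU] : exists b : 'I_3 -> A, (\matrix_i (sg (b i)).2 : 'M[K]_3) \in unitmx.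
  apply: (@row_free_family K A (fun a => (sg a).2)) => c c0; apply: (isframe_inj sF (R := K^o)).
  rewrite !tanE; apply: theta_eq => a; congr (_, _).
  exact: (etrans (sndE _ _ _) (etrans (c0 a) (esym (etrans (sndE _ _ _) (mulmx0 _ _))))).
set N := \matrix_i _ in bU.
apply: (@frame_descent_aux (resalg_mor iota (tanmap (invmx N : 'M[K^o]_3)) \o sg
    : {lrmorphism A -> resalg iota (sqz 3 (K^o))}) b).
  rewrite -tanE; apply: (isframe_tan sF) => //; exact: mulVmx.
move=> i; rewrite [LHS]sndE -[(sg (b i)).2](rowK (fun i => (sg (b i)).2)) -/N.
by rewrite rowE -mulmxA mulmxV // mulmx1.
Qed.

End Represented.

(** * The split form and its invariant forms *)

Definition qsplit (R : comNzRingType) : tqform R := TQForm 0 0 1 1 0 0.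

Lemma qmap_qsplit (R S : comNzRingType) (f : {rmorphism R -> S}) :
  qmap f (qsplit R) = qsplit S.
Proof. by rewrite /qmap /= rmorph0 rmorph1. Qed.

Lemma Phi4_qsplit (R : comNzRingType) : Phi4 (qsplit R) = 1.
Proof. by rewrite /Phi4 /=; ring. Qed.

(** Conjugation by 1 + t E_01, and for [unip_lower] by 1 - t E_10, on trace-zero matrices in the
    coordinates of [slmx]. *)
Definition unip_upper (R : comNzRingType) (t : R) : 'M[R]_3 :=
  mx3 1 (- 2%:R * t) (- t ^+ 2) 0 1 t 0 0 1.
Definition unip_lower (R : comNzRingType) (t : R) : 'M[R]_3 :=
  mx3 1 0 0 t 1 0 (- t ^+ 2) (- 2%:R * t) 1.

Lemma unip_upper_SO (R : comNzRingType) (t : R) :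
  qcomp (qsplit R) (unip_upper t) = qsplit R /\ \det (unip_upper t) = 1.
Proof.
rewrite /qcomp /qval /qpol /tqeval /= det3 !mxE /=.
by split; [congr TQForm; ring | ring].
Qed.

Lemma unip_lower_SO (R : comNzRingType) (t : R) :
  qcomp (qsplit R) (unip_lower t) = qsplit R /\ \det (unip_lower t) = 1.
Proof.
rewrite /qcomp /qval /qpol /tqeval /= det3 !mxE /=.
by split; [congr TQForm; ring | ring].
Qed.

Lemma SO_of_mx (k : fieldType) (Q : tqform k) (R : comAlgType k) (h : 'M[R]_3) :
  qcomp (qmap (in_alg R) Q) h = qmap (in_alg R) Q -> \det h = 1 ->
  exists g : SO Q R, GLmx (val g) = h.
Proof.
move=> hQ h1; have hd : \det h * 1 = 1 by rewrite mulr1.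
have hS : (GL_of_det hd : GLk k 3 R) \in @SO_pred k Q R by exact/asboolP.
by exists (SubGrp (@SO_group_closed k Q R) hS).
Qed.

(** Invariance is used at t = X over K[X] and coefficients of powers of X are compared, so that a
    small finite field K causes no trouble. *)
Lemma invariant_form (K : fieldType) (P : tqform K) :
  (forall (R : comAlgType K) (h : SO (qsplit K) R),
    qcomp (qmap (in_alg R) P) (GLmx (val h)) = qmap (in_alg R) P) ->
  P = qscale (qc P) (qsplit K).
Proof.
move=> inv.
have invm h : qcomp (qsplit {poly K}) h = qsplit {poly K} -> \det h = 1 ->
    qcomp (qmap (in_alg {poly K}) P) h = qmap (in_alg {poly K}) P.
  move=> hQ h1; have [|g <-] := @SO_of_mx K (qsplit K) {poly K} h _ h1.
    by rewrite qmap_qsplit.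
  exact: inv.
have algE (x : K) : in_alg {poly K} x = x%:P by rewrite /= alg_polyC.
have [u1 u2] := unip_upper_SO ('X : {poly K}); have eu := invm _ u1 u2.
have [l1 l2] := unip_lower_SO ('X : {poly K}); have el := invm _ l1 l2.
move: eu el {u1 u2 l1 l2 invm inv}; case: P => a b c d e f.
rewrite /qmap !algE /qcomp /qval /qpol /tqeval /= !mxE /=.
move=> [_ _ eu3 _ _ eu6] [el1 _ _ _ _ _].
have e6 : a%:P * 'X^4 - b%:P * 'X^3 + (d - c)%:P * 'X^2 + e%:P * 'X = 0.
  apply: (addIr f%:P); rewrite add0r -[RHS]eu6 polyCB; ring.
have e3 : b%:P * 'X - (a *+ 2)%:P * 'X^2 = 0.
  apply: (addIr c%:P); rewrite add0r -[RHS]eu3 polyCMn; ring.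
have e1 : f%:P * 'X^4 - e%:P * 'X^3 + (d - c)%:P * 'X^2 + b%:P * 'X = 0.
  apply: (addIr a%:P); rewrite add0r -[RHS]el1 polyCB; ring.
have cf p : p = 0 :> {poly K} -> forall n, p`_n = 0 by move=> -> n; rewrite coef0.
have := (cf _ e6 4%N, cf _ e6 2%N, cf _ e6 1%N, cf _ e3 1%N, cf _ e1 4%N).
rewrite !(coefD, coefN, coefCM, coefXn, coefX) /=.
rewrite !(mulr0, mulr1, addr0, add0r, subr0, oppr0).
move=> [[[[-> dc] ->] ->] ->].
have -> : d = c by apply/eqP; rewrite -subr_eq0 dc.
by rewrite /qscale /= !(mulr0, mulr1).
Qed.

Lemma qval_qmap (R S : comNzRingType) (K : Type) (f : K -> S) (g : {rmorphism R -> S})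
    (a b c d e h : K) (u : 'cV[R]_3) :
  qval (TQForm (f a) (f b) (f c) (f d) (f e) (f h)) (map_mx g u) =
    f a * g (u 0 0 ^+ 2) + f b * g (u 0 0 * u 1 0) + f c * g (u 0 0 * u 2%:R 0)
    + f d * g (u 1 0 ^+ 2) + f e * g (u 1 0 * u 2%:R 0) + f h * g (u 2%:R 0 ^+ 2).
Proof. by rewrite /qval /tqeval /= !mxE; ring. Qed.

Lemma qpol_qmap (R S : comNzRingType) (K : Type) (f : K -> S) (g : {rmorphism R -> S})
    (a b c d e h : K) (u v : 'cV[R]_3) :
  qpol (TQForm (f a) (f b) (f c) (f d) (f e) (f h)) (map_mx g u) (map_mx g v) =
    f a * g ((u 0 0 * v 0 0) *+ 2) + f b * g (u 0 0 * v 1 0 + u 1 0 * v 0 0)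
    + f c * g (u 0 0 * v 2%:R 0 + u 2%:R 0 * v 0 0) + f d * g ((u 1 0 * v 1 0) *+ 2)
    + f e * g (u 1 0 * v 2%:R 0 + u 2%:R 0 * v 1 0)
    + f h * g ((u 2%:R 0 * v 2%:R 0) *+ 2).
Proof. by rewrite /qpol /= !mxE; ring. Qed.

(** * Descent of an invariant form *)

Section TensorForms.
Variables (k K : fieldType) (iota : {rmorphism k -> K}) (l : functional iota).
Variable R : comAlgType k.

Let L (z : tens iota R) : R := tfun z l.
Let LD x y : L (x + y) = L x + L y. Proof. by []. Qed.
Let LZ (c : K) (r : R) : L (in_alg (tens iota R) c * (@tin k K iota R r : tens iota R)) = l c *: r.
Proof. by rewrite mulr_algl; exact: tfun_scale_tin. Qed.

(** For [h] with entries in R, invariance is linear in the coefficients of [P] with coefficients in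
    R, so it survives the R-linear map R (x) K -> R given by [l]. *)
Lemma qcomp_tens (P : tqform K) (h : 'M[R]_3) :
  qcomp (qmap (in_alg (tens iota R)) P) (map_mx (@tin k K iota R : R -> tens iota R) h)
    = qmap (in_alg (tens iota R)) P ->
  qcomp (qmap (in_alg R) (qmap l P)) h = qmap (in_alg R) (qmap l P).
Proof.
pose g : {rmorphism R -> tens iota R} := @tin k K iota R.
have L1 (c : K) : L (in_alg (tens iota R) c) = (l c)%:A.
  by rewrite -[in LHS](mulr1 (in_alg _ c)) -(rmorph1 g) LZ.
have LA x y z t u v : L (x + y + z + t + u + v) = L x + L y + L z + L t + L u + L v.
  by rewrite !LD.
have hom (c : K) (r : R) : L (in_alg (tens iota R) c * g r) = in_alg R (l c) * r.
  by rewrite LZ mulr_algl.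
case: P => p1 p2 p3 p4 p5 p6; rewrite /qmap /=.
pose f := in_alg (tens iota R).
have colE i : col i (map_mx g h) = map_mx g (col i h) by rewrite map_col.
move=> hP.
pose Q := TQForm (f p1) (f p2) (f p3) (f p4) (f p5) (f p6).
pose q := TQForm (in_alg R (l p1)) (in_alg R (l p2)) (in_alg R (l p3))
  (in_alg R (l p4)) (in_alg R (l p5)) (in_alg R (l p6)).
have Lval u : L (qval Q (map_mx g u)) = qval q u.
  rewrite (qval_qmap f) LA !hom -[in RHS](map_mx_id (f := idfun) _ u) //.
  by rewrite (qval_qmap (fun c => in_alg R (l c)) (idfun : {rmorphism R -> R})).
have Lpol u v : L (qpol Q (map_mx g u) (map_mx g v)) = qpol q u v.
  rewrite (qpol_qmap f) LA !hom -[in RHS](map_mx_id (f := idfun) _ u) //.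
  rewrite -[in RHS](map_mx_id (f := idfun) _ v) //.
  by rewrite (qpol_qmap (fun c => in_alg R (l c)) (idfun : {rmorphism R -> R})).
have Lproj (p : tqform (tens iota R) -> tens iota R) c :
    p (qcomp Q (map_mx g h)) = p Q -> p Q = f c ->
    L (p (qcomp Q (map_mx g h))) = in_alg R (l c).
  by move=> -> ->; exact: L1.
congr TQForm; rewrite -?Lval -?Lpol -!colE.
- by apply: (Lproj (@qa _)) => //; rewrite [qcomp _ _]hP.
- by apply: (Lproj (@qb _)) => //; rewrite [qcomp _ _]hP.
- by apply: (Lproj (@qc _)) => //; rewrite [qcomp _ _]hP.
- by apply: (Lproj (@qd _)) => //; rewrite [qcomp _ _]hP.
- by apply: (Lproj (@qe _)) => //; rewrite [qcomp _ _]hP.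
- by apply: (Lproj (@qf _)) => //; rewrite [qcomp _ _]hP.
Qed.

End TensorForms.

(** [l] may kill every coefficient of [P], but not all K-multiples of a nonzero coefficient x, since
    l(x^-1 x) = 1; hence the factor [c]. *)
Lemma qmap_functional_neq0 (k K : fieldType) (iota : {rmorphism k -> K})
    (l : functional iota) (P : tqform K) : l 1 = 1 -> Phi4 P != 0 ->
  exists c, qmap l (qscale c P) <> TQForm 0 0 0 0 0 0.
Proof.
move=> l1 P0; apply: contrapT => /forallNP h; move/eqP: P0; apply.
have z x : (forall c, l (c * x) = 0) -> x = 0.
  move=> lx; apply: contrapT => /eqP x0; have := lx x^-1.
  by rewrite mulVf // l1 => /eqP; rewrite oner_eq0.
have {h}h c : qmap l (qscale c P) = TQForm 0 0 0 0 0 0 by have /contrapT := h c.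
case: P h => a b c d e f h.
have [-> -> -> ->] : [/\ a = 0, b = 0, c = 0 & d = 0].
  by split; apply: z => x; have [] := h x.
have [-> ->] : e = 0 /\ f = 0 by split; apply: z => x; have [] := h x.
by rewrite /Phi4 /=; ring.
Qed.

Lemma qmap_eq0 (k K : fieldType) (iota : {rmorphism k -> K}) (q : tqform k) P :
  qmap iota q = qscale 0 P -> q = TQForm 0 0 0 0 0 0.
Proof.
case: q => a b c d e f; rewrite /qmap /qscale !mul0r /= => -[].
do 6![move=> /eqP; rewrite fmorph_eq0 => /eqP ->].
by [].
Qed.

Section FormSO.
Variables (k K : fieldType) (iota : {rmorphism k -> K}) (H : kgroup k).
Hypothesis Haff : affine_algebraic H.
Hypothesis Hiso : kiso (SO (qsplit K)) (base_change iota H).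

Lemma form_SO : exists2 q : tqform k, Phi4 q != 0 & kiso H (SO q).
Proof.
have [psi [psib psiM psiN]] := Hiso.
have [A _ [theta [thetab thetaN]]] := Haff.
have q00 : Phi4 (qsplit K) != 0 by rewrite Phi4_qsplit oner_eq0.
pose s0 := SO_isframe q00.
have sF := isframe_kiso psib psiM psiN s0.
have [t tP tK] := frame_descent thetab thetaN sF.
have [T TU TE] := isframe_change sF tK.
pose TR (R : comAlgType K) : 'M[R]_3 := map_mx (in_alg R) T.
pose TV (R : comAlgType K) : 'M[R]_3 := map_mx (in_alg R) (invmx T).
have TTV R : TR R *m TV R = 1%:M by rewrite -map_mxM mulmxV // map_mx1.
have TVT R : TV R *m TR R = 1%:M by rewrite -map_mxM mulVmx // map_mx1.
have rhoV (R : comAlgType k) (x : H R) : adrho tP x *m adrho tP x^-1%g = 1%:M.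
  by rewrite -adrhoM mulgV adrho1.
have sgP (R : comAlgType k) (x : H R) :
    (adrho tP x^-1%g)^T *m (adrho tP x)^T == 1%:M.
  by rewrite -trmx_mul rhoV trmx1.
(* The contragredient of the adjoint representation. For SO(q) the adjoint representation is dual to
   the standard one, so [sg] should be the embedding into GL_3. *)
pose sg (R : comAlgType k) (x : H R) : GLk k 3 R := @MkGL 3 R (_, _) (sgP R x).
have sgE (R : comAlgType k) (x : H R) : GLmx (sg R x) = (adrho tP x^-1%g)^T by [].
have sgM (R : comAlgType k) : {morph sg R : x y / (x * y)%g}.
  move=> x y; apply: GLmx_inj; rewrite GLmxM !sgE invMg adrhoM; exact: trmx_mul.
have sgN (R S : comAlgType k) (f : {lrmorphism R -> S}) (x : H R) :
    sg S (pmap f x) = pmap f (sg R x).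
  apply: GLmx_inj; rewrite [RHS](_ : _ = map_mx f (GLmx (sg R x))) // !sgE.
  by rewrite -pmapV adrho_map map_trmx.
have sgK (R : comAlgType K) (h : SO (qsplit K) R) :
    (GLmx (sg (resalg iota R) (psi R h)) : 'M[R]_3)
    = (TV R)^T *m GLmx (val h) *m (TR R)^T.
  have := adrho_kiso psiM psiN (SO_isframe q00) tK TE (h^-1)%g.
  have psiV : psi R h^-1%g = (psi R h)^-1%g := group_morV (psiM R) h.
  rewrite adrho_SO psiV (adrho_ext tP tK) -/(TR R) => E.
  rewrite sgE; apply: trmx_inj; rewrite [LHS]trmxK -mulmxA 2!trmx_mul !trmxK.
  by rewrite [GLinvmx _]/= in E; rewrite E -mulmxA TTV mulmx1.
have psiS (R : comAlgType K) (x : H (resalg iota R)) : exists h, x = psi R h.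
  by have [g _ gK] := psib R; exists (g x).
pose P := qcomp (qsplit K) T^T.
have P0 : Phi4 P != 0.
  by rewrite Phi4_qcomp Phi4_qsplit mulr1 expf_neq0 // det_tr -unitfE -unitmxE.
have PR (R : comAlgType K) : qmap (in_alg R) P = qcomp (qsplit R) (TR R)^T.
  by rewrite qmap_qcomp qmap_qsplit map_trmx.
(* All multiples of [P] are treated, because the one to be descended is selected only afterwards. *)
have Pinv (R : comAlgType K) (x : H (resalg iota R)) c :
    qcomp (qmap (in_alg R) (qscale c P)) (GLmx (sg (resalg iota R) x) : 'M[R]_3)
    = qmap (in_alg R) (qscale c P).
  have [h ->] := psiS R x; rewrite sgK qmap_qscale PR qcomp_scale; congr qscale.
  have /asboolP[hQ _] := valP h; rewrite qmap_qsplit in hQ.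
  rewrite qcompM !mulmxA -trmx_mul TVT trmx1 mul1mx.
  by rewrite -[in LHS]qcompM hQ.
have detK (R : comAlgType K) (x : H (resalg iota R)) :
    \det (GLmx (sg (resalg iota R) x) : 'M[R]_3) = 1.
  have [h ->] := psiS R x; have /asboolP[_ h1] := valP h.
  by rewrite sgK !det_mulmx h1 mulr1 -det_mulmx -trmx_mul TTV trmx1 det1.
have [l l1] := retraction_exists iota.
have [c qn0] := qmap_functional_neq0 l1 P0.
set q := qmap l _ in qn0.
have sgtin (R : comAlgType k) (x : H R) :
    map_mx (@tin k K iota R : R -> tens iota R) (GLmx (sg R x)) =
    GLmx (sg (resalg iota (tens iota R)) (pmap (@tin k K iota R : {lrmorphism _ -> _}) x)).
  by rewrite sgN.
have sgq (R : comAlgType k) (x : H R) : sg R x \in @SO_pred k q R.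
  apply/asboolP; split.
    by apply: (qcomp_tens (iota := iota)); rewrite sgtin; exact: Pinv.
  apply: (@tin_inj k K iota R); rewrite [RHS](rmorph1 (@tin k K iota R)).
  by rewrite -[LHS](det_map_mx (@tin k K iota R)) sgtin; exact: detK.
pose qK := qmap iota q.
(* So far [q] is only nonzero and invariant. Uniqueness of the invariant form over K makes it a
   nonzero multiple of [P], hence nondegenerate. *)
have qKinv : qcomp qK (invmx T)^T = qscale (qc (qcomp qK (invmx T)^T)) (qsplit K).
  apply: invariant_form => R h.
  have /asboolP[hq _] := sgq (resalg iota R) (psi R h); rewrite sgK in hq.
  have hqK : qcomp (qmap (in_alg R) qK) ((TV R)^T *m GLmx (val h) *m (TR R)^T)
    = qmap (in_alg R) qK := hq.
  have TVE : map_mx (in_alg R) (invmx T)^T = (TV R)^T by rewrite map_trmx.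
  rewrite qmap_qcomp TVE qcompM -[in RHS]hqK qcompM -!mulmxA.
  by rewrite -trmx_mul TVT trmx1 mulmx1.
set c' := qc _ in qKinv.
have qKE : qK = qscale c' P.
  rewrite -[LHS]qcomp1 -trmx1 -(mulmxV TU) trmx_mul -qcompM qKinv.
  by rewrite qcomp_scale.
have c'0 : c' != 0.
  by apply/eqP=> c'0; apply: qn0; apply: (qmap_eq0 (P := P)); rewrite -c'0 -qKE.
exists q.
  by rewrite -(fmorph_eq0 iota) -Phi4_map -/qK qKE Phi4_qscale mulf_neq0 // expf_neq0.
have sgKinj (R : comAlgType K) (x y : H (resalg iota R)) :
    sg (resalg iota R) x = sg (resalg iota R) y -> x = y.
  have [h ->] := psiS R x; have [h' ->] := psiS R y => E.
  have {}E : (TV R)^T *m GLmx (val h) *m (TR R)^T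
      = (TV R)^T *m GLmx (val h') *m (TR R)^T by rewrite -!sgK E.
  congr psi; apply: val_inj; apply: GLmx_inj.
  have := congr1 (fun X => (TR R)^T *m X *m (TV R)^T) E.
  rewrite !mulmxA -!trmx_mul TVT trmx1 !mul1mx -!mulmxA -!trmx_mul TVT trmx1.
  by rewrite !mulmx1.
have sgKsurj (R : comAlgType K) (g : GLk k 3 (resalg iota R)) :
    g \in @SO_pred k q (resalg iota R) -> exists x, sg (resalg iota R) x = g.
  move=> /asboolP[gq g1].
  have gqK : qcomp (qmap (in_alg R) qK) (GLmx g : 'M[R]_3) = qmap (in_alg R) qK := gq.
  have [||h hE] := @SO_of_mx K (qsplit K) R ((TR R)^T *m (GLmx g : 'M[R]_3) *m (TV R)^T).
  - have e1 : qmap (in_alg R) (qsplit K) =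
        qscale (in_alg R c'^-1) (qcomp (qmap (in_alg R) qK) (TV R)^T).
      rewrite qKE qmap_qscale qcomp_scale qscaleA -rmorphM mulVf // rmorph1 qscale1.
      by rewrite PR qcompM -trmx_mul TVT trmx1 qcomp1 qmap_qsplit.
    rewrite e1 qcomp_scale qcompM !mulmxA -trmx_mul TTV trmx1 mul1mx.
    by rewrite -[in LHS]qcompM gqK.
  - rewrite !det_mulmx mulrAC -det_mulmx -trmx_mul TVT trmx1 det1 mul1r.
    exact: g1.
  exists (psi R h); apply: GLmx_inj; rewrite [LHS]sgK hE !mulmxA.
  by rewrite -trmx_mul TTV trmx1 mul1mx -mulmxA -trmx_mul TTV trmx1 mulmx1.
pose tinL (R : comAlgType k) : {lrmorphism R -> resalg iota (tens iota R)} := @tin k K iota R.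
have sginj (R : comAlgType k) (x y : H R) : sg R x = sg R y -> x = y.
  move=> /(congr1 (pmap (tinL R))); rewrite -!sgN => /sgKinj.
  by apply: (rep_pmap_inj thetab thetaN); exact: tin_inj.
exists (fun R x => SubGrp (@SO_group_closed k q R) (sgq R x)).
split=> [R|R x y|R S f x]; last 2 first.
- by apply: val_inj; rewrite /= sgM.
- by apply: val_inj; rewrite /= sgN.
apply: inj_surj_bijective => [x y /(congr1 val)/= /sginj //|g].
(* Surjectivity is available over R (x) K. Injectivity over R (x) K (x) K makes the two images of
   the preimage [z] agree, so [z] comes from R. *)
have gP : pmap (tinL R) (val g) \in @SO_pred k q (resalg iota (tens iota R)).
  exact: (@SO_pmap k q R _ (tinL R) (val g) (valP g)).
have [z zE] := sgKsurj (tens iota R) _ gP.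
have [x xz] : exists x : H R, z = pmap (tinL R) x.
  apply: (rep_descent thetab thetaN); apply: sgKinj.
  rewrite !sgN zE; apply: pmap_square => a.
  by rewrite [RHS](tmap_tin iota (tinL R)).
exists x; apply: val_inj => /=; apply: GLmx_inj.
apply/matrixP=> i j; apply: (@tin_inj k K iota R).
have := congr1 (fun u : GLk k 3 (resalg iota (tens iota R)) => GLmx u i j) zE.
by rewrite xz sgN /GLmx /= !mxE.
Qed.

End FormSO.

(** * PGL_2 as a special orthogonal group *)

Section Sl2.
Variable R : comNzRingType.
Implicit Types (v w : 'cV[R]_3) (h : 'M[R]_3) (a b m : 'M[R]_2).

Definition mx2 (a b c d : R) : 'M[R]_2 :=
  \matrix_(i, j) nth 0 (nth [::] [:: [:: a; b]; [:: c; d]] i) j.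

Lemma ord2P (P : 'I_2 -> Prop) : P 0 -> P 1 -> forall i, P i.
Proof.
move=> p0 p1 [[|[|//]] h].
- by rewrite [Ordinal h](_ : _ = 0) //; exact: val_inj.
- by rewrite [Ordinal h](_ : _ = 1) //; exact: val_inj.
Qed.

Lemma sum2 (V : nmodType) (F : 'I_2 -> V) : \sum_i F i = F 0 + F 1.
Proof.
rewrite !big_ord_recl big_ord0 addr0.
by congr (F _ + F _); apply: val_inj.
Qed.

(** The basis is E_01, E_00 - E_11, E_10; in these coordinates minus the determinant is u1 u3 +
    u2^2. *)
Definition slmx v : 'M[R]_2 := mx2 (v 1 0) (v 0 0) (v 2%:R 0) (- v 1 0).
Definition slvec a : 'cV[R]_3 :=
  \col_i nth 0 [:: a 0 1; a 0 0; a 1 0] (nat_of_ord i).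

Lemma slmxK a : \tr a = 0 -> slmx (slvec a) = a.
Proof.
rewrite /mxtrace sum2 => /eqP; rewrite addr_eq0 => /eqP a0.
by apply/matrixP; apply: ord2P; apply: ord2P; rewrite !mxE /= ?mxE /= ?a0 ?opprK.
Qed.

Lemma slvecK v : slvec (slmx v) = v.
Proof.
by apply/matrixP=> i j; rewrite ord1; move: i; apply: ord3P; rewrite !mxE /= ?mxE.
Qed.

Lemma tr_slmx v : \tr (slmx v) = 0.
Proof. by rewrite /mxtrace sum2 !mxE /= subrr. Qed.

Lemma slmx_is_linear : linear slmx.
Proof.
move=> c v w; apply/matrixP; apply: ord2P; apply: ord2P; rewrite !mxE /= ?mxE //.
by rewrite opprD mulrN.
Qed.
HB.instance Definition _ := GRing.isLinear.Build R _ _ *:%R slmx slmx_is_linear.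

Lemma slmx_sum v : slmx v = \sum_j v j 0 *: slmx (delta_mx j 0).
Proof.
rewrite [in LHS](matrix_sum_delta v) linear_sum; apply: eq_bigr => j _.
by rewrite big_ord1 linearZ.
Qed.

Lemma slmx_sq v : slmx v *m slmx v = (qval (qsplit R) v)%:M.
Proof.
apply/matrixP; apply: ord2P; apply: ord2P;
  by rewrite !mxE !sum2 !mxE /= /qval /tqeval /=; ring.
Qed.

Lemma slmx_anticomm v w :
  slmx v *m slmx w + slmx w *m slmx v = (qpol (qsplit R) v w)%:M.
Proof.
apply/matrixP; apply: ord2P; apply: ord2P;
  by rewrite !mxE !sum2 !mxE /= /qpol /=; ring.
Qed.

Lemma tr_slmx3 h :
  \tr (slmx (col 0 h) *m slmx (col 1 h) *m slmx (col 2%:R h)) = - \det h.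
Proof.
by rewrite /mxtrace sum2 !(mxE, sum2) /= ?mxE det3; ring.
Qed.

Lemma scalar_inj2 (c d : R) : c%:M = d%:M :> 'M[R]_2 -> c = d.
Proof. by move=> /matrixP/(_ 0 0); rewrite !mxE. Qed.

(* The middle column is the cross product of the outer ones for the form dual
   to u1 u3 + u2^2; no division by 2 occurs. *)
Lemma qsplit_col1 h : qcomp (qsplit R) h = qsplit R -> \det h = 1 ->
  [/\ h 0 1 = 2%:R * (h 1 0 * h 0 2%:R - h 0 0 * h 1 2%:R),
      h 1 1 = h 0 0 * h 2%:R 2%:R - h 0 2%:R * h 2%:R 0
    & h 2%:R 1 = 2%:R * (h 2%:R 0 * h 1 2%:R - h 1 0 * h 2%:R 2%:R)].
Proof.
rewrite /qcomp /qval /qpol /tqeval /= !mxE => -[].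
set A := (X in X = 0 -> _) => a0; set B := (X in X = 0 -> _) => b0.
set C := (X in X = 1 -> _) => c1 _; set E := (X in X = 0 -> _) => e0.
set F := (X in X = 0 -> _) => f0 h1.
set w0 := 2%:R * _; set w1 := _ - _; set w2 := 2%:R * (h 2%:R 0 * _ - _).
(* [k0], [k1] and [k2] say that the adjugate of [h] maps w to the middle basis vector; each follows
   from the relations on [h]. Multiplying by [h], of determinant 1, identifies w with the middle
   column. *)
have k0 : (h 1 1 * h 2%:R 2%:R - h 1 2%:R * h 2%:R 1) * w0
   + (h 0 2%:R * h 2%:R 1 - h 0 1 * h 2%:R 2%:R) * w1
   + (h 0 1 * h 1 2%:R - h 0 2%:R * h 1 1) * w2 = 0.
  transitivity (2%:R * B * F - C * E); last by rewrite b0 f0 e0; ring.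
  rewrite /B /C /E /F /w0 /w1 /w2; ring.
have k1 : (h 1 2%:R * h 2%:R 0 - h 1 0 * h 2%:R 2%:R) * w0
   + (h 0 0 * h 2%:R 2%:R - h 0 2%:R * h 2%:R 0) * w1
   + (h 0 2%:R * h 1 0 - h 0 0 * h 1 2%:R) * w2 = 1.
  transitivity (C * C - 4%:R * A * F); last by rewrite a0 c1; ring.
  rewrite /A /C /F /w0 /w1 /w2; ring.
have k2 : (h 1 0 * h 2%:R 1 - h 1 1 * h 2%:R 0) * w0
   + (h 0 1 * h 2%:R 0 - h 0 0 * h 2%:R 1) * w1
   + (h 0 0 * h 1 1 - h 0 1 * h 1 0) * w2 = 0.
  transitivity (2%:R * A * E - B * C); last by rewrite a0 b0; ring.
  rewrite /A /B /C /E /w0 /w1 /w2; ring.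
have fin (i : 'I_3) (w : R) : \det h * w = h i 0 * ((h 1 1 * h 2%:R 2%:R - h 1 2%:R * h 2%:R 1) * w0
   + (h 0 2%:R * h 2%:R 1 - h 0 1 * h 2%:R 2%:R) * w1
   + (h 0 1 * h 1 2%:R - h 0 2%:R * h 1 1) * w2)
   + h i 1 * ((h 1 2%:R * h 2%:R 0 - h 1 0 * h 2%:R 2%:R) * w0
   + (h 0 0 * h 2%:R 2%:R - h 0 2%:R * h 2%:R 0) * w1
   + (h 0 2%:R * h 1 0 - h 0 0 * h 1 2%:R) * w2)
   + h i 2%:R * ((h 1 0 * h 2%:R 1 - h 1 1 * h 2%:R 0) * w0
   + (h 0 1 * h 2%:R 0 - h 0 0 * h 2%:R 1) * w1
   + (h 0 0 * h 1 1 - h 0 1 * h 1 0) * w2) -> h i 1 = w.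
  by rewrite k0 k1 k2 h1 mul1r !mulr0 add0r addr0 mulr1.
by split; apply: fin; rewrite det3; ring.
Qed.

(** The bracket relation [E_01, E_10] = E_00 - E_11 is preserved. It allows [sl_ext], built from the
    outer columns only, to agree with [h] on the middle basis vector as well. *)
Lemma slmx_col1 h : qcomp (qsplit R) h = qsplit R -> \det h = 1 ->
  slmx (col 1 h) = slmx (col 0 h) *m slmx (col 2%:R h)
                   - slmx (col 2%:R h) *m slmx (col 0 h).
Proof.
move=> hQ h1; have [e0 e1 e2] := qsplit_col1 hQ h1.
apply/matrixP; apply: ord2P; apply: ord2P;
  rewrite !(mxE, sum2) /= ?mxE ?e0 ?e1 ?e2; ring.
Qed.

Section Aut.
Variable u : GL (2 * 2) R.
Hypothesis uA : u \in autM2 R.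
Let f := endM2 u.
Let f1 : f 1%:M = 1%:M. Proof. by have /autM2P[] := uA. Qed.
Let fM : {morph f : a b / a *m b}. Proof. by have /autM2P[] := uA. Qed.

(** The automorphism is intertwined with the identity by two matrices. Multiplying by an adjugate
    shows that the traces agree up to each determinant, and these determinants generate the unit
    ideal. *)
Lemma autM2_tr a : \tr (f a) = \tr a.
Proof.
have [g [h [r [s [rs gP hP]]]]] := autM2_locally_conj uA.
have trE (m : 'M[R]_2) : (forall b, f b *m m = m *m b) -> \det m * \tr (f a) = \det m * \tr a.
  move=> mP; rewrite -!mxtraceZ -!mul_mx_scalar -{1}mul_mx_adj mulmxA mP.
  by rewrite -mulmxA mxtrace_mulC -mulmxA mul_adj_mx.
rewrite -[LHS]mul1r -[RHS]mul1r -rs !mulrDl -!mulrA.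
by rewrite (trE g) ?(trE h).
Qed.

Definition adsl : 'M[R]_3 := \matrix_(i, j) slvec (f (slmx (delta_mx j 0))) i 0.

Lemma adslE v : f (slmx v) = slmx (adsl *m v).
Proof.
rewrite slmx_sum /f raddf_sum /= -/f.
have -> : adsl *m v = \sum_j v j 0 *: slvec (f (slmx (delta_mx j 0))).
  apply/matrixP=> i p; rewrite ord1 !mxE summxE; apply: eq_bigr => j _.
  by rewrite !mxE mulrC.
rewrite linear_sum; apply: eq_bigr => j _ /=.
by rewrite /f linearZ /= linearZ /= -/f slmxK // autM2_tr tr_slmx.
Qed.

Let fscal (c : R) : f c%:M = c%:M.
Proof. by rewrite -scalemx1 /f linearZ /= -/f f1. Qed.

(** The algebra structure sees both conditions: the form is the square of a trace-zero matrix, and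
    the determinant is minus the trace of a triple product. *)
Lemma adsl_SO : qcomp (qsplit R) adsl = qsplit R /\ \det adsl = 1.
Proof.
have qv v : qval (qsplit R) (adsl *m v) = qval (qsplit R) v.
  by apply: scalar_inj2; rewrite -slmx_sq -adslE -fM slmx_sq; exact: fscal.
have qp v w : qpol (qsplit R) (adsl *m v) (adsl *m w) = qpol (qsplit R) v w.
  apply: scalar_inj2; rewrite -slmx_anticomm -!adslE -!fM -raddfD /=.
  rewrite slmx_anticomm; exact: fscal.
split.
  rewrite /qcomp !colE !qv !qp /qval /qpol /tqeval /= !mxE /=.
  congr TQForm; ring.
apply: oppr_inj; rewrite -tr_slmx3 !colE -!adslE -!fM autM2_tr.
have cE i : delta_mx i 0 = col i (1%:M : 'M[R]_3) by rewrite colE mul1mx.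
by rewrite !cE tr_slmx3 det1.
Qed.

End Aut.

Section Inverse.
Variable h : 'M[R]_3.
Hypotheses (hQ : qcomp (qsplit R) h = qsplit R) (h1 : \det h = 1).
Let e := slmx (col 0 h).
Let f := slmx (col 2%:R h).

Let ee : e *m e = 0.
Proof.
rewrite slmx_sq (_ : qval _ _ = 0) ?raddf0 //.
exact: (congr1 (@qa R) hQ).
Qed.
Let ff : f *m f = 0.
Proof.
rewrite slmx_sq (_ : qval _ _ = 0) ?raddf0 //.
exact: (congr1 (@qf R) hQ).
Qed.
Let efe : e *m f + f *m e = 1%:M.
Proof.
rewrite slmx_anticomm (_ : qpol _ _ _ = 1) //.
exact: (congr1 (@qc R) hQ).
Qed.

(* By ee, ff and efe, the elements e and f generate a copy of the 2x2 matrices: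
   e and f play the roles of the elementary matrices E_01 and E_10. *)
Definition sl_ext a : 'M[R]_2 :=
  a 0 0 *: (e *m f) + a 0 1 *: e + a 1 0 *: f + a 1 1 *: (f *m e).

Lemma sl_ext_is_linear : linear sl_ext.
Proof.
move=> c a b; rewrite /sl_ext; move: (e *m f) (f *m e) => x y.
by apply/matrixP=> i j; rewrite !mxE; ring.
Qed.
HB.instance Definition _ := GRing.isLinear.Build R _ _ *:%R sl_ext sl_ext_is_linear.

Lemma sl_ext1 : sl_ext 1%:M = 1%:M.
Proof. by rewrite /sl_ext !mxE /= !scale1r !scale0r !addr0 efe. Qed.

Lemma sl_extM : {morph sl_ext : a b / a *m b}.
Proof.
have eef a : e *m (e *m a) = 0 by rewrite mulmxA ee mul0mx.
have ffe a : f *m (f *m a) = 0 by rewrite mulmxA ff mul0mx.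
have efe' : e *m (f *m e) = e.
  by rewrite -[RHS]mulmx1 -efe mulmxDr eef add0r.
have fef' : f *m (e *m f) = f.
  by rewrite -[RHS]mulmx1 -efe mulmxDr ffe addr0.
move=> a b; rewrite /sl_ext !mxE !sum2.
rewrite !mulmxDl !mulmxDr -!scalemxAl -!scalemxAr !scalerA.
have -> : e *m f *m (e *m f) = e *m f by rewrite -mulmxA fef'.
have -> : e *m f *m e = e by rewrite -mulmxA efe'.
have -> : e *m f *m f = 0 by rewrite -mulmxA ff mulmx0.
have -> : e *m f *m (f *m e) = 0 by rewrite -mulmxA ffe mulmx0.
have -> : f *m e *m (e *m f) = 0 by rewrite -mulmxA eef mulmx0.
have -> : f *m e *m e = 0 by rewrite -mulmxA ee mulmx0.
have -> : f *m e *m f = f by rewrite -mulmxA fef'.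
have -> : f *m e *m (f *m e) = f *m e by rewrite -mulmxA efe'.
rewrite !eef !ffe efe' fef' ee ff !scaler0 !(addr0, add0r).
move: (e *m f) (f *m e) => x y; apply/matrixP=> i j; rewrite !mxE; ring.
Qed.

Lemma sl_ext_slmx v : sl_ext (slmx v) = slmx (h *m v).
Proof.
rewrite [in RHS](_ : h *m v = v 0 0 *: col 0 h + v 1 0 *: col 1 h + v 2%:R 0 *: col 2%:R h).
  rewrite !linearD !linearZ /= slmx_col1 // -/e -/f /sl_ext !mxE /=.
  by rewrite scalerBr scaleNr addrAC [_ + v 0 0 *: e]addrC !addrA addrAC.
by apply/matrixP=> i j; rewrite !mxE sum3 ord1; ring.
Qed.

End Inverse.

Lemma endM2_ext (u v : GL (2 * 2) R) : endM2 u =1 endM2 v -> u = v.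
Proof.
move=> uv; apply: GLmx_inj; apply: trmx_inj; apply/row_matrixP=> i.
rewrite !rowE; have := uv (vec_mx (delta_mx 0 i)); rewrite /endM2 vec_mxK.
by move/(can_inj vec_mxK).
Qed.

(** Trace-zero matrices generate the algebra: E_00 = E_01 E_10 and E_11 = E_10 E_01. *)
Lemma autM2_ext (f g : {linear 'M[R]_2 -> 'M[R]_2}) :
  {morph f : a b / a *m b} -> {morph g : a b / a *m b} ->
  (forall v, f (slmx v) = g (slmx v)) -> f =1 g.
Proof.
move=> fM gM fg a.
have aE : a = a 0 0 *: (slmx (delta_mx 0 0) *m slmx (delta_mx 2%:R 0))
    + a 0 1 *: slmx (delta_mx 0 0) + a 1 0 *: slmx (delta_mx 2%:R 0)
    + a 1 1 *: (slmx (delta_mx 2%:R 0) *m slmx (delta_mx 0 0)).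
  by apply/matrixP; apply: ord2P; apply: ord2P; rewrite !(mxE, sum2) /= ?mxE /=; ring.
by rewrite aE !linearD !linearZ /= fM gM fM gM !fg.
Qed.

Lemma sl_ext_comp (g h : 'M[R]_3) (gQ : qcomp (qsplit R) g = qsplit R)
  (g1 : \det g = 1) (hQ : qcomp (qsplit R) h = qsplit R) (h1 : \det h = 1) :
  g *m h = 1%:M -> forall a, sl_ext g (sl_ext h a) = a.
Proof.
move=> gh a.
apply: (@autM2_ext (sl_ext g \o sl_ext h : {linear _ -> _}) idfun) => //= [b c|v].
  by rewrite /= !sl_extM.
by rewrite /= !sl_ext_slmx // mulmxA gh mul1mx.
Qed.

Lemma adsl_surj (h : GL 3 R) : qcomp (qsplit R) (GLmx h) = qsplit R ->
  \det (GLmx h) = 1 -> exists2 u, u \in autM2 R & adsl u = GLmx h.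
Proof.
move=> hQ h1.
have hiQ : qcomp (qsplit R) (GLinvmx h) = qsplit R.
  by rewrite -[in LHS]hQ qcompM GLmulV qcomp1.
have hi1 : \det (GLinvmx h) = 1.
  by rewrite -[LHS]mulr1 -h1 -det_mulmx GLmulVl det1.
pose F := sl_ext (GLmx h); pose G := sl_ext (GLinvmx h).
have FG a : F (G a) = a by apply: sl_ext_comp => //; exact: GLmulV.
have uP : (lin_mx F)^T *m (lin_mx G)^T == 1%:M.
  rewrite -trmx_mul -[1%:M]trmx1 (inj_eq trmx_inj); apply/eqP/row_matrixP=> i.
  rewrite rowE [RHS]rowE mulmx1 mulmxA -[delta_mx 0 i]vec_mxK.
  rewrite !mul_vec_lin; exact: (congr1 mxvec (FG _)).
have uE a : endM2 (MkGL (GLpair := (_, _)) uP) a = F a.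
  by rewrite /endM2 trmxK mul_vec_lin mxvecK.
exists (MkGL (GLpair := (_, _)) uP).
  apply/autM2P; split=> [|a b]; rewrite !uE; [exact: sl_ext1 | exact: sl_extM].
apply/matrixP=> i j; rewrite mxE uE /F.
by rewrite sl_ext_slmx // slvecK -colE mxE.
Qed.

End Sl2.

Lemma adsl_map (R S : comNzRingType) (f : {rmorphism R -> S}) (u : GL (2 * 2) R) :
  adsl (GLmap f u) = map_mx f (adsl u).
Proof.
have slN (v : 'cV[R]_3) : slmx (map_mx f v) = map_mx f (slmx v).
  by apply/matrixP; apply: ord2P; apply: ord2P; rewrite !mxE /= ?mxE ?rmorphN.
apply/matrixP=> i j.
have E : endM2 (GLmap f u) (slmx (delta_mx j 0)) = map_mx f (endM2 u (slmx (delta_mx j 0))).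
  by rewrite -(map_delta_mx f) slN endM2_map.
rewrite [RHS]mxE ![adsl _ _ _]mxE E [LHS]mxE [in RHS]mxE.
by move: i; apply: ord3P; rewrite /= mxE.
Qed.

Lemma kiso_PGL2_SO (k : fieldType) : kiso (PGL2 k) (SO (qsplit k)).
Proof.
have adP (R : comAlgType k) (u : PGL2 k R) : \det (adsl (val u)) * 1 = 1.
  by rewrite mulr1; case: (adsl_SO (valP u)).
have SOP (R : comAlgType k) (u : PGL2 k R) :
    (GL_of_det (adP R u) : GLk k 3 R) \in @SO_pred k (qsplit k) R.
  by apply/asboolP; rewrite qmap_qsplit; exact: adsl_SO (valP u).
exists (fun R u => SubGrp (@SO_group_closed k (qsplit k) R) (SOP R u)).
split=> [R|R u v|R S f u].
- apply: inj_surj_bijective => [u v /(congr1 (fun g => GLmx (val g)))|h].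
    rewrite !GL_of_detE => uv; apply: val_inj; apply: endM2_ext.
    have /autM2P[_ uM] := valP u; have /autM2P[_ vM] := valP v.
    apply: (@autM2_ext R (endM2 (val u)) (endM2 (val v))) => // w.
    have uE : endM2 (val u) (slmx w) = _ := adslE (valP u) w.
    have vE : endM2 (val v) (slmx w) = _ := adslE (valP v) w.
    by rewrite /= uE vE uv.
  have /asboolP[] := valP h; rewrite qmap_qsplit => hQ h1.
  have [u uA uh] := adsl_surj hQ h1.
  exists (SubGrp (autM2_group_closed R) uA).
  by apply: val_inj; apply: GLmx_inj.
- apply: val_inj; apply: GLmx_inj; rewrite [RHS]GLmxM !GL_of_detE.
  apply/matrixP=> i j; apply/(congr1 (fun X : 'M_3 => X i j)).
  have inj2 (M N : 'M[R]_3) : (forall w, slmx (M *m w) = slmx (N *m w)) -> M = N.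
    move=> MN; apply/trmx_inj/row_matrixP=> p; rewrite -!tr_col !colE.
    by congr trmx; rewrite -[LHS]slvecK MN slvecK.
  have uE (g : PGL2 k R) w : endM2 (val g) (slmx w) = slmx (adsl (val g) *m w).
    exact: adslE (valP g) w.
  by apply: inj2 => w; rewrite -mulmxA -!uE [val _]/= endM2_M.
by apply: val_inj; apply: GLmx_inj; rewrite GL_of_detE [LHS]adsl_map.
Qed.

(** * Splitting a form *)

Section Similar.
Variable k : fieldType.
Implicit Types Q : tqform k.

Lemma similar_sym Q Q' : similar Q Q' -> similar Q' Q.
Proof.
case=> c [h [c0 hU ->]]; exists c^-1, (invmx h); split.
- by rewrite invr_eq0.
- by rewrite unitmx_inv.
by rewrite qcomp_scale qscaleA mulVf // qscale1 qcompM mulmxV // qcomp1.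
Qed.

Lemma similar_trans Q1 Q2 Q3 : similar Q1 Q2 -> similar Q2 Q3 -> similar Q1 Q3.
Proof.
case=> c [h [c0 hU ->]] [d [g [d0 gU ->]]]; exists (d * c), (h *m g); split.
- by rewrite mulf_neq0.
- by rewrite unitmx_mul hU.
by rewrite qcomp_scale qscaleA qcompM.
Qed.

Lemma similar_qcomp Q h : h \in unitmx -> similar Q (qcomp Q h).
Proof. by exists 1, h; rewrite oner_eq0 qscale1. Qed.

Lemma unitmx_det (h : 'M[k]_3) d : \det h = d -> d != 0 -> h \in unitmx.
Proof. by move=> hd d0; rewrite unitmxE unitfE hd. Qed.

Lemma det_mx3 (R : comNzRingType) (a b c d e f g h i : R) :
  \det (mx3 a b c d e f g h i) =
  a * (e * i - f * h) - b * (d * i - f * g) + c * (d * h - e * g).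
Proof. by rewrite det3 !mxE. Qed.

Lemma unitmx_col0 (v : 'cV[k]_3) : v != 0 -> exists2 g, g \in unitmx & col 0 g = v.
Proof.
move=> v0.
have colE a b c d e f : col 0 (mx3 (v 0 0) a b (v 1 0) c d (v 2%:R 0) e f) = v.
  by apply/matrixP=> i j; rewrite ord1 mxE; move: i; apply: ord3P; rewrite mxE.
have [v00|v00] := eqVneq (v 0 0) 0; last first.
  exists (mx3 (v 0 0) 0 0 (v 1 0) 1 0 (v 2%:R 0) 0 1); last exact: colE.
  by apply: (unitmx_det _ v00); rewrite det_mx3; ring.
have [v10|v10] := eqVneq (v 1 0) 0; last first.
  exists (mx3 (v 0 0) 1 0 (v 1 0) 0 0 (v 2%:R 0) 0 1); last exact: colE.
  apply: (unitmx_det (d := - v 1 0)); last by rewrite oppr_eq0.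
  by rewrite det_mx3; ring.
have [v20|v20] := eqVneq (v 2%:R 0) 0; last first.
  exists (mx3 (v 0 0) 1 0 (v 1 0) 0 1 (v 2%:R 0) 0 0); last exact: colE.
  by apply: (unitmx_det _ v20); rewrite det_mx3; ring.
case/eqP: v0; apply/matrixP=> i j; rewrite ord1 mxE.
by move: i; apply: ord3P.
Qed.

Lemma similar_qsplit_c b c d e f : c != 0 -> Phi4 (TQForm 0 b c d e f) != 0 ->
  similar (qsplit k) (TQForm 0 b c d e f).
Proof.
move=> c0 q0; pose P := Phi4 (TQForm 0 b c d e f); pose d' := P / c ^+ 2.
have d'0 : d' != 0 by rewrite mulf_neq0 ?invr_eq0 ?expf_neq0.
pose e' := e / c - 2%:R * f * b / c ^+ 2; pose f' := f / c ^+ 2.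
(* With w = b u2 + c u3 the form is d' u2^2 + w (u1 + e' u2 + f' w), which is d' times the split
   form in the coordinates (u1 + e' u2 + f' w) / d', u2, w. *)
exists d', (mx3 d'^-1 ((e' + f' * b) / d') (f' * c / d') 0 1 0 0 b c); split=> //.
  apply: (unitmx_det (d := c / d')); last by rewrite mulf_neq0 ?invr_eq0.
  by rewrite det_mx3; ring.
rewrite /qscale /qcomp /qval /qpol /tqeval /= !mxE /=.
have P0 : P != 0 by [].
have PE : P = d * c ^+ 2 + f * b ^+ 2 - b * c * e by rewrite /P /Phi4; ring.
rewrite PE in P0.
by congr TQForm; rewrite /e' /f' /d' PE; field; rewrite ?c0 ?P0.
Qed.

(** A zero moved to the first basis vector removes the coefficient of u1^2. Nondegeneracy then
    forces b or c to be nonzero, and exchanging u2 and u3 swaps them. *)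
Lemma isotropic_similar (Q : tqform k) v : Phi4 Q != 0 -> v != 0 -> qval Q v = 0 ->
  similar (qsplit k) Q.
Proof.
move=> Q0 v0 Qv; have [g gU gv] := unitmx_col0 v0.
apply: similar_trans (similar_sym (similar_qcomp Q gU)).
have g0 : \det g != 0 by rewrite -unitfE -unitmxE.
have : Phi4 (qcomp Q g) != 0 by rewrite Phi4_qcomp mulf_neq0 // expf_neq0.
have : qa (qcomp Q g) = 0 by rewrite /= gv.
case: (qcomp Q g) => a b c d e f; rewrite [qa _]/= => -> q0.
have [c0|c0] := eqVneq c 0; last exact: similar_qsplit_c.
have sU : (mx3 1 0 0 0 0 1 0 1 0 : 'M[k]_3) \in unitmx.
  apply: (unitmx_det (d := -1)); last by rewrite oppr_eq0 oner_eq0.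
  by rewrite det_mx3; ring.
apply: similar_trans (similar_sym (similar_qcomp _ sU)).
have -> : qcomp (TQForm 0 b c d e f) (mx3 1 0 0 0 0 1 0 1 0) = TQForm 0 c b f e d.
  by rewrite /qcomp /qval /qpol /tqeval /= !mxE /=; congr TQForm; ring.
apply: similar_qsplit_c.
  by apply: contraNneq q0 => b0; rewrite /Phi4 b0 c0; apply/eqP; ring.
suff -> : Phi4 (TQForm 0 c b f e d) = Phi4 (TQForm 0 b c d e f) by [].
by rewrite /Phi4; ring.
Qed.

End Similar.

Lemma separable_algebraic_id (k : fieldType) :
  separable_algebraic (idfun : {rmorphism k -> k}).
Proof.
move=> z; exists ('X - z%:P); first by rewrite separable_poly.unlock derivXsubC coprimep1.
by rewrite map_poly_id // root_XsubC.
Qed.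

Lemma quadratic_split (k : fieldType) (a b c : k) : a != 0 ->
  b ^+ 2 - 4%:R * a * c != 0 ->
  exists (K : fieldType) (iota : {rmorphism k -> K}),
    separable_algebraic iota /\
    exists z, iota a * z ^+ 2 + iota b * z + iota c = 0.
Proof.
move=> a0 D0; pose p := a%:P * 'X^2 + b%:P * 'X + c%:P.
have psz : size p = 3%N.
  rewrite /p -addrA size_polyDl size_Cmul // size_polyXn //.
  apply: leq_ltn_trans (size_polyD _ _) _; rewrite gtn_max.
  rewrite (leq_ltn_trans (size_polyC_leq1 _)) // andbT.
  apply: leq_ltn_trans (size_polyMleq _ _) _; rewrite size_polyX addnS /=.
  by rewrite addn1 ltnS; exact: size_polyC_leq1.
have psep : separable_poly p.
  (* 4 a p - p'^2 is minus the discriminant, a nonzero constant. *)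
  rewrite separable_poly.unlock; apply/Bezout_coprimepP; exists ((4%:R * a)%:P, - (2%:R * a%:P * 'X + b%:P)) => /=.
  have -> : (4%:R * a)%:P * p + - (2%:R * a%:P * 'X + b%:P) * p^`()
      = (- (b ^+ 2 - 4%:R * a * c))%:P.
    rewrite /p !derivD derivM derivM !derivC derivXn derivX /=.
    by rewrite expr2 !(polyCN, polyCB, polyCM, polyC_natr); ring.
  by rewrite -size_poly_eq1 size_polyC oppr_eq0 D0.
have pE (K : fieldType) (iota : {rmorphism k -> K}) z : root (map_poly iota p) z ->
    iota a * z ^+ 2 + iota b * z + iota c = 0.
  rewrite /p !rmorphD !rmorphM /= !map_polyC !map_polyX => /rootP.
  by rewrite !hornerE.
have [[z pz]|nz] := pselect (exists z, root p z).
  exists k, (idfun : {rmorphism k -> k}); split; first exact: separable_algebraic_id.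
  by exists z; apply: pE; rewrite map_poly_id.
have [|L _ [z pz Lz]] := @irredp_FAdjoin k p.
  apply: cubic_irreducible; first by rewrite psz.
  by move=> x; apply/negP => px; apply: nz; exists x.
exists L, (in_alg L : {rmorphism k -> L}); split; last by exists z; exact: pE.
move=> y; have zsep : separable_element 1%AS z.
  apply/separable_elementP; exists (map_poly (in_alg L) p); split=> //.
    by apply/polyOver1P; exists p.
  by rewrite separable_map.
have : separable 1%AS <<1%AS; z>>%VS by rewrite -adjoin_separable_eq.
have yz : y \in <<1; z>>%VS by rewrite Lz memvf.
move/separableP/(_ y yz)/separable_elementP; case=> g [/polyOver1P[g' ->] gy gs]; exists g' => //.
by move: gs; rewrite separable_map.
Qed.

(** A zero is sought on a coordinate plane. If the discriminant on u3 = 0 vanishes, (- b, 2 a, 0) is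
    a zero, unless b = 0 and 2 = 0. In that case [Phi4] is a e^2 + d c^2, so c or e is nonzero and
    another plane gives a separable quadratic equation. *)
Lemma split_separable (k : fieldType) (Q : tqform k) : Phi4 Q != 0 ->
  exists (K : fieldType) (iota : {rmorphism k -> K}),
    separable_algebraic iota /\ similar (qsplit K) (qmap iota Q).
Proof.
move=> Q0.
suff [K [iota [sep [v [v0 Qv]]]]] : exists (K : fieldType) (iota : {rmorphism k -> K}),
    separable_algebraic iota /\ exists v, v != 0 /\ qval (qmap iota Q) v = 0.
  exists K, iota; split=> //; apply: isotropic_similar v0 Qv.
  by rewrite Phi4_map fmorph_eq0.
pose cv (K : fieldType) (x y z : K) : 'cV[K]_3 := \col_i nth 0 [:: x; y; z] (nat_of_ord i).
have cv0 (K : fieldType) (x y z : K) : [|| x != 0, y != 0 | z != 0] -> cv K x y z != 0.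
  apply: contraTneq => /matrixP E; have := (E 0 0, E 1 0, E 2%:R 0).
  by rewrite !mxE /= => -[[-> ->] ->]; rewrite !eqxx.
have done_k x y z : [|| x != 0, y != 0 | z != 0] -> qval Q (cv k x y z) = 0 ->
    exists (K : fieldType) (iota : {rmorphism k -> K}),
    separable_algebraic iota /\ exists v, v != 0 /\ qval (qmap iota Q) v = 0.
  move=> xyz Qv; exists k, (idfun : {rmorphism k -> k}).
  split; first exact: separable_algebraic_id.
  exists (cv k x y z); split; first exact: cv0.
  by rewrite -[RHS]Qv; case: (Q).
case: Q Q0 done_k => a b c d e f Q0 done_k.
have [a0|a0] := eqVneq a 0.
  apply: (done_k 1 0 0); first by rewrite oner_eq0.
  by rewrite /qval /tqeval !mxE /= a0; ring.
have [d0|d0] := eqVneq d 0.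
  apply: (done_k 0 1 0); first by rewrite oner_eq0 orbT.
  by rewrite /qval /tqeval !mxE /= d0; ring.
have [D1|D1] := eqVneq (b ^+ 2 - 4%:R * a * d) 0; last first.
  have [K [iota [sep [z zE]]]] := quadratic_split a0 D1.
  exists K, iota; split=> //; exists (cv K z 1 0); split.
    by apply: cv0; rewrite oner_eq0 orbT.
  by rewrite /qval /tqeval !mxE /= -[RHS]zE; ring.
have [/eqP b0|b0] := boolP ((b == 0) && (2%:R * a == 0)); last first.
  apply: (done_k (- b) (2%:R * a) 0).
    by rewrite oppr_eq0; move: b0; rewrite negb_and => /orP[->|->]; rewrite ?orbT.
  rewrite /qval /tqeval !mxE /=; transitivity (- a * (b ^+ 2 - 4%:R * a * d)).
    by ring.
  by rewrite D1 mulr0.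
move/eqP/andP: b0 => [/eqP b0 a20].
have two0 : 2%:R = 0 :> k by move: a20; rewrite mulf_eq0 (negPf a0) orbF => /eqP.
have four0 : 4%:R = 0 :> k by rewrite (natrM _ 2 2) two0 mul0r.
have [c0|c0] := eqVneq c 0; last first.
  have [|K [iota [sep [z zE]]]] := @quadratic_split k a c f a0.
    by rewrite four0 !mul0r subr0 expf_neq0.
  exists K, iota; split=> //; exists (cv K z 0 1); split.
    by apply: cv0; rewrite oner_eq0 !orbT.
  by rewrite /qval /tqeval !mxE /= -[RHS]zE; ring.
have e0 : e != 0.
  by apply: contraNneq Q0 => e0; rewrite /Phi4 b0 c0 e0 four0; apply/eqP; ring.
have [|K [iota [sep [z zE]]]] := @quadratic_split k d e f d0.
  by rewrite four0 !mul0r subr0 expf_neq0.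
exists K, iota; split=> //; exists (cv K 0 z 1); split.
  by apply: cv0; rewrite oner_eq0 !orbT.
by rewrite /qval /tqeval !mxE /= -[RHS]zE; ring.
Qed.

Lemma affine_algebraic_kiso (k : fieldType) (G H : kgroup k) :
  kiso G H -> affine_algebraic G -> affine_algebraic H.
Proof.
case=> psi [psib psiM psiN] [A Afg [phi [phib phiN]]]; exists A => //.
exists (fun R a => psi R (phi R a)); split=> [R|R S f a].
  exact: (bij_comp (psib R) (phib R)).
by rewrite phiN psiN.
Qed.

(** * SO(Q) is affine *)

Section CoordinateRing.
Variables (k : fieldType) (I : finType).

(** Polynomials as expression trees: the ring laws need not be built in, as they are inherited from
    the algebras in which the trees are evaluated. *)
Inductive pterm : Type :=
  PConst of k | PVar of I | PAdd of pterm & pterm | PMul of pterm & pterm.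

HB.instance Definition _ := gen_eqMixin pterm.
HB.instance Definition _ := gen_choiceMixin pterm.

Fixpoint peval (R : comAlgType k) (v : I -> R) (t : pterm) : R :=
  match t with
  | PConst c => c%:A
  | PVar i => v i
  | PAdd s t => peval v s + peval v t
  | PMul s t => peval v s * peval v t
  end.

Lemma peval_map (R S : comAlgType k) (f : {lrmorphism R -> S}) (v : I -> R) t :
  f (peval v t) = peval (f \o v) t.
Proof.
elim: t => [c|i|s IHs t IHt|s IHs t IHt] //=; first exact: rmorph_alg.
  by rewrite rmorphD /= IHs IHt.
by rewrite rmorphM /= IHs IHt.
Qed.

Variable X : forall R : comAlgType k, (I -> R) -> Prop.
Hypothesis Xmap : forall (R S : comAlgType k) (f : {lrmorphism R -> S}) (v : I -> R),
  X v -> X (f \o v).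
(** A rational point, which makes the coordinate ring nonzero. *)
Variable v0 : I -> k^o.
Hypothesis Xv0 : X v0.

Definition peq (s t : pterm) : bool :=
  `[< forall (R : comAlgType k) (v : I -> R), X v -> peval v s = peval v t >].

Fact peq_refl : reflexive peq. Proof. by move=> t; apply/asboolP. Qed.
Fact peq_sym : symmetric peq.
Proof. by move=> s t; apply/asboolP/asboolP => st R v /st ->. Qed.
Fact peq_trans : transitive peq.
Proof.
move=> s t u /asboolP st /asboolP su; apply/asboolP => R v vX.
by rewrite st // su.
Qed.
Canonical peq_equiv := EquivRel peq peq_refl peq_sym peq_trans.

(* The coordinate ring of X: polynomial expressions modulo equality at all
   points of X. *)
Definition cring : Type := {eq_quot peq}%qT.
HB.instance Definition _ := Choice.on cring.

Definition cpi (t : pterm) : cring := \pi_({eq_quot peq})%qT t.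
Definition crepr (q : cring) : pterm := generic_quotient.repr (q : {eq_quot peq}%qT).

Lemma creprK q : cpi (crepr q) = q. Proof. exact: reprK. Qed.

Definition cev (R : comAlgType k) (v : I -> R) (q : cring) : R := peval v (crepr q).

Lemma cevE (R : comAlgType k) (v : I -> R) t : X v -> cev v (cpi t) = peval v t.
Proof.
move=> vX; have : cpi (crepr (cpi t)) = cpi t by rewrite creprK.
by move=> /eqmodP/asboolP/(_ R v vX).
Qed.

Lemma cring_ext (q r : cring) :
  (forall (R : comAlgType k) (v : I -> R), X v -> cev v q = cev v r) -> q = r.
Proof.
move=> qr; rewrite -[q]creprK -[r]creprK; apply/eqmodP/asboolP => R v.
exact: qr.
Qed.

Definition cadd q r := cpi (PAdd (crepr q) (crepr r)).
Definition cmul q r := cpi (PMul (crepr q) (crepr r)).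
Definition copp q := cpi (PMul (PConst (-1)) (crepr q)).
Definition cscale c q := cpi (PMul (PConst c) (crepr q)).

Section Ev.
Variables (R : comAlgType k) (v : I -> R) (vX : X v).
Lemma cevD q r : cev v (cadd q r) = cev v q + cev v r. Proof. exact: cevE. Qed.
Lemma cevM q r : cev v (cmul q r) = cev v q * cev v r. Proof. exact: cevE. Qed.
Lemma cevZ c q : cev v (cscale c q) = c *: cev v q.
Proof. by rewrite cevE //= mulr_algl. Qed.
Lemma cevN q : cev v (copp q) = - cev v q.
Proof. by rewrite cevE //= mulr_algl scaleN1r. Qed.
Lemma cevC c : cev v (cpi (PConst c)) = c%:A. Proof. exact: cevE. Qed.
End Ev.

Definition cevs := (cevD, cevM, cevZ, cevN, cevC).

Fact caddA : associative cadd.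
Proof. by move=> x y z; apply: cring_ext => R v vX; rewrite !cevs // addrA. Qed.
Fact caddC : commutative cadd.
Proof. by move=> x y; apply: cring_ext => R v vX; rewrite !cevs // addrC. Qed.
Fact cadd0 : left_id (cpi (PConst 0)) cadd.
Proof. by move=> x; apply: cring_ext => R v vX; rewrite !cevs // scale0r add0r. Qed.
Fact caddN : left_inverse (cpi (PConst 0)) copp cadd.
Proof. by move=> x; apply: cring_ext => R v vX; rewrite !cevs // scale0r addNr. Qed.
HB.instance Definition _ := GRing.isZmodule.Build cring caddA caddC cadd0 caddN.

Fact cmulA : associative cmul.
Proof. by move=> x y z; apply: cring_ext => R v vX; rewrite !cevs // mulrA. Qed.
Fact cmulC : commutative cmul.
Proof. by move=> x y; apply: cring_ext => R v vX; rewrite !cevs // mulrC. Qed.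
Fact cmul1 : left_id (cpi (PConst 1)) cmul.
Proof. by move=> x; apply: cring_ext => R v vX; rewrite !cevs // scale1r mul1r. Qed.
Fact cmulDl : left_distributive cmul cadd.
Proof. by move=> x y z; apply: cring_ext => R v vX; rewrite !cevs // mulrDl. Qed.
Fact cone_neq0 : cpi (PConst 1) != cpi (PConst 0).
Proof.
apply/eqP=> /(congr1 (cev v0)); rewrite !cevs // scale1r scale0r => /eqP.
by rewrite oner_eq0.
Qed.
HB.instance Definition _ := GRing.Zmodule_isComNzRing.Build cring
  cmulA cmulC cmul1 cmulDl cone_neq0.

Fact cscaleA a b x : cscale a (cscale b x) = cscale (a * b) x.
Proof. by apply: cring_ext => R v vX; rewrite !cevs // scalerA. Qed.
Fact cscale1 : left_id 1 cscale.
Proof. by move=> x; apply: cring_ext => R v vX; rewrite !cevs // scale1r. Qed.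
Fact cscaleDr : right_distributive cscale cadd.
Proof. by move=> a x y; apply: cring_ext => R v vX; rewrite !cevs // scalerDr. Qed.
Fact cscaleDl x : {morph cscale^~ x : a b / a + b >-> cadd a b}.
Proof. by move=> a b; apply: cring_ext => R v vX; rewrite !cevs // scalerDl. Qed.
HB.instance Definition _ := GRing.Zmodule_isLmodule.Build k cring
  cscaleA cscale1 cscaleDr cscaleDl.

Fact cscaleAl (a : k) (x y : cring) : a *: (x * y) = a *: x * y.
Proof.
suff : cscale a (cmul x y) = cmul (cscale a x) y by [].
by apply: cring_ext => R v vX; rewrite !cevs // scalerAl.
Qed.
HB.instance Definition _ := GRing.Lmodule_isLalgebra.Build k cring cscaleAl.
Fact cscaleAr (a : k) (x y : cring) : a *: (x * y) = x * (a *: y).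
Proof. by rewrite mulrC cscaleAl mulrC. Qed.
HB.instance Definition _ := GRing.Lalgebra_isAlgebra.Build k cring cscaleAr.

Definition cvar (i : I) : cring := cpi (PVar i).

Lemma cring_peval (t : pterm) : peval cvar t = cpi t.
Proof.
elim: t => [c|i|s IHs t IHt|s IHs t IHt] //=; rewrite ?IHs ?IHt.
- suff : cscale c (cpi (PConst 1)) = cpi (PConst c) by [].
  by apply: cring_ext => R v vX; rewrite !cevs // scalerA mulr1.
- suff : cadd (cpi s) (cpi t) = cpi (PAdd s t) by [].
  by apply: cring_ext => R v vX; rewrite !cevs // !cevE.
suff : cmul (cpi s) (cpi t) = cpi (PMul s t) by [].
by apply: cring_ext => R v vX; rewrite !cevs // !cevE.
Qed.

Lemma cring_morP (R : comAlgType k) (f : {lrmorphism cring -> R}) t :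
  f (cpi t) = peval (f \o cvar) t.
Proof. by rewrite -cring_peval peval_map. Qed.

Lemma cev_lrmorphism (R : comAlgType k) (v : I -> R) : X v ->
  exists f : {lrmorphism cring -> R}, f =1 cev v.
Proof.
move=> vX.
have fB : zmod_morphism (cev v).
  by move=> x y; rewrite [LHS](cevD vX) [X in _ + X](cevN vX).
have fM : monoid_morphism (cev v).
  by split=> [|x y]; [rewrite [LHS](cevC vX) scale1r | exact: (cevM vX)].
have fZ : scalable (cev v) by move=> c x; exact: (cevZ vX).
pose f : {lrmorphism cring -> R} := HB.pack (cev v)
  (GRing.isZmodMorphism.Build cring R (cev v) fB)
  (GRing.isMonoidMorphism.Build cring R (cev v) fM)
  (GRing.isScalable.Build k cring R *:%R (cev v) fZ).
by exists f.
Qed.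

Lemma cring_fg : finitely_generated (cring : comAlgType k).
Proof.
exists [seq cvar i | i <- enum I] => B [B1 Blin BM] Bs q.
have B0 : 0 \in B by have := Blin (-1) 1 1 B1 B1; rewrite scaleN1r addNr.
rewrite -[q]creprK -cring_peval.
elim: (crepr q) => [c|i|s IHs t IHt|s IHs t IHt] /=.
- by have := Blin c 1 0 B1 B0; rewrite addr0.
- by apply: Bs; apply: map_f; rewrite mem_enum.
- by have := Blin 1 _ _ IHs IHt; rewrite scale1r.
exact: BM.
Qed.

(* X is cut out by equations: the hypothesis on a and b says that they get
   identified once the equations of X are imposed on w. *)
Hypothesis Xclosed : forall (A : comAlgType k) (w : I -> A),
  (forall a b : A, (forall (R : comAlgType k) (f : {lrmorphism A -> R}),
      X (f \o w) -> f a = f b) -> a = b) -> X w.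

(** The universal point satisfies the equations because elements of [cring] are separated by the
    points of X. *)
Lemma cvarX : X cvar.
Proof.
apply: Xclosed => a b ab; apply: cring_ext => R v vX.
have [f fE] := cev_lrmorphism vX; rewrite -!fE; apply: ab.
suff -> : f \o cvar = v by [].
by apply/funext=> i; rewrite /= fE cevE.
Qed.

Lemma affine_of_equations (G : kgroup k) (pt : forall R : comAlgType k, G R -> I -> R) :
  (forall R, injective (pt R)) ->
  (forall (R : comAlgType k) (v : I -> R), X v <-> exists g : G R, pt R g = v) ->
  (forall (R S : comAlgType k) (f : {lrmorphism R -> S}) (g : G R),
     pt S (pmap f g) = f \o pt R g) ->
  affine_algebraic G.
Proof.
move=> ptI ptX ptN; exists (cring : comAlgType k); first exact: cring_fg.
have ex (R : comAlgType k) (f : {lrmorphism cring -> R}) : exists g : G R, pt R g = f \o cvar.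
  by apply/ptX; apply: Xmap; exact: cvarX.
pose phi (R : comAlgType k) (f : {lrmorphism cring -> R}) : G R := projT1 (cid (ex R f)).
have phiP (R : comAlgType k) (f : {lrmorphism cring -> R}) : pt R (phi R f) = f \o cvar.
  by rewrite /phi; case: cid.
exists phi; split=> [R|R S f a]; last by apply: ptI; rewrite ptN !phiP.
apply: inj_surj_bijective => [a b /(congr1 (pt R))|g].
  rewrite !phiP => ab; apply: lrmorphism_ext => q.
  by rewrite -[q]creprK !cring_morP ab.
have gX : X (pt R g) by apply/ptX; exists g.
have [f fE] := cev_lrmorphism gX; exists f; apply: ptI; rewrite phiP.
by apply/funext=> i; rewrite /= fE cevE.
Qed.

End CoordinateRing.

Lemma SO_affine (k : fieldType) (Q : tqform k) : affine_algebraic (SO Q).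
Proof.
pose mxof (R : comAlgType k) (v : 'I_3 * 'I_3 -> R) : 'M[R]_3 := \matrix_(i, j) v (i, j).
pose X (R : comAlgType k) (v : 'I_3 * 'I_3 -> R) : Prop :=
  qcomp (qmap (in_alg R) Q) (mxof R v) = qmap (in_alg R) Q /\ \det (mxof R v) = 1.
have mxofN (R S : comAlgType k) (f : {lrmorphism R -> S}) v :
    mxof S (f \o v) = map_mx f (mxof R v).
  by apply/matrixP=> i j; rewrite !mxE.
have Xmap (R S : comAlgType k) (f : {lrmorphism R -> S}) v : X R v -> X S (f \o v).
  move=> [vQ v1]; rewrite /X mxofN -(qmap_algin Q f) -qmap_qcomp vQ.
  by rewrite det_map_mx v1 rmorph1.
pose v0 (ij : 'I_3 * 'I_3) : k^o := (ij.1 == ij.2)%:R.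
have Xv0 : X (k^o) v0.
  have e1 : mxof (k^o) v0 = 1%:M by apply/matrixP=> i j; rewrite !mxE.
  by rewrite /X e1 qcomp1 det1.
pose pt (R : comAlgType k) (h : SO Q R) (ij : 'I_3 * 'I_3) : R := GLmx (val h) ij.1 ij.2.
have ptK (R : comAlgType k) (h : SO Q R) : mxof R (pt R h) = GLmx (val h).
  by apply/matrixP=> i j; rewrite mxE.
apply: (@affine_of_equations k _ X Xmap v0 Xv0 _ (SO Q) pt).
- move=> A w sep; split; last first.
    by apply: sep => R f [_]; rewrite mxofN det_map_mx => ->; rewrite rmorph1.
  (* The equality of forms is split into its six coefficients, each a function [p] that commutes
     with base change. *)
  have sepq (p : forall R : comNzRingType, tqform R -> R) :
      (forall (R S : comNzRingType) (f : {rmorphism R -> S}) q, p S (qmap f q) = f (p R q)) ->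
      p _ (qcomp (qmap (in_alg A) Q) (mxof A w)) = p _ (qmap (in_alg A) Q).
    move=> pN; apply: sep => R f [fQ _]; rewrite -!pN qmap_qcomp qmap_algin.
    by rewrite -mxofN fQ.
  move: sepq; case: (qcomp _ _) => a b c d e g sepq; rewrite /qmap.
  by congr TQForm; [apply: (sepq (@qa)) | apply: (sepq (@qb)) | apply: (sepq (@qc))
    | apply: (sepq (@qd)) | apply: (sepq (@qe)) | apply: (sepq (@qf))].
- move=> R g h gh; apply: val_inj; apply: GLmx_inj.
  by rewrite -!ptK gh.
- move=> R v; split=> [[vQ v1]|[g <-]]; last by rewrite /X ptK; exact/asboolP/(valP g).
  have [g gE] := SO_of_mx vQ v1; exists g.
  by apply/funext=> -[i j]; rewrite /pt gE mxE.
by move=> R S f g; apply/funext=> -[i j]; rewrite /pt /GLmx /= !mxE.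
Qed.

(** * From isomorphic groups to similar forms *)

Lemma qmap_scale_descent (k K : fieldType) (iota : {rmorphism k -> K})
    (A B : tqform k) c :
  qmap iota A = qscale c (qmap iota B) -> exists d, A = qscale d B.
Proof.
have [l l1] := retraction_exists iota.
have lr a : l (iota a) = a by rewrite -[iota a]mulr1 fnalZ l1 mulr1.
case: A B => a1 a2 a3 a4 a5 a6 [b1 b2 b3 b4 b5 b6].
rewrite /qmap /qscale /= => -[e1 e2 e3 e4 e5 e6]; exists (l c).
by congr TQForm; rewrite -[LHS]lr ?(e1, e2, e3, e4, e5, e6) mulrC fnalZ mulrC.
Qed.

(** On tangent spaces the isomorphism is a matrix [T], which intertwines the adjoint
    representations, so [q'] transported by [T] is a form [P] invariant under SO(q). Over a field
    splitting q it is proportional to q, and the factor can be taken in k. *)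
Lemma SO_kiso_similar (k : fieldType) (q q' : tqform k) :
  Phi4 q != 0 -> Phi4 q' != 0 -> kiso (SO q) (SO q') -> similar q q'.
Proof.
move=> q0 q0' [phi [phib phiM phiN]].
have sF := isframe_kiso phib phiM phiN (SO_isframe q0).
have [T TU TE] := isframe_change sF (SO_isframe q0').
pose TR (R : comAlgType k) : 'M[R]_3 := map_mx (in_alg R) T.
pose TV (R : comAlgType k) : 'M[R]_3 := map_mx (in_alg R) (invmx T).
have TTV R : TR R *m TV R = 1%:M by rewrite -map_mxM mulmxV // map_mx1.
have TVT R : TV R *m TR R = 1%:M by rewrite -map_mxM mulVmx // map_mx1.
have phiE (R : comAlgType k) (h : SO q R) :
    GLmx (val (phi R h)) = (TV R)^T *m GLmx (val h) *m (TR R)^T.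
  have phiV : phi R h^-1%g = (phi R h)^-1%g := group_morV (phiM R) h.
  have := adrho_kiso phiM phiN (SO_isframe q0) (SO_isframe q0') TE (h^-1)%g.
  rewrite phiV.
  rewrite (adrho_SO q0).
  rewrite (adrho_SO q0').
  rewrite -/(TR R) => E.
  apply: trmx_inj; rewrite 2!trmx_mul !trmxK mulmxA.
  have {}E : TR R *m (GLmx (val h))^T = (GLmx (val (phi R h)))^T *m TR R := E.
  by rewrite E -mulmxA TTV mulmx1.
pose P := qcomp q' (invmx T)^T.
have PR (R : comAlgType k) : qmap (in_alg R) P = qcomp (qmap (in_alg R) q') (TV R)^T.
  by rewrite qmap_qcomp map_trmx.
have Pinv (R : comAlgType k) (h : SO q R) :
    qcomp (qmap (in_alg R) P) (GLmx (val h)) = qmap (in_alg R) P.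
  have /asboolP[+ _] := valP (phi R h); rewrite phiE => hq'.
  rewrite PR qcompM -[in RHS]hq' qcompM -!mulmxA.
  by rewrite -trmx_mul TVT trmx1 mulmx1.
have P0 : Phi4 P != 0.
  by rewrite Phi4_qcomp mulf_neq0 // expf_neq0 // det_tr -unitfE -unitmxE unitmx_inv.
have [K [iota [_ [c [g [c0 gU qE]]]]]] := split_separable q0.
(* Uniqueness of the invariant form is known for the split form only, hence the conjugation by [g]
   over K. *)
have PK : qcomp (qmap iota P) (invmx g) =
    qscale (qc (qcomp (qmap iota P) (invmx g))) (qsplit K).
  apply: invariant_form => R h; have /asboolP[hQ h1] := valP h.
  pose gR : 'M[R]_3 := map_mx (in_alg R) g.
  pose gV : 'M[R]_3 := map_mx (in_alg R) (invmx g).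
  have ggV : gR *m gV = 1%:M by rewrite -map_mxM mulmxV // map_mx1.
  have qR : qmap (in_alg R) (qmap iota q) = qscale (in_alg R c) (qcomp (qsplit R) gR).
    by rewrite qE qmap_qscale qmap_qcomp qmap_qsplit.
  rewrite qmap_qsplit in hQ.
  have [||h' h'E] := @SO_of_mx k q (resalg iota R) (gV *m GLmx (val h) *m gR : 'M[R]_3).
  - rewrite [LHS](_ : _ = qcomp (qmap (in_alg R) (qmap iota q)) (gV *m GLmx (val h) *m gR)) //.
    rewrite [RHS](_ : _ = qmap (in_alg R) (qmap iota q)) // qR qcomp_scale qcompM.
    by rewrite !mulmxA ggV mul1mx -[in LHS]qcompM hQ.
  - apply: (etrans (det_mulmx _ _)).
    rewrite det_mulmx h1 mulr1 -det_mulmx (mulmx1C ggV); exact: det1.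
  have := Pinv (resalg iota R) h'; rewrite h'E => E.
  have {}E : qcomp (qmap (in_alg R) (qmap iota P)) (gV *m GLmx (val h) *m gR)
    = qmap (in_alg R) (qmap iota P) := E.
  rewrite qmap_qcomp -/gV -[in RHS]E !qcompM -!mulmxA ggV mulmx1.
  by [].
set c' := qc _ in PK.
have PE : qmap iota P = qscale (c' / c) (qmap iota q).
  rewrite -[LHS]qcomp1 -(mulVmx gU) -qcompM PK qcomp_scale qE qscaleA.
  by rewrite divfK.
have [d dE] := qmap_scale_descent PE.
have d0 : d != 0.
  by apply: contraNneq P0 => d0; rewrite dE Phi4_qscale d0 expr0n mul0r.
exists d, T^T; split; rewrite ?unitmx_tr //.
by rewrite -qcomp_scale -dE qcompM -trmx_mul mulmxV // trmx1 qcomp1.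
Qed.

(** * The correspondence between orbits and forms of PGL_2 *)

Lemma stab_kform (k : fieldType) (x : Vspace k) : U x -> kform (PGL2 k) (stab x).
Proof.
move=> Ux; have [_ _ x2] := Ux; have xSO := kiso_stab_SO Ux.
split; first exact: affine_algebraic_kiso (kiso_sym xSO) (SO_affine _).
have [K [iota [sep sim]]] := split_separable x2; exists K, iota; split=> //.
apply: kiso_trans (kiso_base_change iota xSO) _.
apply: kiso_trans (SO_base_change iota (Phi3 x)) _.
apply: kiso_trans (kiso_sym (SO_similar sim)) _.
apply: kiso_sym; apply: kiso_trans (kiso_base_change iota (kiso_PGL2_SO k)) _.
by have := SO_base_change iota (qsplit k); rewrite qmap_qsplit.
Qed.

Lemma kform_stab (k : fieldType) (H : kgroup k) : kform (PGL2 k) H ->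
  exists2 x : Vspace k, U x & kiso H (stab x).
Proof.
case=> Haff [K [iota [_ Hiso]]].
have [|q q0 Hq] := @form_SO k K iota H Haff.
  apply: kiso_sym; apply: kiso_trans Hiso _.
  apply: kiso_trans (kiso_base_change iota (kiso_PGL2_SO k)) _.
  by have := SO_base_change iota (qsplit k); rewrite qmap_qsplit.
exists (nform q); first exact: U_nform.
exact: kiso_trans Hq (kiso_sym (kiso_stab_nform q0)).
Qed.

Lemma kiso_stab_orbit (k : fieldType) (x y : Vspace k) : U x -> U y ->
  kiso (stab x) (stab y) -> Gorbit x = Gorbit y.
Proof.
move=> Ux Uy xy; have [_ _ x2] := Ux; have [_ _ y2] := Uy.
have sim : similar (Phi3 x) (Phi3 y).
  apply: SO_kiso_similar => //; apply: kiso_trans (kiso_sym (kiso_stab_SO Ux)) _.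
  exact: kiso_trans xy (kiso_stab_SO Uy).
by have [g <-] := orbit_similar Ux Uy sim; rewrite Gorbit_act.
Qed.

Lemma isoclass_eq (k : fieldType) (G H : kgroup k) : kiso G H -> isoclass G = isoclass H.
Proof.
move=> GH; apply/funext=> L; apply/propext; split; last exact: kiso_trans.
exact/kiso_trans/kiso_sym.
Qed.

Lemma sig_eq (A : Type) (P : A -> Prop) (u v : {x | P x}) : sval u = sval v -> u = v.
Proof. by case: u v => [x xP] [y yP] /= xy; exact: eq_exist. Qed.

Theorem proposition9p14 (k : fieldType) :
  exists f : orbits k -> Prg2 k,
    bijective f /\
    forall (x : Vspace k) (Ux : U x),
      kform (PGL2 k) (stab x) /\ sval (f (orbit_of Ux)) = isoclass (stab x).
Proof.
have rep (O : orbits k) : {x | U x /\ sval O = Gorbit x}.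
  by apply: cid; have [x Ux OE] := svalP O; exists x.
have repU O : U (sval (rep O)) by have [] := svalP (rep O).
have repO O : sval O = Gorbit (sval (rep O)) by have [] := svalP (rep O).
pose f (O : orbits k) : Prg2 k := exist _ (isoclass (stab (sval (rep O))))
  (ex_intro2 _ _ (stab (sval (rep O))) (stab_kform (repU O)) erefl).
(* The class does not depend on the chosen representative, since stabilizers along an orbit are
   conjugate. *)
have fE x (Ux : U x) : sval (f (orbit_of Ux)) = isoclass (stab x).
  apply: isoclass_eq; have /= := repO (orbit_of Ux).
  set y := sval _ => xy.
  have [g _ <-] : Gorbit y x by rewrite -xy; exact: GorbitE.
  exact: kiso_stab_act.
exists f; split=> [|x Ux]; last by split; [exact: stab_kform | exact: fE].
apply: inj_surj_bijective => [O O' /(congr1 sval)/= OO'|C].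
  apply: sig_eq; rewrite repO [RHS]repO; apply: kiso_stab_orbit => //.
  have : isoclass (stab (sval (rep O'))) (stab (sval (rep O'))) by exact: kiso_refl.
  by rewrite -OO'.
have [H Hform CE] := svalP C; have [x Ux Hx] := kform_stab Hform.
exists (orbit_of Ux); apply: sig_eq; rewrite fE CE.
exact/esym/isoclass_eq.
Qed.
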